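(* For all integers $n\ge 0$, $$f(2750n+825)\equiv 0 \pmod{11}\quad\text{and}\quad f(2750n+1925)\equiv 0 \pmod{11}.$$
   Context: For $n\ge 0$, let $f(n)$ denote the number of 1-shell totally symmetric plane partitions of weight $n$. Equivalently, $f$ is defined by the generating function $$\sum_{n\ge 0}f(n)q^n=1+\sum_{n\ge 1}q^{3n-2}\prod_{i=0}^{n-2}\left(1+q^{6i+3}\right).$$ (A plane partition is an array of nonnegative integers $\pi_{i,j}$ weakly decreasing in both indices; it is totally symmetric if invariant under all permutations of the three axes; it is 1-shell if its first row/column is a self-conjugate partition and all other nonzero entries equal 1; its weight is the sum of its entries.) *)

(* Defs.v *)
From mathcomp Require Import all_boot all_fingroup.

Set Implicit Arguments.
Unset Strict Implicit.
Unset Printing Implicit Defensive.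

(* Indices start at 0.  A plane partition of weight n has all its nonzero     *)
(* entries in the first n rows and columns, and all its entries are at most n, *)
(* so nothing is lost by using n x n arrays with entries in {0, ..., n}.      *)
Definition array (n : nat) := {ffun 'I_n * 'I_n -> 'I_n.+1}.

Definition weight (n : nat) (pi : array n) : nat := \sum_x pi x.

Definition plane_partition (n : nat) (pi : array n) : bool :=
  [forall i : 'I_n, forall j : 'I_n, forall k : 'I_n,
     (j <= k) ==> (pi (i, k) <= pi (i, j)) && (pi (k, i) <= pi (j, i))].

(* The solid diagram of pi is the set of boxes (x_0, x_1, x_2) such that      *)
(* x_2 < pi_(x_0, x_1).                                                       *)
Definition in_diagram (n : nat) (pi : array n) (x : {ffun 'I_3 -> 'I_n}) : bool :=
  x (@Ordinal 3 2 isT) < pi (x (@Ordinal 3 0 isT), x (@Ordinal 3 1 isT)).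

Definition totally_symmetric (n : nat) (pi : array n) : bool :=
  [forall s : 'S_3, forall x : {ffun 'I_3 -> 'I_n},
     in_diagram pi [ffun a => x (s a)] == in_diagram pi x].

(* The k-th part of the conjugate of l is the number of parts of l exceeding k. *)
Definition self_conjugate (n : nat) (l : 'I_n -> nat) : bool :=
  [forall k : 'I_n, #|[set j : 'I_n | k < l j]| == l k].

Definition one_shell (n : nat) (pi : array n) : bool :=
  [forall i : 'I_n, (i == 0 :> nat) ==>
     self_conjugate (fun j => pi (i, j)) && self_conjugate (fun j => pi (j, i))]
  && [forall i : 'I_n, forall j : 'I_n,
     [&& i != 0 :> nat, j != 0 :> nat & pi (i, j) != 0 :> nat]
       ==> (pi (i, j) == 1 :> nat)].

Definition num_1shell_tspp (n : nat) : nat :=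
  #|[set pi : array n |
      [&& plane_partition pi, totally_symmetric pi, one_shell pi
        & weight pi == n]]|.

(* Main.v *)
Require Import Defs.
(**
The floor of a 1-shell totally symmetric plane partition is a symmetric Young
diagram which determines it; removing hooks shows that [f (3 m + 1)] is the
coefficient of [q^m] in [H(q) = sum_k q^k (-q; q^2)_k], and [f] vanishes at the
positive integers not congruent to 1 modulo 3.  The two series [H(q)] and [H(-q)]
are the two halves of a bilateral sum, which gives
[H(q) + H(-q) = 2 psi(q^2) (-q^2; q^2)_oo], so [f (6 m + 1)] is the coefficient of
[q^m] in the eta quotient [g = E_2^3 / E_1^2], where [E_s = (q^s; q^s)_oo].

The theta functions [psi(q^2)], [phi(q)] and [phi(-q)] satisfy Halphen's
differential system, hence on polynomials in them and in one logarithmic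
derivative [W], [D = q d/dq] is an explicit derivation.  Modulo 11 we have
[D^11 = D]; this forces the square of the Hasse invariant to be 1 and makes [W] a
polynomial in the theta functions, after which Cartier's projection [1 - (D + 2)^10] of [g] onto
the exponents 9 modulo 11 is a finite computation.  It gives
[g_(11 m + 9) = 16^9 [q^m] phi(-q) E_2^10] modulo 11.

Rotations of lattices turn [24 phi(-q) E_2^10] into a theta series of the form
[u^2 + v^2 + 6 k^2] with a harmonic weight of degree 4 and a character, the
coefficient of [q^m] being the sum over the vectors of norm [6 m + 5].  When
[6 m + 5 = 25 n] with [n = 2] or [3] modulo 5, these vectors are the disjoint
images of the vectors of norm [n] under scaling by 5 and six similitudes, along
which the weight sums to [625 + 794 = 11 * 129] times its value at [n].
*)

(* The arguments [2750 n + 825] and [2750 n + 1925] are the numbers [275 n'] with [n'] odd and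
   congruent to 3 or 2 modulo 5. Unless [f] vanishes there by the condition modulo 3,
   [275 n' = 6 (11 m + 9) + 1] with [6 m + 5 = 25 n']. So the factor 11 is absorbed by Cartier's
   projection, 9 being the root of [6 r + 1 = 0] modulo 11, and the factor 25 by what is in
   substance a Hecke operator at 5. The classes 2 and 3 are the nonsquares modulo 5: an overlap
   between the seven families of vectors would make the norm [n'] a square modulo 5.

   The product [phi(-q) E_2^10] has weight [11/2 = 3/2 + 4], which is why a ternary form with a
   harmonic polynomial of degree 4 fits it. No theory of modular forms enters: each relation between
   theta functions is a change of variables in a lattice sum, and working over [F_11] from the start
   makes 2 and 3 invertible. *)
From HB Require Import structures.
From mathcomp Require Import all_boot all_order all_algebra all_fingroup.
From mathcomp Require Import boolp classical_sets functions cardinality fsbigop.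
From mathcomp Require Import ring zify.
Set Implicit Arguments.
Unset Strict Implicit.
Unset Printing Implicit Defensive.
Import Order.TTheory GRing.Theory Num.Theory.

(** * Formal power series *)

Section PowerSeries.
Local Open Scope ring_scope.

Record fps (R : Type) := Fps { cf : nat -> R }.
HB.instance Definition _ (R : Type) := gen_eqMixin (fps R).
HB.instance Definition _ (R : Type) := gen_choiceMixin (fps R).

Lemma fpsP (R : Type) (f g : fps R) : cf f =1 cf g -> f = g.
Proof. by case: f g => [f] [g] /= /funext ->. Qed.

Section Zmodule.
Variable R : zmodType.
Implicit Types f g : fps R.

Definition fps_add f g := Fps (fun n => cf f n + cf g n).
Definition fps_opp f := Fps (fun n => - cf f n).
Definition fps_zero : fps R := Fps (fun=> 0).

Lemma fps_addA : associative fps_add.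
Proof. by move=> f g h; apply: fpsP => n /=; rewrite addrA. Qed.
Lemma fps_addC : commutative fps_add.
Proof. by move=> f g; apply: fpsP => n /=; rewrite addrC. Qed.
Lemma fps_add0 : left_id fps_zero fps_add.
Proof. by move=> f; apply: fpsP => n /=; rewrite add0r. Qed.
Lemma fps_addN : left_inverse fps_zero fps_opp fps_add.
Proof. by move=> f; apply: fpsP => n /=; rewrite addNr. Qed.

HB.instance Definition _ := GRing.isZmodule.Build (fps R)
  fps_addA fps_addC fps_add0 fps_addN.

End Zmodule.

Section Ring.
Variable R : comNzRingType.
Implicit Types f g : fps R.

Definition fps_mul f g := Fps (fun n => \sum_(i < n.+1) cf f i * cf g (n - i)).
Definition fps_one : fps R := Fps (fun n => (n == 0%N)%:R).
Definition fps_trunc N f : {poly R} := \poly_(i < N) cf f i.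

(** Coefficients of index below [N] depend only on truncations, so commutativity and associativity
    are inherited from [{poly R}]. *)
Lemma cf_mul_trunc N f g n : (n < N)%N ->
  cf (fps_mul f g) n = (fps_trunc N f * fps_trunc N g)`_n.
Proof.
move=> ltnN; rewrite coefM; apply: eq_bigr => i _.
by rewrite !coef_poly !ifT //; have := ltn_ord i; lia.
Qed.

Lemma coefM_trunc_congr (p p' r : {poly R}) n :
  (forall i, (i <= n)%N -> p`_i = p'`_i) -> (p * r)`_n = (p' * r)`_n.
Proof.
by move=> eqpp'; rewrite !coefM; apply: eq_bigr => i _; rewrite eqpp' // -ltnS.
Qed.

Lemma fps_mulC : commutative fps_mul.
Proof. by move=> f g; apply: fpsP => n; rewrite !(@cf_mul_trunc n.+1) // mulrC. Qed.

Lemma fps_mulA : associative fps_mul.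
Proof.
move=> f g h; apply: fpsP => n; rewrite !(@cf_mul_trunc n.+1) //.
rewrite [in LHS]mulrC.
transitivity ((fps_trunc n.+1 g * fps_trunc n.+1 h * fps_trunc n.+1 f)`_n).
  apply: coefM_trunc_congr => i lein.
  by rewrite coef_poly ltnS lein (@cf_mul_trunc n.+1).
rewrite mulrC mulrA; apply: coefM_trunc_congr => i lein.
by rewrite [RHS]coef_poly ltnS lein (@cf_mul_trunc n.+1).
Qed.

Lemma fps_mul1 : left_id fps_one fps_mul.
Proof.
move=> f; apply: fpsP => n /=; rewrite big_ord_recl /= mul1r subn0.
by rewrite big1 ?addr0 // => i _; rewrite mul0r.
Qed.

Lemma fps_mulDl : left_distributive fps_mul (@fps_add R).
Proof.
move=> f g h; apply: fpsP => n /=; rewrite -big_split /=.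
by apply: eq_bigr => i _; rewrite mulrDl.
Qed.

Lemma fps_one_neq0 : fps_one != 0 :> fps R.
Proof. by apply/eqP => /(congr1 (fun f => cf f 0)) /= /eqP; rewrite oner_eq0. Qed.

HB.instance Definition _ := GRing.Zmodule_isComNzRing.Build (fps R)
  fps_mulA fps_mulC fps_mul1 fps_mulDl fps_one_neq0.

Lemma cfD f g n : cf (f + g) n = cf f n + cf g n. Proof. by []. Qed.
Lemma cfN f n : cf (- f) n = - cf f n. Proof. by []. Qed.
Lemma cfB f g n : cf (f - g) n = cf f n - cf g n. Proof. by []. Qed.
Lemma cf1 n : cf (1 : fps R) n = (n == 0%N)%:R. Proof. by []. Qed.
Lemma cfM f g n : cf (f * g) n = \sum_(i < n.+1) cf f i * cf g (n - i).
Proof. by []. Qed.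
Lemma cf_sum I (r : seq I) (P : pred I) (F : I -> fps R) n :
  cf (\sum_(i <- r | P i) F i) n = \sum_(i <- r | P i) cf (F i) n.
Proof. by elim/big_rec2: _ => // i x f _ <-. Qed.
Lemma cf0M f g : cf (f * g) 0 = cf f 0 * cf g 0.
Proof. by rewrite cfM big_ord_recl big_ord0 addr0. Qed.
Lemma cf0X f n : cf (f ^+ n) 0 = cf f 0 ^+ n.
Proof. by elim: n => [|n IH]; rewrite ?expr0 // !exprS cf0M IH. Qed.

Definition qX : fps R := Fps (fun n => (n == 1%N)%:R).

Lemma cf_qXM f n : cf (qX * f) n = if n is m.+1 then cf f m else 0.
Proof.
case: n => [|n]; first by rewrite cf0M mul0r.
rewrite cfM !big_ord_recl /= mul0r add0r mul1r big1 ?addr0 ?subSS ?subn0 //.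
by move=> i _; rewrite mul0r.
Qed.

Lemma cf_qXnM k f n : cf (qX ^+ k * f) n = if (n < k)%N then 0 else cf f (n - k).
Proof.
elim: k n => [|k IH] n; first by rewrite mul1r subn0.
by rewrite exprS -mulrA cf_qXM; case: n => [|n] //; rewrite IH.
Qed.

Lemma cf_qXn k n : cf (qX ^+ k) n = (n == k)%:R.
Proof.
rewrite -[_ ^+ k]mulr1 cf_qXnM cf1 subn_eq0.
by case: ltngtP.
Qed.

Lemma qXn_reg k f g : qX ^+ k * f = qX ^+ k * g -> f = g.
Proof.
move=> eqfg; apply: fpsP => n; move/(congr1 (fun f => cf f (n + k))): eqfg.
by rewrite !cf_qXnM ltnNge leq_addl /= addnK.
Qed.

Definition fps_const (c : R) : fps R := Fps (fun n => if n == 0%N then c else 0).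

Lemma cf_constM c f n : cf (fps_const c * f) n = c * cf f n.
Proof.
rewrite cfM big_ord_recl /= subn0 big1 ?addr0 // => i _.
by rewrite mul0r.
Qed.

Lemma fps_const_is_additive : {morph fps_const : x y / x - y}.
Proof. by move=> x y; apply: fpsP => -[|n] //=; rewrite subr0. Qed.
HB.instance Definition _ :=
  GRing.isZmodMorphism.Build R (fps R) fps_const fps_const_is_additive.

Lemma fps_const_is_multiplicative : monoid_morphism fps_const.
Proof.
split; first by apply: fpsP => -[].
by move=> x y; apply: fpsP => n; rewrite cf_constM /=; case: ifP; rewrite ?mulr0.
Qed.
HB.instance Definition _ :=
  GRing.isMonoidMorphism.Build R (fps R) fps_const fps_const_is_multiplicative.

(** Congruence modulo [q^N]. It plays the part of the q-adic topology: an identity between infinite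
    sums or products is proved modulo every [q^N], where they become finite, and concluded by
    [eqm_all]. *)
Definition eqm N f g := forall n, (n < N)%N -> cf f n = cf g n.

Lemma eqm_refl N f : eqm N f f. Proof. by []. Qed.
Lemma eqm_sym N f g : eqm N f g -> eqm N g f.
Proof. by move=> fg n /fg. Qed.
Lemma eqm_trans N g f h : eqm N f g -> eqm N g h -> eqm N f h.
Proof. by move=> fg gh n ltnN; rewrite fg ?gh. Qed.
Lemma eqm_le M N f g : (M <= N)%N -> eqm N f g -> eqm M f g.
Proof. by move=> leMN fg n ltnM; apply: fg; apply: leq_trans leMN. Qed.
Lemma eqm_all f g : (forall N, eqm N f g) -> f = g.
Proof. by move=> fg; apply: fpsP => n; apply: (fg n.+1). Qed.
Lemma eqmD N f f' g g' : eqm N f f' -> eqm N g g' -> eqm N (f + g) (f' + g').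
Proof. by move=> ff gg n ltnN; rewrite !cfD ff ?gg. Qed.
Lemma eqmN N f f' : eqm N f f' -> eqm N (- f) (- f').
Proof. by move=> ff n ltnN; rewrite !cfN ff. Qed.
Lemma eqmM N f f' g g' : eqm N f f' -> eqm N g g' -> eqm N (f * g) (f' * g').
Proof.
move=> ff gg n ltnN; rewrite !cfM; apply: eq_bigr => i _.
by rewrite ff ?gg //; have := ltn_ord i; lia.
Qed.
Lemma eqmX N f f' k : eqm N f f' -> eqm N (f ^+ k) (f' ^+ k).
Proof. by move=> ff; elim: k => // k IH; rewrite !exprS; apply: eqmM. Qed.
Lemma eqm_sum N I (r : seq I) (P : pred I) (F G : I -> fps R) :
  (forall i, P i -> eqm N (F i) (G i)) ->
  eqm N (\sum_(i <- r | P i) F i) (\sum_(i <- r | P i) G i).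
Proof.
move=> FG; elim/big_rec2: _ => // i x y Pi xy; exact: eqmD (FG _ Pi) xy.
Qed.
Lemma eqm_prod N I (r : seq I) (P : pred I) (F G : I -> fps R) :
  (forall i, P i -> eqm N (F i) (G i)) ->
  eqm N (\prod_(i <- r | P i) F i) (\prod_(i <- r | P i) G i).
Proof.
move=> FG; elim/big_rec2: _ => // i x y Pi xy; exact: eqmM (FG _ Pi) xy.
Qed.
Lemma eqm_qXn N k f : (N <= k)%N -> eqm N (qX ^+ k * f) 0.
Proof. by move=> leNk n ltnN; rewrite cf_qXnM (leq_trans ltnN leNk). Qed.
Lemma eqm_qXnM N k f g : eqm N f g -> eqm (k + N) (qX ^+ k * f) (qX ^+ k * g).
Proof.
move=> fg n ltn; rewrite !cf_qXnM; case: ltnP => // lekn.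
by apply: fg; rewrite ltn_subLR.
Qed.
(** The geometric series in [1 - f], cut off at the index that is read; it inverts [f] once the
    constant coefficient is 1. *)
Definition fps_inv f : fps R :=
  Fps (fun n => cf (\sum_(k < n.+1) (1 - f) ^+ k) n).

Lemma eqm_expr0 f k : cf f 0 = 0 -> eqm k (f ^+ k) 0.
Proof.
move=> f0; elim: k => // k IH [|n] ltn.
  by rewrite cf0X f0 expr0n.
rewrite exprS cfM big_ord_recl f0 mul0r add0r big1 // => i _.
by rewrite IH ?mulr0 // lift0; have := ltn_ord i; lia.
Qed.

Lemma mulfps_inv f : cf f 0 = 1 -> f * fps_inv f = 1.
Proof.
move=> f0; apply: eqm_all => N.
have u0 : cf (1 - f) 0 = 0 by rewrite cfB cf1 f0 subrr.
apply: (@eqm_trans N (f * \sum_(k < N) (1 - f) ^+ k)).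
  apply: eqmM => // n ltnN; rewrite /= !cf_sum -(subnKC ltnN) big_split_ord /=.
  rewrite [X in _ = _ + X]big1 ?addr0 // => i _.
  by rewrite (@eqm_expr0 (1 - f) (n.+1 + i)%N) // addSn ltnS leq_addr.
have -> : f * \sum_(k < N) (1 - f) ^+ k = 1 - (1 - f) ^+ N.
  by rewrite -[RHS]opprB subrX1 -mulNr; congr (_ * _); ring.
rewrite -[X in eqm _ _ X]subr0.
by apply: eqmD => //; apply/eqmN/eqm_expr0.
Qed.

(** This cancellation stands in for division by eta products, which have constant coefficient 1. *)
Lemma mulfps_inj f g h : cf f 0 = 1 -> f * g = f * h -> g = h.
Proof.
move=> f0 fgh; rewrite -[g]mul1r -[h]mul1r -(mulfps_inv f0) ![f * _]mulrC -!mulrA.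
by rewrite fgh.
Qed.

End Ring.
End PowerSeries.

(** * Theta series and infinite products *)

Section Operators.
Local Open Scope ring_scope.
Variable R : comNzRingType.
Implicit Types f g : fps R.

Definition qD f : fps R := Fps (fun n => n%:R * cf f n).

Lemma cf_qD f n : cf (qD f) n = n%:R * cf f n. Proof. by []. Qed.

Lemma qD_is_additive : {morph qD : f g / f - g}.
Proof. by move=> f g; apply: fpsP => n; rewrite /= mulrBr. Qed.
HB.instance Definition _ :=
  GRing.isZmodMorphism.Build (fps R) (fps R) qD qD_is_additive.

Lemma qDM f g : qD (f * g) = qD f * g + f * qD g.
Proof.
apply: fpsP => n; rewrite cf_qD cfD !cfM mulr_sumr -big_split /=.
apply: eq_bigr => i _; have lein : (i <= n)%N by rewrite -ltnS.
have -> : n%:R = i%:R + (n - i)%:R :> R by rewrite -natrD subnKC.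
by ring.
Qed.

Lemma qDX f n : qD (f ^+ n) = n%:R * f ^+ n.-1 * qD f.
Proof.
elim: n => [|n IH].
  by rewrite !mul0r; apply: fpsP => -[|n]; rewrite cf_qD cf1 ?mul0r ?mulr0.
rewrite exprS qDM IH -natr1; case: n {IH} => [|n] /=; first by ring.
by rewrite exprS; ring.
Qed.

Lemma qD_const c : qD (fps_const c) = 0.
Proof. by apply: fpsP => -[|n]; rewrite cf_qD /= ?mul0r ?mulr0. Qed.

Lemma qD_nat n : qD (n%:R : fps R) = 0.
Proof. by rewrite -[n%:R](rmorph_nat (@fps_const R)) qD_const. Qed.

Definition qneg f : fps R := Fps (fun n => (-1) ^+ n * cf f n).

Lemma cf_qneg f n : cf (qneg f) n = (-1) ^+ n * cf f n. Proof. by [].  Qed.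

Lemma qneg_is_additive : {morph qneg : f g / f - g}.
Proof. by move=> f g; apply: fpsP => n; rewrite /= mulrBr. Qed.
HB.instance Definition _ :=
  GRing.isZmodMorphism.Build (fps R) (fps R) qneg qneg_is_additive.

Lemma qneg_is_multiplicative : monoid_morphism qneg.
Proof.
split; first by apply: fpsP => -[|n]; rewrite /= ?mul1r ?mulr0.
move=> f g; apply: fpsP => n /=; rewrite mulr_sumr; apply: eq_bigr => i _.
have lein : (i <= n)%N by rewrite -ltnS.
have -> : (-1) ^+ n = (-1) ^+ i * (-1) ^+ (n - i) :> R by rewrite -exprD subnKC.
by ring.
Qed.
HB.instance Definition _ :=
  GRing.isMonoidMorphism.Build (fps R) (fps R) qneg qneg_is_multiplicative.

Lemma qD_qneg f : qD (qneg f) = qneg (qD f).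
Proof. by apply: fpsP => n /=; ring. Qed.

Lemma qneg_qX : qneg (qX R) = - qX R.
Proof.
by apply: fpsP => -[|[|n]]; rewrite cfN /= ?expr1 ?mulr1 ?mulr0 ?oppr0.
Qed.

Lemma qnegK : involutive qneg.
Proof. by move=> f; apply: fpsP => n; rewrite /= mulrA -expr2 sqrr_sign mul1r. Qed.

End Operators.

Section Theta.
Local Open Scope ring_scope.
Variable R : comNzRingType.

(* Sums over an index set need a summable exponent: finitely many terms of each *)
(* degree, since [\sum_(i \in A)] is 0 on a sum of infinite support.          *)
Definition summable (I : choiceType) (e : I -> nat) :=
  forall n, exists s : seq I, forall i, (e i <= n)%N -> i \in s.

Definition theta (I : choiceType) (e : I -> nat) (w : I -> R) : fps R :=
  Fps (fun n => \sum_(i \in [set` [pred i | e i == n]]) w i).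

Variable I : choiceType.
Implicit Types (e : I -> nat) (w : I -> R).

Lemma cf_theta e w n (s : seq I) :
  uniq s -> (forall i, e i = n -> i \in s) ->
  cf (theta e w) n = \sum_(i <- s | e i == n) w i.
Proof. by move=> us sn /=; rewrite -(@bigfs _ _ _ _ s) // => i /eqP /sn ->. Qed.

Lemma eqm_theta e w N (s : seq I) :
  uniq s -> (forall i, (e i < N)%N -> i \in s) ->
  eqm N (theta e w) (\sum_(i <- s) fps_const (w i) * qX R ^+ e i).
Proof.
move=> us sN n ltnN; rewrite (@cf_theta _ _ _ s) //; last first.
  by move=> i ein; apply: sN; rewrite ein.
rewrite cf_sum big_mkcond; apply: eq_bigr => i _.
by rewrite cf_constM cf_qXn eq_sym; case: eqP; rewrite ?mulr1 ?mulr0.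
Qed.

Lemma summable_seq e : summable e ->
  forall N, exists2 s : seq I, uniq s & forall i, (e i < N)%N -> i \in s.
Proof.
move=> pe N; have [s sP] := pe N; exists (undup s); first exact: undup_uniq.
by move=> i /ltnW /sP; rewrite mem_undup.
Qed.

Lemma eq_theta e e' w w' : e =1 e' -> w =1 w' -> theta e w = theta e' w'.
Proof. by move=> /funext -> /funext ->. Qed.

Lemma thetaD e w w' : summable e ->
  theta e (fun i => w i + w' i) = theta e w + theta e w'.
Proof.
move=> pe; apply: fpsP => n; have [s us sP] := summable_seq pe n.+1.
have sn i : e i = n -> i \in s by move=> ein; apply: sP; rewrite ein.
by rewrite cfD !(cf_theta _ us sn) big_split.
Qed.

Lemma thetaZ e w c : summable e ->
  theta e (fun i => c * w i) = fps_const c * theta e w.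
Proof.
move=> pe; apply: fpsP => n; have [s us sP] := summable_seq pe n.+1.
have sn i : e i = n -> i \in s by move=> ein; apply: sP; rewrite ein.
by rewrite cf_constM !(cf_theta _ us sn) mulr_sumr.
Qed.

Lemma thetaN e w : summable e -> theta e (fun i => - w i) = - theta e w.
Proof.
move=> se; rewrite -[RHS]mulN1r -(rmorph1 (@fps_const R)) -rmorphN -thetaZ //.
by apply: eq_theta => // i; rewrite mulN1r.
Qed.

Lemma qD_theta e w : summable e -> qD (theta e w) = theta e (fun i => (e i)%:R * w i).
Proof.
move=> pe; apply: fpsP => n; have [s us sP] := summable_seq pe n.+1.
have sn i : e i = n -> i \in s by move=> ein; apply: sP; rewrite ein.
rewrite cf_qD !(cf_theta _ us sn) mulr_sumr.
by apply: eq_bigr => i /eqP ->.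
Qed.

Lemma qneg_theta e w : summable e ->
  qneg (theta e w) = theta e (fun i => (-1) ^+ e i * w i).
Proof.
move=> pe; apply: fpsP => n; have [s us sP] := summable_seq pe n.+1.
have sn i : e i = n -> i \in s by move=> ein; apply: sP; rewrite ein.
rewrite cf_qneg !(cf_theta _ us sn) mulr_sumr.
by apply: eq_bigr => i /eqP ->.
Qed.

Lemma qXM_theta e w k : summable e ->
  qX R ^+ k * theta e w = theta (fun i => (k + e i)%N) w.
Proof.
move=> pe; apply: fpsP => n; have [s us sP] := summable_seq pe n.+1.
rewrite cf_qXnM (@cf_theta (fun i => k + e i)%N w n s) //; last first.
  by move=> i ein; apply: sP; rewrite -ein ltnS leq_addl.
case: ltnP => [ltnk|lekn].
  by rewrite big_pred0 // => i; apply/eqP; lia.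
rewrite (@cf_theta e w (n - k)%N s) //; last first.
  by move=> i ein; apply: sP; rewrite ein; lia.
by apply: eq_bigl => i; apply/eqP/eqP; lia.
Qed.

End Theta.

Section ThetaReindex.
Local Open Scope ring_scope.
Variable R : comNzRingType.
Variables I J : choiceType.

Lemma summable_comp (h : J -> I) (e : I -> nat) : injective h -> summable e ->
  summable (e \o h).
Proof.
move=> injh pe n; have [s sP] := pe n.
suff [t tP] : exists t : seq J, forall j, (h j \in s) -> j \in t.
  by exists t => j /= /sP /tP.
elim: {sP} s => [|i s [t tP]]; first by exists [::].
have [[j hj]|noj] := EM (exists j, h j = i).
  exists (j :: t) => k; rewrite !inE -hj => /orP[/eqP/injh ->|/tP ->].
    by rewrite eqxx.
  by rewrite orbT.
exists t => k; rewrite inE => /orP[/eqP hk|/tP //].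
by case: noj; exists k.
Qed.

(** Surjectivity is asked only on the support of [w]: a weight carrying a character lets a lattice
    sum be parametrized by a few residue classes. *)
Lemma theta_reindex (h : J -> I) (e : I -> nat) (w : I -> R) :
  summable e -> injective h -> (forall i, w i != 0 -> exists j, i = h j) ->
  theta e w = theta (e \o h) (w \o h).
Proof.
move=> pe injh surjh; apply: fpsP => n; have [s us sP] := summable_seq pe n.+1.
have sn i : e i = n -> i \in s by move=> ein; apply: sP; rewrite ein.
rewrite (cf_theta _ us sn).
have [t ut tP] := summable_seq (summable_comp injh pe) n.+1.
have tn j : e (h j) = n -> j \in t by move=> ehj; apply: tP; rewrite /= ehj.
rewrite (@cf_theta _ _ (e \o h) (w \o h) n t ut tn).
transitivity (\sum_(i <- map h t | e i == n) w i); last by rewrite big_map.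
rewrite -big_filter -[RHS]big_filter.
set s1 := [seq _ <- s | _]; set s2 := [seq _ <- map _ _ | _].
have us2 : uniq s2 by rewrite filter_uniq // map_inj_uniq.
have us1 : uniq s1 by exact: filter_uniq.
rewrite (bigID (fun i => i \in s2)) /= [X in _ + X]big_seq_cond.
rewrite [X in _ + X]big1 ?addr0; last first.
  move=> i /andP[]; rewrite !mem_filter => /andP[/eqP ein si].
  rewrite ein eqxx /= => /mapP nin; apply/eqP/negP => /negP/surjh [j ij].
  by case: nin; exists j => //; apply: tn; rewrite -ij.
rewrite -big_filter; apply: perm_big; apply: uniq_perm => //; first exact: filter_uniq.
move=> i; rewrite !mem_filter; case: eqP => //= ein.
case im: (i \in map h _) => //=.
by rewrite (sn i ein).
Qed.

Lemma theta_bij (h : J -> I) (e : I -> nat) (w : I -> R) :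
  summable e -> bijective h -> theta e w = theta (e \o h) (w \o h).
Proof.
move=> pe [k hK kK]; apply: theta_reindex => // [|i _]; first exact: can_inj hK.
by exists (k i).
Qed.

Lemma summableM (e1 : I -> nat) (e2 : J -> nat) :
  summable e1 -> summable e2 -> summable (fun ij : I * J => (e1 ij.1 + e2 ij.2)%N).
Proof.
move=> p1 p2 n; have [s sP] := p1 n; have [t tP] := p2 n.
exists [seq (i, j) | i <- s, j <- t] => -[i j] /= le.
by apply/allpairsP; exists (i, j); rewrite sP ?tP //=; lia.
Qed.

Lemma thetaM (e1 : I -> nat) (e2 : J -> nat) (w1 : I -> R) (w2 : J -> R) :
  summable e1 -> summable e2 ->
  theta e1 w1 * theta e2 w2 =
  theta (fun ij : I * J => (e1 ij.1 + e2 ij.2)%N) (fun ij => w1 ij.1 * w2 ij.2).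
Proof.
move=> p1 p2; apply: eqm_all => N.
have [s us sP] := summable_seq p1 N; have [t ut tP] := summable_seq p2 N.
apply: eqm_trans (eqmM (eqm_theta w1 us sP) (eqm_theta w2 ut tP)) _.
apply: eqm_sym; apply: eqm_trans (@eqm_theta _ _ _ _ _ [seq (i, j) | i <- s, j <- t] _ _) _.
- by apply: allpairs_uniq => // -[i j] [i' j'] _ _ [-> ->].
- move=> [i j] /= lt; apply/allpairsP; exists (i, j); rewrite sP ?tP //=; lia.
move=> n _; congr (cf _ n); rewrite big_allpairs mulr_suml.
apply: eq_bigr => i _; rewrite mulr_sumr; apply: eq_bigr => j _ /=.
by rewrite rmorphM exprD; ring.
Qed.

End ThetaReindex.

Section InfiniteProduct.
Local Open Scope ring_scope.
Variable R : comNzRingType.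
Implicit Types u v : nat -> fps R.
Local Notation q := (qX R).

(** Coefficient [n] is read off the first [n + 1] factors. This is the right value under [tends1],
    where the factor of index [i] is 1 modulo [q^(i+1)]. *)
Definition pinf u : fps R := Fps (fun n => cf (\prod_(i < n.+1) u i) n).

Definition tends1 u := forall i, eqm i.+1 (u i) 1.

Lemma eqm_pinf u N M : tends1 u -> (N <= M)%N -> eqm N (pinf u) (\prod_(i < M) u i).
Proof.
move=> u1 leNM n ltnN; rewrite [LHS]/=.
have [k ->] : exists k, M = (n.+1 + k)%N by exists (M - n.+1)%N; lia.
elim: k => [|k IH]; first by rewrite addn0.
rewrite addnS [in RHS]big_ord_recr IH /= -[X in cf X n = _]mulr1.
apply: (@eqmM R n.+1) => // m ltm; rewrite u1 //=.
by apply: leq_trans ltm _; lia.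
Qed.

Lemma pinfM u v : tends1 u -> tends1 v -> pinf (fun i => u i * v i) = pinf u * pinf v.
Proof.
move=> u1 v1; have uv1 : tends1 (fun i => u i * v i).
  by move=> i; rewrite -[1]mulr1; apply: eqmM.
apply: eqm_all => N; apply: eqm_trans (eqm_pinf uv1 (leqnn N)) _.
rewrite big_split; apply: eqm_sym.
by apply: eqmM; apply: eqm_pinf.
Qed.

Lemma eq_pinf u v : u =1 v -> pinf u = pinf v.
Proof. by move=> /funext ->. Qed.

Lemma pinf_parity u : tends1 u ->
  pinf u = pinf (fun i => u i.*2) * pinf (fun i => u i.*2.+1).
Proof.
move=> u1.
have ue : tends1 (fun i => u i.*2).
  by move=> i; apply: eqm_le (u1 _); rewrite ltnS -addnn leq_addr.
have uo : tends1 (fun i => u i.*2.+1).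
  by move=> i; apply: eqm_le (u1 _); rewrite -addnn; lia.
apply: eqm_all => N.
apply: eqm_trans (@eqm_pinf _ N N.*2 u1 _) _; first by rewrite -addnn leq_addr.
apply: eqm_sym; apply: eqm_trans (eqmM (eqm_pinf ue (leqnn N)) (eqm_pinf uo (leqnn N))) _.
move=> n _; congr (cf _ n); elim: N => [|N IH]; first by rewrite !big_ord0 mulr1.
by rewrite doubleS !big_ord_recr /= -IH; ring.
Qed.

Lemma cf0_pinf u : tends1 u -> cf (pinf u) 0 = 1.
Proof. by move=> u1; rewrite /= big_ord_recl big_ord0 mulr1 (u1 0%N). Qed.

Lemma tends1_qXn (c : fps R) (e : nat -> nat) :
  (forall i, (i < e i)%N) -> tends1 (fun i => 1 + c * q ^+ e i).
Proof.
move=> ei i; rewrite -[X in eqm _ _ X]addr0; apply: eqmD => //.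
by rewrite mulrC; apply: eqm_qXn.
Qed.

End InfiniteProduct.

(** * The Jacobi triple product *)

Section QBinomial.
Local Open Scope ring_scope.
Variables (R : comNzRingType) (Q : R).

(** Pascal's recursion is the definition because it makes sense over any commutative ring; the
    quotient formula appears, without division, as [qbinom_fact]. *)
Fixpoint qbinom (m k : nat) : R :=
  if k isn't k'.+1 then 1 else
  if m isn't m'.+1 then 0 else
  qbinom m' k' + Q ^+ k'.+1 * qbinom m' k'.+1.

Lemma qbinomS m k :
  qbinom m.+1 k.+1 = qbinom m k + Q ^+ k.+1 * qbinom m k.+1.
Proof. by []. Qed.

Lemma qbinom0 m : qbinom m 0 = 1. Proof. by case: m. Qed.
Lemma qbinom_small m k : (m < k)%N -> qbinom m k = 0.
Proof.
elim: m k => [|m IH] [|k] //= ltmk.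
by rewrite !IH ?mulr0 ?addr0 //; lia.
Qed.

(** The form homogeneous in [x] and [y] is applied with a power of [q] for [y], which clears the
    negative powers of a product centered at 0. *)
Lemma qbinomial_theorem m (x y : R) :
  \prod_(i < m) (y + x * Q ^+ i) =
  \sum_(k < m.+1) Q ^+ 'C(k, 2) * qbinom m k * x ^+ k * y ^+ (m - k).
Proof.
elim: m x => [|m IH] x.
  by rewrite big_ord0 big_ord_recl big_ord0 /= !expr0 !mulr1 addr0.
rewrite big_ord_recl expr0 mulr1.
under eq_bigr => i _ do rewrite lift0 exprS mulrA.
rewrite IH mulrDl !mulr_sumr.
rewrite [X in X + _]big_ord_recl [X in _ + X]big_ord_recr [RHS]big_ord_recl.
rewrite [in RHS]big_ord_recr !qbinom0 !subn0 !lift0.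
rewrite /= (@qbinom_small m m.+1) // mulr0 addr0 /bump /=.
rewrite -!addrA; congr (_ + _); first by rewrite !expr0 !mulr1 exprS; ring.
rewrite addrA; congr (_ + _); last first.
  by rewrite !subnn binS bin1 exprD !exprMn exprS; ring.
rewrite -big_split; apply: eq_bigr => i _ /=.
rewrite !add0n !add1n !subSS binS bin1.
have -> : (m - i = (m - i.+1).+1)%N by have := ltn_ord i; lia.
by rewrite exprD !exprMn !exprS; ring.
Qed.

Definition qfact m : R := \prod_(i < m) (1 - Q ^+ i.+1).

Lemma qbinom_fact m k : (k <= m)%N ->
  qfact k * qfact (m - k) * qbinom m k = qfact m.
Proof.
elim: m k => [|m IH] [|k] //= lekm.
- by rewrite /qfact !big_ord0 !mulr1.
- by rewrite subn0 mulr1 {1}/qfact big_ord0 mul1r.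
rewrite subSS mulrDr.
have qS n : qfact n.+1 = qfact n * (1 - Q ^+ n.+1).
  by rewrite /qfact big_ord_recr.
have [ltkm|lemk] := ltnP k m; last first.
  have -> : k = m by lia.
  rewrite (@qbinom_small m m.+1) // !mulr0 addr0 subnn qS -[in RHS](IH m) //.
  by rewrite subnn; ring.
have eqmk : (m - k = (m - k.+1).+1)%N by lia.
have h1 := IH k (ltnW ltkm); have h2 := IH k.+1 ltkm.
transitivity (qfact k * qfact (m - k) * qbinom m k * (1 - Q ^+ k.+1)
  + qfact k.+1 * qfact (m - k.+1) * qbinom m k.+1 * (Q ^+ k.+1 * (1 - Q ^+ (m - k)))).
  by rewrite qS eqmk qS; ring.
have QE : Q ^+ m.+1 = Q ^+ k.+1 * Q ^+ (m - k) by rewrite -exprD; congr (_ ^+ _); lia.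
by rewrite h1 h2 qS QE; ring.
Qed.

End QBinomial.
Arguments qbinom : simpl never.

Section IntegerSums.
Local Open Scope ring_scope.

Definition zrange N : seq int := [seq Posz k - Posz N | k <- iota 0 N.*2.+1].

Lemma zrange_uniq N : uniq (zrange N).
Proof. by rewrite map_inj_uniq ?iota_uniq // => i j; lia. Qed.

Lemma mem_zrange N (i : int) : (i \in zrange N) = (`|i| <= N)%N.
Proof.
apply/mapP/idP => [[k]|leiN]; first by rewrite mem_iota; lia.
by exists (absz (i + Posz N)); rewrite ?mem_iota; lia.
Qed.

Lemma summable_int c (e : int -> nat) : (forall i, (`|i| <= e i + c)%N) -> summable e.
Proof.
by move=> le n; exists (zrange (n + c)) => i lei; rewrite mem_zrange; have := le i; lia.
Qed.

Lemma sum_zrange (V : zmodType) N (F : int -> V) :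
  \sum_(i <- zrange N) F i = \sum_(k < N.*2.+1) F (Posz k - Posz N).
Proof. by rewrite big_map -[iota 0 _]/(index_iota 0 N.*2.+1) big_mkord. Qed.

(** Exponents of theta series are written through [tri]; the division-free [tri2] then reduces their
    identities to [ring] and [lia]. *)
Definition tri (n : int) : int := ((n * (n - 1)) %/ 2)%Z.

Lemma tri2 n : 2 * tri n = n * (n - 1).
Proof.
rewrite mulrC divzK //; apply/dvdz_mod0P.
have [m [r [-> rP]]] : exists m r : int, n = 2 * m + r /\ (r = 0 \/ r = 1).
  by exists (n %/ 2)%Z, (n %% 2)%Z; lia.
have -> : (2 * m + r) * (2 * m + r - 1) = 2 * (m * (2 * m + r - 1) + r * m) + r * (r - 1).
  by ring.
case: rP => ->; rewrite ?subrr ?mulr0 ?mul0r addr0.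
all: by rewrite modzMr.
Qed.

Lemma tri_ge0 n : 0 <= tri n.
Proof. by have := tri2 n; nia. Qed.

End IntegerSums.

Section TripleProduct.
Local Open Scope ring_scope.
Variable R : comNzRingType.
Local Notation q := (qX R).

Definition euler s : fps R := pinf (fun i => 1 - q ^+ (s * i.+1)).

Lemma tends1_euler s : (0 < s)%N -> tends1 (fun i => 1 - q ^+ (s * i.+1)).
Proof.
move=> s0; have -> : (fun i => 1 - q ^+ (s * i.+1)) = (fun i => 1 + (-1) * q ^+ (s * i.+1)).
  by apply/funext => i; ring.
by apply: tends1_qXn => i; nia.
Qed.

Lemma cf0_euler s : (0 < s)%N -> cf (euler s) 0 = 1.
Proof. by move=> s0; apply: cf0_pinf; apply: tends1_euler. Qed.

Lemma qfactE s m : qfact (q ^+ s) m = \prod_(i < m) (1 - q ^+ (s * i.+1)).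
Proof. by apply: eq_bigr => i _; rewrite exprM. Qed.

Lemma eqm_qfact s m : (0 < s)%N -> eqm m.+1 (euler s) (qfact (q ^+ s) m).
Proof.
move=> s0; have [u1 eul] := (tends1_euler s0, eqm_pinf (tends1_euler s0) (leqnn m.+1)).
apply: eqm_trans eul _; rewrite qfactE big_ord_recr /= -[X in eqm _ _ X]mulr1.
by apply: eqmM => //; apply: u1.
Qed.

Lemma eqm_qfact_le s m N : (0 < s)%N -> (N <= m.+1)%N -> eqm N (euler s) (qfact (q ^+ s) m).
Proof. by move=> s0 le; apply: (eqm_le le); apply: eqm_qfact. Qed.

(** With [Q = q^s] the q-binomial is [(Q)_(2n) / ((Q)_k (Q)_(2n-k))], hence close to [1 / E_s]; the
    error is governed by the smaller of [k] and [2n - k], which is [n - |k - n|]. *)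
Lemma euler_qbinom s n k : (0 < s)%N -> (k <= n.*2)%N ->
  eqm (n - absz (Posz k - Posz n)%R).+1%N (euler s * qbinom (q ^+ s) n.*2 k) 1.
Proof.
move=> s0 lek; set N := (_ - _).+1.
set f := fps_inv (euler s); have fE : f * euler s = 1.
  by rewrite mulrC mulfps_inv // cf0_euler.
have key := qbinom_fact (q ^+ s) lek.
have e1 : eqm N (euler s * (euler s * qbinom (q ^+ s) n.*2 k)) (euler s).
  apply: (@eqm_trans _ _ (qfact (q ^+ s) n.*2)); last first.
    by apply: eqm_sym; apply: eqm_qfact_le => //; rewrite /N; lia.
  rewrite -key mulrA; apply: eqmM => //.
  by apply: eqmM; apply: eqm_qfact_le => //; rewrite /N; lia.
have := eqmM (@eqm_refl _ N f) e1.
by rewrite mulrA fE mul1r.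
Qed.

End TripleProduct.

Section TripleProduct.
Local Open Scope ring_scope.
Variable R : comNzRingType.
Local Notation q := (qX R).

Lemma prod_geometric (c : fps R) (a s n : nat) :
  \prod_(i < n) (c * q ^+ (a + s * i)) = c ^+ n * q ^+ (a * n + s * 'C(n, 2)).
Proof.
elim: n => [|n IH]; first by rewrite big_ord0 !muln0 mulr1.
by rewrite big_ord_recr IH /= binS bin1 mulnS mulnDr !exprD exprSr; ring.
Qed.

(** The bound serves twice: theta exponents are nonnegative, so [absz] loses nothing, and for
    positive [a] and [b] they grow with [|l|], so the sums are summable. *)
Lemma triple_exponent_ge (a b : nat) (l : int) :
  minn a b * absz l <= Posz (a + b) * tri l + Posz a * l :> int.
Proof.
have [m [->|->]] : exists m : nat, l = Posz m \/ l = - Posz m.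
- by exists (absz l); lia.
- by have := tri_ge0 (Posz m); rewrite absz_nat; nia.
have t_ge : Posz m <= tri (- Posz m) by have := tri2 (- Posz m); nia.
have -> : absz (- Posz m) = m by lia.
have : Posz (a + b) * Posz m <= Posz (a + b) * tri (- Posz m) by nia.
have : (minn a b * m <= b * m)%N by rewrite leq_mul2r geq_minr orbT.
by lia.
Qed.

(** On the left is the exponent of the [k]-th term of the q-binomial theorem with [x = q^a] and
    [y = q^(s n)]. Recentering at [k = n] separates a part independent of [k], later cancelled, from
    the theta exponent. *)
Lemma center_exponent (a s n k : nat) (l := Posz k - Posz n) :
  0 <= Posz s * tri l + Posz a * l -> (k < n.*2.+1)%N ->
  (s * 'C(k, 2) + a * k + s * n * (n.*2 - k) =
   a * n + s * 'C(n, 2) + s * n * n + absz (Posz s * tri l + Posz a * l)%R)%N.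
Proof.
move=> ge0 ltk.
have b2 m : 2 * Posz 'C(m, 2) = Posz m * (Posz m - 1).
  elim: m => [|m IH]; first by [].
  by rewrite binS bin1 PoszD mulrDr IH; lia.
have := b2 k; have := b2 n; have := tri2 l; move=> e1 e2 e3.
have [j jE] : exists j, n.*2 = (k + j)%N by exists (n.*2 - k)%N; lia.
have -> : (n.*2 - k = j)%N by lia.
apply/eqP; rewrite -(eqr_nat int) !natz.
rewrite !PoszD !PoszM abszE ger0_norm //.
have jz : Posz j = 2 * Posz n - Posz k by lia.
apply/eqP; apply: (@mulfI _ (2 : int)) => //.
rewrite jz.
transitivity (Posz s * (2 * Posz 'C(k, 2)) + 2 * Posz a * Posz k
   + 2 * Posz s * Posz n * (2 * Posz n - Posz k)); first by ring.
transitivity (2 * Posz a * Posz n + Posz s * (2 * Posz 'C(n, 2))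
   + 2 * Posz s * Posz n * Posz n
   + (Posz s * (2 * tri l) + 2 * Posz a * l)); last by ring.
by rewrite e1 e2 e3 /l; ring.
Qed.

(* The factors [1 + c q^(b+si)] come from the low half of a q-binomial product *)
(* centered at n, after clearing the negative powers of q.                     *)
Lemma finite_triple_product (c : fps R) (a b n : nat) : c * c = 1 ->
  (\prod_(i < n) (1 + c * q ^+ (b + (a + b) * i))) *
  (\prod_(i < n) (1 + c * q ^+ (a + (a + b) * i))) =
  \sum_(k < n.*2.+1) qbinom (q ^+ (a + b)) n.*2 k *
    (c ^+ absz (Posz k - Posz n) *
     q ^+ absz (Posz (a + b) * tri (Posz k - Posz n) + Posz a * (Posz k - Posz n))).
Proof.
move=> cc; set s := (a + b)%N.
have := qbinomial_theorem (q ^+ s) n.*2 (c * q ^+ a) (q ^+ (s * n)).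
set Z := (a * n + s * 'C(n, 2) + s * n * n)%N.
have -> : \prod_(i < n.*2) (q ^+ (s * n) + c * q ^+ a * (q ^+ s) ^+ i) =
  q ^+ Z * (c ^+ n * ((\prod_(i < n) (1 + c * q ^+ (b + s * i))) *
  (\prod_(i < n) (1 + c * q ^+ (a + s * i))))).
  rewrite -addnn big_split_ord /=.
  rewrite [X in X * _](_ : _ = c ^+ n * q ^+ (a * n + s * 'C(n, 2)) *
      (\prod_(i < n) (1 + c * q ^+ (b + s * i)))); last first.
    rewrite -prod_geometric [X in _ = _ * X](reindex_inj rev_ord_inj) -big_split /=.
    apply: eq_bigr => i _ /=; have lt := ltn_ord i.
    have -> : (s * n = a + s * i + (b + s * (n - i.+1)))%N.
      have {1}-> : (n = i + (n - i.+1) + 1)%N by lia.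
      by rewrite /s; ring.
    rewrite -exprM !exprD mulrDr mulr1 addrC; congr (_ + _); first by rewrite mulrA.
    by rewrite [RHS]mulrACA cc mul1r.
  rewrite [X in _ * X](_ : _ = q ^+ (s * n * n) *
      (\prod_(i < n) (1 + c * q ^+ (a + s * i)))); last first.
    have -> : q ^+ (s * n * n) = \prod_(i < n) q ^+ (s * n).
      by rewrite prodr_const card_ord -exprM.
    rewrite -big_split; apply: eq_bigr => i _ /=.
    by rewrite -exprM mulnDr !exprD; ring.
  by rewrite /Z !exprD; ring.
rewrite [X in _ = X -> _](_ : _ = q ^+ Z * (c ^+ n *
   \sum_(k < n.*2.+1) qbinom (q ^+ s) n.*2 k *
    (c ^+ absz (Posz k - Posz n) *
     q ^+ absz (Posz s * tri (Posz k - Posz n) + Posz a * (Posz k - Posz n))))).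
  move/qXn_reg => eqc; have cn : c ^+ n * c ^+ n = 1.
    by rewrite -exprMn cc expr1n.
  by have := congr1 ( *%R (c ^+ n)) eqc; rewrite !(mulrA (c ^+ n) (c ^+ n)) cn !mul1r.
rewrite !mulr_sumr; apply: eq_bigr => k _.
set l := Posz k - Posz n.
have -> : c ^+ absz l = c ^+ n * c ^+ k.
  have [le|lt] := leqP n k.
    have -> : absz l = (k - n)%N by rewrite /l; lia.
    have -> : c ^+ k = c ^+ n * c ^+ (k - n) by rewrite -exprD subnKC.
    by rewrite mulrA -exprMn cc expr1n mul1r.
  have -> : absz l = (n - k)%N by rewrite /l; lia.
  have -> : c ^+ n = c ^+ k * c ^+ (n - k) by rewrite -exprD subnKC // ltnW.
  by rewrite mulrAC -exprMn cc expr1n mul1r.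
have ccn : c ^+ n * c ^+ n = 1 by rewrite -exprMn cc expr1n.
have ge0 : 0 <= Posz s * tri l + Posz a * l.
  by apply: le_trans (triple_exponent_ge a b l).
have eZ := center_exponent ge0 (ltn_ord k).
rewrite exprMn -!exprM.
transitivity (c ^+ k * qbinom (q ^+ s) n.*2 k *
  q ^+ (s * 'C(k, 2) + a * k + s * n * (n.*2 - k))).
  by rewrite !exprD; ring.
rewrite eZ exprD -{1}[c ^+ k]mul1r -ccn; ring.
Qed.

(** As [c * c = 1], the power [c ^+ absz l] is [c^l] for negative [l] too. *)
Lemma triple_product (c : R) (a b : nat) : c * c = 1 -> (0 < a)%N -> (0 < b)%N ->
  euler R (a + b) *
  pinf (fun i => (1 + fps_const c * q ^+ (b + (a + b) * i)) *
                 (1 + fps_const c * q ^+ (a + (a + b) * i))) =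
  theta (fun l => absz (Posz (a + b) * tri l + Posz a * l)) (fun l => c ^+ absz l).
Proof.
move=> cc a0 b0; set s := (a + b)%N; have s0 : (0 < s)%N by rewrite addn_gt0 a0.
have e_ge l : (absz l <= absz (Posz s * tri l + Posz a * l)%R)%N.
  have : (1 <= minn a b)%N by rewrite leq_min a0.
  by have := triple_exponent_ge a b l; nia.
have ua : tends1 (fun i => 1 + fps_const c * q ^+ (a + s * i)).
  by apply: tends1_qXn => i; nia.
have ub : tends1 (fun i => 1 + fps_const c * q ^+ (b + s * i)).
  by apply: tends1_qXn => i; nia.
rewrite (pinfM ub ua); apply: eqm_all => n.
apply: eqm_trans (eqmM (@eqm_refl _ n (euler R s)) (eqmM (eqm_pinf ub (leqnn n)) (eqm_pinf ua (leqnn n)))) _.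
rewrite finite_triple_product; last by rewrite -rmorphM cc rmorph1.
apply: eqm_sym; apply: eqm_trans (@eqm_theta _ _ _ _ _ (zrange n) (zrange_uniq n) _) _.
  by move=> l lt; rewrite mem_zrange; have := e_ge l; lia.
rewrite sum_zrange mulr_sumr; apply: eqm_sum => k _.
rewrite rmorphXn /= -/s; set l := Posz k - Posz n; set e := absz (Posz s * tri l + _); set C := _ ^+ absz l.
rewrite (_ : C * _ = q ^+ e * (C * 1)); last by ring.
rewrite (_ : euler R s * _ = q ^+ e * (C * (euler R s * qbinom (q ^+ s) n.*2 k))); last by ring.
(* The q-binomial is controlled only up to degree [n - |l|]; the factor [q^e] with [e >= |l|]
   supplies the missing [|l|] degrees. *)
apply: (@eqm_le _ _ (e + (n - absz l).+1)); first by have := e_ge l; rewrite -/e; lia.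
apply: eqm_qXnM; apply: eqmM => //; apply: eqm_sym; apply: euler_qbinom => //.
by rewrite -ltnS.
Qed.

End TripleProduct.

Section Jacobi.
Local Open Scope ring_scope.
Variable R : comNzRingType.
Local Notation q := (qX R).

Lemma qbinom_rmorph (S T : comNzRingType) (f : {rmorphism S -> T}) (Q : S) m k :
  qbinom (f Q) m k = f (qbinom Q m k).
Proof.
elim: m k => [|m IH] [|k]; rewrite ?qbinom0 ?rmorph1 //.
  by rewrite !qbinom_small ?rmorph0.
by rewrite !qbinomS !IH -rmorphXn -rmorphM -rmorphD.
Qed.

Lemma euler_cube_exponent_ge (s : nat) (l : int) : (0 < s)%N ->
  (absz l <= absz (Posz s * tri l)%R + 1)%N.
Proof.
move=> s0; have := tri2 l; have := tri_ge0 l => t0 t2.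
have : Posz (absz l) <= tri l + 1 by nia.
by nia.
Qed.

(* Jacobi's identity is the derivative at [z = -1] of the finite triple        *)
(* product, whose factor of index n vanishes there.                            *)
Lemma finite_jacobi s m (n := m.+1) :
  - (qfact (q ^+ s) n * qfact (q ^+ s) m) =
  \sum_(k < n.*2.+1) qbinom (q ^+ s) n.*2 k *
    (((-1) ^+ absz (Posz k - Posz n) * (Posz k - Posz n)%:~R) *
     q ^+ absz (Posz s * tri (Posz k - Posz n))).
Proof.
pose c k := q ^+ (s * 'C(k, 2) + s * n * (n.*2 - k)) * qbinom (q ^+ s) n.*2 k.
pose P : {poly fps R} := \sum_(k < n.*2.+1) (c k)%:P * 'X^k.
pose F i : {poly fps R} := (q ^+ (s * n))%:P + 'X * (q ^+ (s * i))%:P.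
pose A := \prod_(i < n) F i; pose B := \prod_(i < m) F (n + i.+1)%N.
have PE : P = A * (F n * B).
  have := qbinomial_theorem ((q ^+ s)%:P) n.*2 'X ((q ^+ (s * n))%:P).
  rewrite (_ : \sum_(k < _) _ = P); last first.
    apply: eq_bigr => k _; rewrite (qbinom_rmorph (@polyC (fps R))) /=.
    by rewrite -!rmorphXn -!exprM /c exprD !rmorphM /=; ring.
  move=> <-; rewrite (_ : \prod_(i < _) _ = \prod_(i < n + n) F i); last first.
    rewrite -addnn; apply: eq_bigr => i _; rewrite /F -rmorphXn -exprM; ring.
  rewrite big_split_ord /=; congr (_ * _); rewrite {1}/n big_ord_recl addn0.
  by congr (_ * _); apply: eq_bigr => i _; rewrite lift0.
set Z := (s * 'C(n, 2) + s * n * n)%N.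
have FE i : (F i).[-1] = q ^+ (s * n) - q ^+ (s * i).
  by rewrite /F !(hornerD, hornerM, hornerX, hornerC); ring.
have Fn : (F n).[-1] = 0 by rewrite FE subrr.
have AE : A.[-1] = (-1) ^+ n * q ^+ (s * 'C(n, 2)) * qfact (q ^+ s) n.
  rewrite /A horner_prod qfactE (_ : _ * q ^+ _ = \prod_(i < n) (-1 * q ^+ (0 + s * i))).
    rewrite [X in _ = _ * X](reindex_inj rev_ord_inj) -big_split; apply: eq_bigr => i _ /=.
    have lt := ltn_ord i.
    rewrite FE (_ : (n - i.+1).+1 = (n - i)%N); last by lia.
    have {1}-> : (s * n = s * i + s * (n - i))%N by rewrite -mulnDr subnKC // ltnW.
    by rewrite exprD; ring.
  by rewrite prod_geometric.
have BE : B.[-1] = q ^+ (s * n * m) * qfact (q ^+ s) m.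
  rewrite /B horner_prod qfactE.
  have -> : q ^+ (s * n * m) = \prod_(i < m) q ^+ (s * n).
    by rewrite prodr_const card_ord -exprM.
  by rewrite -big_split; apply: eq_bigr => i _; rewrite FE mulnDr exprD /=; ring.
have P0 : P.[-1] = 0 by rewrite PE hornerM hornerM Fn mul0r mulr0.
have P1 : P^`().[-1] = (-1) ^+ n * q ^+ Z * (qfact (q ^+ s) n * qfact (q ^+ s) m).
  rewrite PE derivM hornerD hornerM (hornerM _ (F n * B)^`()) (hornerM (F n) B) Fn derivM
    hornerD !(hornerM _ B) (hornerM _ B^`()) Fn AE BE.
  have -> : (F n)^`() = (q ^+ (s * n))%:P.
    by rewrite /F derivD derivC derivM derivX derivC; ring.
  have -> : Z = (s * 'C(n, 2) + (s * n + s * n * m))%N by rewrite /Z /n; ring.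
  by rewrite hornerC !exprD; ring.
have tri_l (k : 'I_n.*2.+1) : (s * 'C(k, 2) + s * n * (n.*2 - k) =
    Z + absz (Posz s * tri (Posz k - Posz n))%R)%N.
  have := @center_exponent 0 s n k; cbv zeta; rewrite (_ : Posz 0 = 0) // !mul0n !mul0r !addr0 addn0 add0n.
  by apply=> //; apply: mulr_ge0 => //; apply: tri_ge0.
set E := fun k : 'I_n.*2.+1 => q ^+ absz (Posz s * tri (Posz k - Posz n)).
have cE (k : 'I_n.*2.+1) : c k = q ^+ Z * (qbinom (q ^+ s) n.*2 k * E k).
  by rewrite /c /E tri_l exprD; ring.
have S0 : \sum_(k < n.*2.+1) qbinom (q ^+ s) n.*2 k * (-1) ^+ k * E k = 0.
  apply: (@qXn_reg _ Z); rewrite mulr0 -{2}P0 /P horner_sum mulr_sumr.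
  by apply: eq_bigr => k _; rewrite hornerM hornerC hornerXn cE; set x := (-1) ^+ k; ring.
have S1 : (-1) ^+ n * (qfact (q ^+ s) n * qfact (q ^+ s) m) =
   - \sum_(k < n.*2.+1) qbinom (q ^+ s) n.*2 k * (-1) ^+ k * E k * k%:R.
  apply: (@qXn_reg _ Z); rewrite mulrA [_ * (-1) ^+ n]mulrC -P1 /P.
  rewrite (raddf_sum (@deriv _)) horner_sum mulrN mulr_sumr -sumrN.
  apply: eq_bigr => -[[|k] ltk] _.
    by rewrite /= mulr0 mulr0 oppr0 expr0 mulr1 derivC hornerC.
  rewrite /= derivM derivC mul0r add0r derivXn /= hornerM hornerC hornerMn hornerXn (cE (Ordinal ltk)) /=.
  rewrite exprS -mulr_natr; set x := (-1) ^+ k; ring.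
have sgn (k : 'I_n.*2.+1) : (-1) ^+ absz (Posz k - Posz n) = (-1) ^+ n * (-1) ^+ k :> fps R.
  rewrite -exprD -signr_odd -[RHS]signr_odd; congr (_ ^+ nat_of_bool _); lia.
have nn : (-1) ^+ n * (-1) ^+ n = 1 :> fps R by rewrite -expr2 sqrr_sign.
transitivity ((-1) ^+ n * - ((-1) ^+ n * (qfact (q ^+ s) n * qfact (q ^+ s) m))).
  by rewrite mulrN mulrA nn mul1r.
(* Differentiation yields the factor [k]; subtracting [n] times the vanishing sum [S0] recenters it
   to [k - n]. *)
rewrite S1 opprK -[X in _ * X]subr0 -[X in _ - X](mul0r n%:R) -[X in _ - X * _]S0.
rewrite mulr_suml -sumrB mulr_sumr; apply: eq_bigr => k _.
rewrite sgn intrB -/(E k); set x := (-1) ^+ n; set y := (-1) ^+ k.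
by rewrite !pmulrn; ring.
Qed.

(** Folding [l] with [1 - l], which has the same [tri], gives the familiar series over [n >= 0] with
    coefficients [(-1)^n (2 n + 1)]. *)
Lemma jacobi s : (0 < s)%N ->
  euler R s ^+ 3 =
  theta (fun l => absz (Posz s * tri l)) (fun l => - ((-1) ^+ absz l * l%:~R)).
Proof.
move=> s0; apply: eqm_all => m; set n := m.+1.
apply: (@eqm_trans _ _ (euler R s * (qfact (q ^+ s) n * qfact (q ^+ s) m))).
  rewrite !exprS expr0 mulr1; apply: eqmM => //.
  by apply: eqmM; apply: eqm_qfact_le => //; rewrite /n; lia.
rewrite -[qfact _ n * _]opprK finite_jacobi -/n.
apply: eqm_sym; apply: eqm_trans (@eqm_theta _ _ _ _ _ (zrange n) (zrange_uniq n) _) _.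
  by move=> l lt; rewrite mem_zrange; have := euler_cube_exponent_ge l s0; lia.
rewrite sum_zrange mulrN mulr_sumr -sumrN; apply: eqm_sum => k _.
set l := Posz k - Posz n; set e := absz (Posz s * tri l).
rewrite rmorphN rmorphM rmorphXn rmorphN rmorph1 rmorph_int.
set C := _ * l%:~R.
rewrite (_ : - C * _ = - (q ^+ e * (C * 1))); last by ring.
rewrite (_ : euler R s * _ = q ^+ e * (C * (euler R s * qbinom (q ^+ s) n.*2 k))); last by ring.
apply: eqmN; apply: (@eqm_le _ _ (e + (n - absz l).+1)).
  by have := euler_cube_exponent_ge l s0; rewrite -/e /n; lia.
apply: eqm_qXnM; apply: eqmM => //; apply: eqm_sym; apply: euler_qbinom => //.
by rewrite -ltnS.
Qed.

End Jacobi.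

(** * Eta quotients as theta series *)

Section ThetaSplit.
Local Open Scope ring_scope.
Variable R : comNzRingType.

Lemma theta_split_supp (I J K : choiceType) (h : J -> I) (k : K -> I) (e : I -> nat)
    (w : I -> R) :
  summable e -> injective h -> injective k -> (forall j l, h j <> k l) ->
  (forall i, w i != 0 -> (exists j, i = h j) \/ (exists l, i = k l)) ->
  theta e w = theta (e \o h) (w \o h) + theta (e \o k) (w \o k).
Proof.
move=> se injh injk dis cov.
pose w1 i := if `[< exists j, i = h j >] then w i else 0.
pose w2 i := if `[< exists j, i = h j >] then 0 else w i.
have w1h : w1 \o h =1 w \o h by move=> j; rewrite /w1 /= asboolT //; exists j.
have w2k : w2 \o k =1 w \o k.
  by move=> l; rewrite /w2 /= asboolF // => -[j] /esym /dis.
rewrite -(eq_theta (fun=> erefl) w1h) -(eq_theta (fun=> erefl) w2k).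
rewrite -!theta_reindex //.
- rewrite -thetaD //; apply: eq_theta => // i.
  by rewrite /w1 /w2; case: ifP; rewrite ?addr0 ?add0r.
- move=> i; rewrite /w2; case: asboolP => [|nh]; first by rewrite eqxx.
  by case/cov.
- by move=> i; rewrite /w1; case: asboolP => [//|]; rewrite eqxx.
Qed.

Lemma theta_split (I J K : choiceType) (h : J -> I) (k : K -> I) (e : I -> nat) (w : I -> R) :
  summable e -> injective h -> injective k -> (forall j l, h j <> k l) ->
  (forall i, (exists j, i = h j) \/ (exists l, i = k l)) ->
  theta e w = theta (e \o h) (w \o h) + theta (e \o k) (w \o k).
Proof. by move=> se injh injk dis cov; apply: theta_split_supp => // i _. Qed.

Lemma theta_split3 (I J : choiceType) (h0 h1 h2 : J -> I) (e : I -> nat) (w : I -> R) :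
  summable e -> injective h0 -> injective h1 -> injective h2 ->
  (forall j l, h0 j <> h1 l) -> (forall j l, h0 j <> h2 l) -> (forall j l, h1 j <> h2 l) ->
  (forall i, [\/ exists j, i = h0 j, exists j, i = h1 j | exists j, i = h2 j]) ->
  theta e w = theta (e \o h0) (w \o h0) + theta (e \o h1) (w \o h1)
    + theta (e \o h2) (w \o h2).
Proof.
move=> se i0 i1 i2 d01 d02 d12 cov.
pose h (x : J + J) := match x with inl j => h1 j | inr j => h2 j end.
have injh : injective h.
  move=> [x|x] [y|y] /=; [move/i1 -> | by move/d12 | by move/esym/d12 | move/i2 ->] => //.
have dis j x : h0 j <> h x by case: x => l; [exact: d01|exact: d02].
have cov' i : (exists j, i = h0 j) \/ (exists x, i = h x).
  by case: (cov i) => -[j ->]; [left; exists j | right; exists (inl j) | right; exists (inr j)].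
rewrite (theta_split w se i0 injh dis cov') -addrA; congr (_ + _).
rewrite (@theta_split _ _ _ inl inr) //; first exact: summable_comp.
- by move=> x y [].
- by move=> x y [].
- by move=> [j|j]; [left|right]; exists j.
Qed.

Lemma summable_tri (s : nat) : (0 < s)%N -> summable (fun l => absz (Posz s * tri l)).
Proof. by move=> s0; apply: (@summable_int 1) => l; exact: euler_cube_exponent_ge. Qed.

Lemma summable_triple (a b : nat) : (0 < a)%N -> (0 < b)%N ->
  summable (fun l => absz (Posz (a + b) * tri l + Posz a * l)).
Proof.
move=> a0 b0; apply: (@summable_int 0) => l.
have : (1 <= minn a b)%N by rewrite leq_min a0.
by have := triple_exponent_ge a b l; nia.
Qed.

End ThetaSplit.

Section EtaProducts.
Local Open Scope ring_scope.
Variable R : comNzRingType.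
Local Notation q := (qX R).
Local Notation E := (euler R).

(** In classical notation these four are Euler's pentagonal sum, [phi(q^s)], [phi(-q^s)] and
    [psi(q^s)]; in the last, [l (2 l - 1)] runs once through the triangular numbers. *)
Definition pent s := theta (fun l => absz (Posz (3 * s)%N * tri l + Posz s * l))
                           (fun l => (-1) ^+ absz l : R).
Definition phi s := theta (fun l => absz (Posz (2 * s)%N * tri l + Posz s * l)) (fun=> 1 : R).
Definition phim s := theta (fun l => absz (Posz (2 * s)%N * tri l + Posz s * l))
                           (fun l => (-1) ^+ absz l : R).
Definition psi s := theta (fun l => absz (Posz (4 * s)%N * tri l + Posz s * l)) (fun=> 1 : R).

Lemma pinf_mod3 (u : nat -> fps R) : tends1 u ->
  pinf u = pinf (fun i => u (3 * i)%N * u (3 * i + 1)%N) * pinf (fun i => u (3 * i + 2)%N).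
Proof.
move=> u1.
have t0 : tends1 (fun i => u (3 * i)%N * u (3 * i + 1)%N).
  by move=> i; rewrite -[1]mulr1; apply: eqmM; apply: eqm_le (u1 _); lia.
have t2 : tends1 (fun i => u (3 * i + 2)%N).
  by move=> i; apply: eqm_le (u1 _); lia.
apply: eqm_all => N.
apply: eqm_trans (@eqm_pinf _ _ N (3 * N) u1 _) _; first by lia.
apply: eqm_sym; apply: eqm_trans (eqmM (eqm_pinf t0 (leqnn N)) (eqm_pinf t2 (leqnn N))) _.
move=> n _; congr (cf _ n); elim: N => [|N IH]; first by rewrite !big_ord0 mulr1.
by rewrite mulnS [(3 + _)%N]addnC !addnS addn0 !big_ord_recr /= -IH addn1 addn2; ring.
Qed.

Lemma pentagonal s : (0 < s)%N -> pent s = E s.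
Proof.
move=> s0; have := @triple_product R (-1) s (2 * s); rewrite mulrNN mulr1.
rewrite (_ : s + 2 * s = 3 * s)%N; last by lia.
move=> /(_ erefl s0); rewrite muln_gt0 /= => /(_ s0); rewrite -/(pent s) => <-.
rewrite [RHS]/euler [RHS]pinf_mod3; last exact: tends1_euler.
rewrite mulrC; congr (_ * _).
  apply: eq_pinf => i; rewrite rmorphN rmorph1.
  rewrite (_ : s * (3 * i).+1 = s + 3 * s * i)%N; last by lia.
  by rewrite (_ : s * (3 * i + 1).+1 = 2 * s + 3 * s * i)%N; [ring | lia].
by apply: eq_pinf => i; rewrite (_ : s * (3 * i + 2).+1 = 3 * s * i.+1)%N //; lia.
Qed.

Definition odd_euler s := pinf (fun i => 1 - q ^+ (s * i.*2.+1)).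
Definition odd_euler_plus s := pinf (fun i => 1 + q ^+ (s * i.*2.+1)).

Lemma euler_odd s : (0 < s)%N -> E s = odd_euler s * E (2 * s).
Proof.
move=> s0; rewrite {1}/euler pinf_parity; last exact: tends1_euler.
congr (_ * _); apply: eq_pinf => i; congr (1 - q ^+ _); lia.
Qed.

Lemma tends1_odd (c : fps R) s : (0 < s)%N -> tends1 (fun i => 1 + c * q ^+ (s * i.*2.+1)).
Proof. by move=> s0; apply: tends1_qXn => i; nia. Qed.

Lemma odd_eulerE s : odd_euler s = pinf (fun i => 1 + (-1) * q ^+ (s * i.*2.+1)).
Proof. by apply: eq_pinf => i; ring. Qed.
Lemma odd_euler_plusE s : odd_euler_plus s = pinf (fun i => 1 + 1 * q ^+ (s * i.*2.+1)).
Proof. by apply: eq_pinf => i; ring. Qed.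

Lemma odd_euler_mul s : (0 < s)%N -> odd_euler_plus s * odd_euler s = odd_euler (2 * s).
Proof.
move=> s0; rewrite odd_eulerE odd_euler_plusE -pinfM; try exact: tends1_odd.
by apply: eq_pinf => i; rewrite (_ : 2 * s * i.*2.+1 = s * i.*2.+1 + s * i.*2.+1)%N ?exprD; [ring|lia].
Qed.

Lemma phimE s : (0 < s)%N -> phim s * E (2 * s) = E s ^+ 2.
Proof.
move=> s0; rewrite (euler_odd s0) /phim.
have := @triple_product R (-1) s s; rewrite mulrNN mulr1 addnn -mul2n.
move=> /(_ erefl s0 s0) <-; rewrite (_ : pinf _ = odd_euler s * odd_euler s); first by ring.
rewrite odd_eulerE -pinfM; try exact: tends1_odd.
apply: eq_pinf => i; rewrite rmorphN rmorph1 (_ : s + 2 * s * i = s * i.*2.+1)%N //; lia.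
Qed.

Lemma phiE s : (0 < s)%N -> phi s * (E s ^+ 2 * E (4 * s) ^+ 2) = E (2 * s) ^+ 5.
Proof.
move=> s0; have s20 : (0 < 2 * s)%N by lia.
have := @triple_product R 1 s s; rewrite mulr1 addnn -mul2n.
move=> /(_ erefl s0 s0); set p := pinf _.
have -> : p = odd_euler_plus s * odd_euler_plus s.
  rewrite odd_euler_plusE -pinfM; try exact: tends1_odd.
  apply: eq_pinf => i; rewrite rmorph1 (_ : s + 2 * s * i = s * i.*2.+1)%N //; lia.
rewrite (_ : theta _ _ = phi s); last by apply: eq_theta => // l; rewrite expr1n.
move=> <-; rewrite [E s](euler_odd s0).
have := odd_euler_mul s0; have := euler_odd s20; rewrite mulnA.
move: (odd_euler s) (odd_euler_plus s) (odd_euler _) => x y z -> <-; ring.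
Qed.

Lemma psiE s : (0 < s)%N -> psi s * E s = E (2 * s) ^+ 2.
Proof.
move=> s0; have s20 : (0 < 2 * s)%N by lia.
have := @triple_product R 1 s (3 * s); rewrite mulr1 (_ : s + 3 * s = 4 * s)%N; last by lia.
move=> /(_ erefl s0); rewrite muln_gt0 /= => /(_ s0).
set p := pinf _; have -> : p = odd_euler_plus s.
  rewrite odd_euler_plusE pinf_parity; last exact: tends1_odd.
  rewrite /p pinfM; try by apply: tends1_qXn => i; nia.
  rewrite mulrC; congr (_ * _); apply: eq_pinf => i; rewrite rmorph1; congr (1 + 1 * q ^+ _); lia.
rewrite (_ : theta _ _ = psi s); last by apply: eq_theta => // l; rewrite expr1n.
move=> <-; rewrite [E s](euler_odd s0).
have := odd_euler_mul s0; have := euler_odd s20; rewrite mulnA.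
move: (odd_euler s) (odd_euler_plus s) (odd_euler _) => x y z -> <-; ring.
Qed.

End EtaProducts.

Section Sign.
Local Open Scope ring_scope.
Variable R : comNzRingType.

Definition sg (l : int) : R := (-1) ^+ absz l.

Lemma sgD l m : sg (l + m) = sg l * sg m.
Proof.
by rewrite /sg -exprD -signr_odd -[RHS]signr_odd; congr (_ ^+ nat_of_bool _); lia.
Qed.
Lemma sgN l : sg (- l) = sg l.
Proof. by rewrite /sg abszN. Qed.
Lemma sgB l m : sg (l - m) = sg l * sg m.
Proof. by rewrite sgD sgN. Qed.
Lemma sg_sq l : sg l * sg l = 1.
Proof. by rewrite /sg -expr2 sqrr_sign. Qed.
Lemma sg1 : sg 1 = -1. Proof. by []. Qed.
Lemma sg2 l : sg (2 * l) = 1.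
Proof. by rewrite mulrDl !mul1r sgD sg_sq. Qed.
End Sign.

(** * Differential relations between theta functions, by rotating the plane *)

Section Rotations.
Local Open Scope ring_scope.
Local Notation K := 'F_11.
Local Notation q := (qX K).
Local Notation E := (euler K).
Local Notation sg := (sg K).

(** Modulo 11 the inverse of 2 is 6. Cancelling a doubling turns antisymmetry of a sum into its
    vanishing. *)
Lemma double_inj (x y : fps K) : x + x = y + y -> x = y.
Proof.
move=> exy; have h : fps_const (6%:R : K) * (x + x) = fps_const (6%:R : K) * (y + y).
  by rewrite exy.
have c (z : fps K) : fps_const (6%:R : K) * (z + z) = z.
  rewrite (_ : z + z = fps_const 2%:R * z); last by rewrite (rmorph_nat (@fps_const K)); ring.
  rewrite mulrA -rmorphM (_ : 6%:R * 2%:R = 1 :> K); last exact: val_inj.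
  by rewrite rmorph1 mul1r.
by rewrite -[x]c -[y]c h.
Qed.

Lemma absz_add (a b : int) : 0 <= a -> 0 <= b -> (absz a + absz b)%N = absz (a + b).
Proof. by lia. Qed.

Lemma tri_ge0s (s : nat) l : 0 <= Posz s * tri l.
Proof. by rewrite mulr_ge0 // tri_ge0. Qed.

Lemma triple_ge0 (a b : nat) l : 0 <= Posz (a + b)%N * tri l + Posz a * l.
Proof. exact: le_trans (triple_exponent_ge a b l). Qed.

Lemma sq_ge0 s l : 0 <= Posz (2 * s)%N * tri l + Posz s * l.
Proof. by rewrite mul2n -addnn triple_ge0. Qed.

(** With [x = 2 l - 1] the exponent is [s (x^2 - 1) / 8]. For [k = 1] this is Jacobi's series up to
    the factor -2, and [k = 3] is obtained from it by differentiation ([J3E]). *)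
Definition J s k := theta (fun l => absz (Posz s * tri l))
                          (fun l => sg l * (2 * l - 1)%:~R ^+ k : K).

Lemma theta_tri_sign s : (0 < s)%N -> theta (fun l => absz (Posz s * tri l)) sg = 0.
Proof.
move=> s0; set z := theta _ _; apply: double_inj; rewrite addr0.
suff {2}-> : z = - z by rewrite subrr.
rewrite /z -thetaN; last exact: summable_tri.
have bij1 : bijective (fun l : int => 1 - l) by exists (fun l => 1 - l) => l; ring.
rewrite [LHS](theta_bij _ (summable_tri s0) bij1); apply: eq_theta => l /=.
  by congr (absz (_ * _)); have := tri2 l; have := tri2 (1 - l); lia.
by rewrite sgB sg1 mulN1r.
Qed.

Lemma J1E s : (0 < s)%N -> J s 1 = - (E s ^+ 3 + E s ^+ 3).
Proof.
move=> s0; have st := summable_tri s0.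
rewrite jacobi // -thetaD // -[RHS]subr0 -(theta_tri_sign s0) -!thetaN // -thetaD //.
apply: eq_theta => // l; rewrite expr1 /sg /= intrB intrM; ring.
Qed.

Lemma int_parity (z : int) : exists i, z = 2 * i \/ z = 2 * i + 1.
Proof. by exists (z %/ 2)%Z; lia. Qed.

(* The rotation [x = r + s], [y = r - s] of the plane, where x and y are odd; *)
(* the two cases are r odd, s even and conversely.                             *)
Lemma J_sqr s k : (0 < s)%N -> odd k ->
  J s k * J s k = fps_const 2%:R *
  theta (fun ij : int * int => (absz (Posz (2 * s)%N * tri ij.1)%R +
      absz (Posz (2 * s)%N * tri ij.2 + Posz s * ij.2)%R)%N)
    (fun ij => ((2 * ij.1 - 1)%:~R ^+ 2 - (2 * ij.2)%:~R ^+ 2) ^+ k).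
Proof.
move=> s0 oddk; have st := summable_tri s0.
rewrite /J thetaM //.
pose h (ij : int * int) := (ij.1 + ij.2, ij.1 - ij.2).
pose h' (ij : int * int) := (ij.1 + ij.2, ij.2 - ij.1 + 1).
have cov ij : (exists x, ij = h x) \/ (exists x, ij = h' x).
  case: ij => l m; have [i [e|e]] := int_parity (l + m); [left | right].
    by exists (i, l - i); congr (_, _) => /=; lia.
  by exists (l - i, i); congr (_, _) => /=; lia.
have dis x y : h x <> h' y by case: x y => [i j] [i' j'] [] /=; lia.
have injh : injective h by move=> [i j] [i' j'] [] /= e1 e2; congr (_, _); lia.
have injh' : injective h' by move=> [i j] [i' j'] [] /= e1 e2; congr (_, _); lia.
rewrite (theta_split _ (summableM st st) injh injh' dis cov).
(* Both halves give the same series: in the second the signs multiply to -1, and the product of the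
   two odd numbers is [s^2 - r^2], whose [k]-th power changes sign as well, [k] being odd. *)
rewrite (rmorph_nat (@fps_const K)) mulr_natl mulr2n.
congr (_ + _); apply: eq_theta => -[i j] /=.
- rewrite !absz_add ?tri_ge0s ?sq_ge0 //.
  congr absz; rewrite -mulrDr.
  have -> : tri (i + j) + tri (i - j) = 2 * tri i + 2 * tri j + j.
    by have := tri2 (i + j); have := tri2 (i - j); have := tri2 i; have := tri2 j; lia.
  by rewrite PoszM; ring.
- rewrite mulrACA -exprMn -intrM sgD sgB; set t := sg i; set u := sg j.
  rewrite (_ : t * u * (t * u) = (t * t) * (u * u)); last by ring.
  have -> : (2 * (i + j) - 1) * (2 * (i - j) - 1) = (2 * i - 1) ^+ 2 - (2 * j) ^+ 2 by ring.
  by rewrite !sg_sq !mul1r rmorphB !rmorphXn.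
- rewrite !absz_add ?tri_ge0s ?sq_ge0 //.
  congr absz; rewrite -mulrDr.
  have -> : tri (i + j) + tri (j - i + 1) = 2 * tri i + 2 * tri j + j.
    by have := tri2 (i + j); have := tri2 (j - i + 1); have := tri2 i; have := tri2 j; lia.
  by rewrite PoszM; ring.
- rewrite mulrACA -exprMn -intrM !sgD !sgN sg1; set t := sg i; set u := sg j.
  rewrite (_ : t * u * (u * t * -1) = - ((t * t) * (u * u))); last by ring.
  have -> : (2 * (i + j) - 1) * (2 * (j - i + 1) - 1) = - ((2 * i - 1) ^+ 2 - (2 * j) ^+ 2) by ring.
  rewrite !sg_sq mul1r mulN1r rmorphN rmorphB !rmorphXn exprNn -signr_odd oddk expr1.
  by rewrite mulN1r opprK.
Qed.

(** A factor of the weight that is affine in the exponent comes from a first order differential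
    operator; this is how powers of the lattice variables become derivatives. *)
Lemma qD_shift (I : choiceType) (e : I -> nat) (w c : I -> K) m n : summable e ->
  (forall i, m * (e i)%:R + n = c i) ->
  fps_const m * qD (theta e w) + fps_const n * theta e w = theta e (fun i => c i * w i).
Proof.
move=> se ec; rewrite qD_theta // -!thetaZ // -thetaD //.
by apply: eq_theta => // i; rewrite -ec; ring.
Qed.

Definition psi2 s := theta (fun l => absz (Posz s * tri l)) (fun=> 1 : K).

Lemma psi2E s : (0 < s)%N -> psi2 s = fps_const 2%:R * psi K s.
Proof.
move=> s0; have injh : injective (fun l : int => 2 * l) by move=> x y; lia.
have injh' : injective (fun l : int => 1 - 2 * l) by move=> x y; lia.
have dis (x y : int) : 2 * x <> 1 - 2 * y by lia.
have cov (l : int) : (exists x, l = 2 * x) \/ (exists x, l = 1 - 2 * x).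
  by have [m [->|->]] := int_parity l; [left; exists m | right; exists (- m); lia].
rewrite /psi2 (theta_split _ (summable_tri s0) injh injh' dis cov).
rewrite (rmorph_nat (@fps_const K)) mulr_natl mulr2n.
  congr (_ + _); apply: eq_theta => // l /=; congr absz.
    have -> : tri (2 * l) = 4 * tri l + l by have := tri2 (2 * l); have := tri2 l; lia.
    by rewrite PoszM; ring.
  have -> : tri (1 - 2 * l) = 4 * tri l + l by have := tri2 (1 - 2 * l); have := tri2 l; lia.
  by rewrite PoszM; ring.
Qed.

(** This is [4 D] acting on [q^(m/4) f], without the fractional power: the theta function behind
    [psi(q^(2s))] carries the factor [q^(s/4)]. *)
Definition qD4 m (f : fps K) := 4%:R * qD f + m%:R * f.

Section Brackets.
Variable s : nat.
Hypothesis s0 : (0 < s)%N.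

(** In terms of the odd [x = 2 i - 1] and the even [y = 2 j] the exponents are [s (x^2 - 1) / 4] and
    [s y^2 / 4], so weighting by [s x^2] or [s y^2] is applying [4 D + s] or [4 D]. *)
Let e1 (i : int) := absz (Posz (2 * s)%N * tri i).
Let e2 (j : int) := absz (Posz (2 * s)%N * tri j + Posz s * j).
Let A k := theta e1 (fun i => (2 * i - 1)%:~R ^+ 2 ^+ k : K).
Let B k := theta e2 (fun j => (2 * j)%:~R ^+ 2 ^+ k : K).

Let se1 : summable e1.
Proof. by apply: summable_tri; rewrite muln_gt0. Qed.
Let se2 : summable e2.
Proof. by have := summable_triple s0 s0; rewrite addnn -mul2n. Qed.

Let psi_s := psi K (2 * s).
Let phi_s := phi K s.

Let A0E : A 0 = fps_const 2%:R * psi_s.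
Proof.
rewrite -psi2E ?muln_gt0 //; apply: eq_theta => // i.
Qed.
Let B0E : B 0 = phi_s.
Proof. exact: eq_theta. Qed.

Let sA k : fps_const s%:R * A k.+1 = fps_const 4%:R * qD (A k) + fps_const s%:R * A k.
Proof.
rewrite (@qD_shift _ _ _ (fun i => s%:R * (2 * i - 1)%:~R ^+ 2)) //; last first.
  move=> i; have -> : (e1 i)%:R = (Posz (2 * s)%N * tri i)%:~R :> K.
    by rewrite pmulrn /e1 abszE ger0_norm ?tri_ge0s.
  have t2 := congr1 (fun z : int => z%:~R : K) (tri2 i).
  rewrite PoszM !(intrM, intrB) in t2 *; move: t2 => /=.
  set t := (tri i)%:~R; set x := i%:~R => t2.
  rewrite (_ : 4%:R * _ = 4%:R * s%:R * (2%:R * t)); last by ring.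
  by rewrite t2; ring.
by rewrite -thetaZ //; apply: eq_theta => // i; rewrite exprS; ring.
Qed.
Let sB k : fps_const s%:R * B k.+1 = fps_const 4%:R * qD (B k).
Proof.
rewrite -[RHS]addr0 -[X in _ + X](mul0r (B k)) -(rmorph0 (@fps_const K)).
rewrite (@qD_shift _ _ _ (fun j => s%:R * (2 * j)%:~R ^+ 2)) //; last first.
  move=> i; have -> : (e2 i)%:R = (Posz (2 * s)%N * tri i + Posz s * i)%:~R :> K.
    by rewrite pmulrn /e2 abszE ger0_norm // mul2n -addnn triple_ge0.
  have t2 := congr1 (fun z : int => z%:~R : K) (tri2 i).
  rewrite PoszM !(intrM, intrB, intrD) in t2 *; move: t2 => /=.
  set t := (tri i)%:~R; set x := i%:~R => t2.
  rewrite (_ : _ + 0 = 4%:R * s%:R * (2%:R * t) + 4%:R * s%:R * x); last by ring.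
  by rewrite t2; ring.
by rewrite -thetaZ //; apply: eq_theta => // i; rewrite exprS; ring.
Qed.

Let J1 : E s ^+ 6 + E s ^+ 6 = A 1 * B 0 - A 0 * B 1.
Proof.
apply: double_inj; have := J_sqr s0 (erefl : odd 1); rewrite J1E // => e.
transitivity ((- (E s ^+ 3 + E s ^+ 3)) * - (E s ^+ 3 + E s ^+ 3)); first by ring.
rewrite e (rmorph_nat (@fps_const K)) mulr_natl mulr2n.
rewrite [theta _ _](_ : _ = A 1 * B 0 - A 0 * B 1) //.
rewrite !thetaM // -thetaN; last exact: summableM.
rewrite -thetaD; last exact: summableM.
by apply: eq_theta => // -[i k] /=; rewrite !expr1 !expr0; ring.
Qed.

(** Squaring Jacobi's series for [E s ^+ 3] and rotating leaves the weight [x^2 - y^2], which is the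
    Wronskian of the two theta functions. *)
Lemma euler_bracket :
  s%:R * E s ^+ 6 = qD4 s (psi K (2 * s)) * phi K s - psi K (2 * s) * qD4 0 (phi K s).
Proof.
rewrite -/psi_s -/phi_s; apply: double_inj; rewrite -mulrDr J1 -(rmorph_nat (@fps_const K)).
rewrite mulrBr mulrA sA [X in _ - X]mulrCA sB A0E B0E /qD4.
rewrite qDM qD_const !(rmorph_nat (@fps_const K)); ring.
Qed.

Let J3 : J s 3 * J s 3 = fps_const 2%:R *
  (A 3 * B 0 - fps_const 3%:R * (A 2 * B 1) + fps_const 3%:R * (A 1 * B 2) - A 0 * B 3).
Proof.
rewrite (J_sqr s0) //; congr (_ * _).
rewrite !thetaM // -!thetaZ; try exact: summableM.
rewrite -!thetaN; try exact: summableM.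
rewrite -!thetaD; try exact: summableM.
apply: eq_theta => // -[i k] /=; rewrite !exprS !expr0; ring.
Qed.

Lemma J3E : fps_const s%:R * J s 3 =
  - (2%:R * (fps_const 8%:R * qD (E s ^+ 3) + fps_const s%:R * E s ^+ 3)).
Proof.
have -> : - (2%:R * (fps_const 8%:R * qD (E s ^+ 3) + fps_const s%:R * E s ^+ 3)) =
   fps_const 8%:R * qD (J s 1) + fps_const s%:R * J s 1.
  by rewrite J1E // raddfN raddfD; ring.
have st := summable_tri s0.
rewrite (@qD_shift _ _ _ (fun l => s%:R * (2 * l - 1)%:~R ^+ 2)) //; last first.
  move=> i; have -> : (absz (Posz s * tri i)%R)%:R = (Posz s * tri i)%:~R :> K.
    by rewrite pmulrn abszE ger0_norm ?tri_ge0s.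
  have t2 := congr1 (fun z : int => z%:~R : K) (tri2 i).
  rewrite !(intrM, intrB) in t2 *; move: t2 => /=.
  set t := (tri i)%:~R; set x := i%:~R => t2.
  rewrite (_ : 8%:R * _ = 4%:R * s%:R * (2%:R * t)); last by ring.
  by rewrite t2; ring.
by rewrite -thetaZ //; apply: eq_theta => // i; rewrite !exprS; ring.
Qed.

(** The same rotation applied to [J s 3]: expanding [(x^2 - y^2)^3] gives the third order bracket,
    from which the derivative of [W] will be extracted. *)
Lemma euler_bracket3 (a := psi K (2 * s)) (b := phi K s) :
  s%:R * (8%:R * qD (E s ^+ 3) + s%:R * E s ^+ 3) ^+ 2 =
  qD4 s (qD4 s (qD4 s a)) * b - 3%:R * (qD4 s (qD4 s a) * qD4 0 b)
  + 3%:R * (qD4 s a * qD4 0 (qD4 0 b)) - a * qD4 0 (qD4 0 (qD4 0 b)).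
Proof.
pose L := qD4 s; pose M := qD4 0; rewrite -/L -/M {}/a {}/b -/psi_s -/phi_s.
set S : fps K := s%:R; have SE : fps_const s%:R = S by exact: (rmorph_nat (@fps_const K)).
have DS k (f : fps K) : qD (S ^+ k * f) = S ^+ k * qD f.
  by rewrite qDM -SE -rmorphXn qD_const mul0r add0r.
have As k : S ^+ k * A k = 2%:R * iter k L psi_s.
  elim: k => [|k IH]; first by rewrite mul1r A0E (rmorph_nat (@fps_const K)).
  rewrite exprSr -mulrA -SE sA SE; transitivity (4%:R * qD (S ^+ k * A k) + S * (S ^+ k * A k)).
    by rewrite DS (rmorph_nat (@fps_const K)); ring.
  by rewrite IH /= /L /qD4 qDM qD_nat -/S; ring.
have Bs k : S ^+ k * B k = iter k M phi_s.
  elim: k => [|k IH]; first by rewrite mul1r B0E.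
  rewrite exprSr -mulrA -SE sB SE; transitivity (4%:R * qD (S ^+ k * B k)).
    by rewrite DS (rmorph_nat (@fps_const K)); ring.
  by rewrite IH /= /M /qD4; ring.
apply: double_inj; apply: double_inj.
transitivity (S * (S * J s 3) ^+ 2).
  by rewrite -SE J3E SE (rmorph_nat (@fps_const K) 8); ring.
rewrite expr2 mulrACA J3 !(rmorph_nat (@fps_const K)).
have A1 := As 1%N; have A2 := As 2; have A3 := As 3; have B1 := Bs 1%N; have B2 := Bs 2; have B3 := Bs 3.
transitivity (2%:R * ((S ^+ 3 * A 3) * B 0 - 3%:R * ((S ^+ 2 * A 2) * (S ^+ 1 * B 1))
   + 3%:R * ((S ^+ 1 * A 1) * (S ^+ 2 * B 2)) - A 0 * (S ^+ 3 * B 3))); first by ring.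
rewrite A1 A2 A3 B1 B2 B3 B0E A0E !(rmorph_nat (@fps_const K)) /=; ring.
Qed.

End Brackets.

End Rotations.

(** * Quadratic relations and eta quotients of weight 3/2 *)

Section ThetaRelations.
Local Open Scope ring_scope.
Local Notation K := 'F_11.
Local Notation q := (qX K).
Local Notation E := (euler K).
Local Notation sg := (sg K).

Lemma summable_sq s : (0 < s)%N ->
  summable (fun l : int => absz (Posz (2 * s)%N * tri l + Posz s * l)).
Proof. by move=> s0; have := summable_triple s0 s0; rewrite addnn -mul2n. Qed.

(** Rotation by 45 degrees: pairs with even sum give [2 (i^2 + j^2)], pairs with odd sum a product
    of two series over triangular numbers. *)
Lemma phi_sqr s : (0 < s)%N ->
  phi K s ^+ 2 = phi K (2 * s) ^+ 2 + 4%:R * q ^+ s * psi K (4 * s) ^+ 2.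
Proof.
move=> s0; have ss := summable_sq s0; have s20 : (0 < 2 * s)%N by lia.
have s40 : (0 < 4 * s)%N by lia.
transitivity (phi K (2 * s) ^+ 2 + q ^+ s * psi2 (4 * s) ^+ 2); last first.
  by rewrite psi2E // (rmorph_nat (@fps_const K)); ring.
have st4 := summable_tri s40; have ss2 := summable_sq s20.
rewrite !expr2 (thetaM _ _ ss ss) (thetaM _ _ ss2 ss2) (thetaM _ _ st4 st4).
rewrite (qXM_theta _ _ (summableM st4 st4)).
pose h (ij : int * int) := (ij.1 + ij.2, ij.1 - ij.2).
pose h' (ij : int * int) := (ij.1 + ij.2 - 1, ij.1 - ij.2).
have cov ij : (exists x, ij = h x) \/ (exists x, ij = h' x).
  case: ij => l m; have [i [e|e]] := int_parity (l + m); [left | right].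
    by exists (i, l - i); congr (_, _) => /=; lia.
  by exists (i + 1, l - i); congr (_, _) => /=; lia.
have dis x y : h x <> h' y by case: x y => [i j] [i' j'] [] /=; lia.
have injh : injective h by move=> [i j] [i' j'] [] /= e1 e2; congr (_, _); lia.
have injh' : injective h' by move=> [i j] [i' j'] [] /= e1 e2; congr (_, _); lia.
rewrite (theta_split _ (summableM ss ss) injh injh' dis cov).
congr (_ + _); apply: eq_theta => -[i j] //=.
- rewrite !absz_add ?sq_ge0 //; congr absz; rewrite !PoszM.
  rewrite [LHS](_ : _ = Posz s * (2 * tri (i + j) + (i + j) + (2 * tri (i - j) + (i - j)))); last by ring.
  rewrite [RHS](_ : _ = Posz s * (2 * (2 * tri i + i + (2 * tri j + j)))); last by ring.
  by rewrite !tri2; ring.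
- rewrite !absz_add ?sq_ge0 ?tri_ge0s // -[X in (X + _)%N]/(absz (Posz s)) absz_add //; last first.
    by rewrite addr_ge0 ?tri_ge0s.
  congr absz; rewrite !PoszM.
  rewrite [LHS](_ : _ = Posz s * (2 * tri (i + j - 1) + (i + j - 1) + (2 * tri (i - j) + (i - j)))); last by ring.
  rewrite [RHS](_ : _ = Posz s * (1 + 2 * (2 * tri i) + 2 * (2 * tri j))); last by ring.
  by rewrite !tri2; ring.
Qed.

Lemma qneg_phi s : odd s -> (0 < s)%N -> qneg (phi K s) = phim K s.
Proof.
move=> os s0; rewrite /phi qneg_theta; last exact: summable_sq.
apply: eq_theta => // l; rewrite mulr1 -signr_odd -[RHS]signr_odd; congr (_ ^+ nat_of_bool _).
have := tri2 l; have := sq_ge0 s l; rewrite PoszM => h0 t2.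
have -> : absz (Posz 2 * Posz s * tri l + Posz s * l) = (s * (absz l * absz l))%N.
  have -> : Posz 2 * Posz s * tri l + Posz s * l = Posz s * (l * l).
    rewrite (_ : _ + _ = Posz s * (2 * tri l + l)); last by ring.
    by rewrite tri2; ring.
  by rewrite !abszM.
by rewrite !oddM os andbb.
Qed.

Lemma qneg_even (I : choiceType) (e : I -> nat) (w : I -> K) : summable e ->
  (forall i, ~~ odd (e i)) -> qneg (theta e w) = theta e w.
Proof.
move=> se ev; rewrite qneg_theta //; apply: eq_theta => // i.
by rewrite -signr_odd (negbTE (ev i)) mul1r.
Qed.

Lemma qneg_phi_even s : ~~ odd s -> (0 < s)%N -> qneg (phi K s) = phi K s.
Proof.
move=> os s0; apply: qneg_even => [|l]; first exact: summable_sq.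
have -> : Posz (2 * s)%N * tri l + Posz s * l = Posz s * (l * l).
  rewrite PoszM (_ : _ + _ = Posz s * (2 * tri l + l)); last by ring.
  by rewrite tri2; ring.
by rewrite abszM oddM negb_and os.
Qed.

Lemma qneg_psi_even s : ~~ odd s -> (0 < s)%N -> qneg (psi K s) = psi K s.
Proof.
move=> os s0; apply: qneg_even => [|l].
  have := @summable_triple s (3 * s) s0; rewrite (_ : s + 3 * s = 4 * s)%N; last by lia.
  by apply; lia.
have -> : Posz (4 * s)%N * tri l + Posz s * l = Posz s * (4 * tri l + l).
  by rewrite PoszM; ring.
by rewrite abszM oddM negb_and os.
Qed.

(** By [eta5_2E], [eta224E] and [phimE] these are [E_s^5 / E_(2s)^2] and [E_s^2 E_(4s)^2 / E_(2s)],
    theta series in one variable with a linear weight. *)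
Definition eta5_2 s := theta (fun l : int => absz (Posz (3 * s)%N * tri l + Posz s * l))
                            (fun l => (1 - 6 * l)%:~R : K).
Definition eta224 s := theta (fun l : int => absz (Posz (6 * s)%N * tri l + Posz s * l))
                            (fun l => (1 - 3 * l)%:~R : K).

Lemma summable_pent s : (0 < s)%N ->
  summable (fun l : int => absz (Posz (3 * s)%N * tri l + Posz s * l)).
Proof.
move=> s0; have := @summable_triple s (2 * s) s0.
by rewrite (_ : s + 2 * s = 3 * s)%N; [apply; lia | lia].
Qed.

Lemma pent_ge0 s l : 0 <= Posz (3 * s)%N * tri l + Posz s * l.
Proof. by have := triple_ge0 s (2 * s) l; rewrite (_ : s + 2 * s = 3 * s)%N //; lia. Qed.

Lemma summable_eta224 s : (0 < s)%N ->
  summable (fun l : int => absz (Posz (6 * s)%N * tri l + Posz s * l)).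
Proof.
move=> s0; have := @summable_triple s (5 * s) s0.
by rewrite (_ : s + 5 * s = 6 * s)%N; [apply; lia | lia].
Qed.

Lemma eta224_ge0 s l : 0 <= Posz (6 * s)%N * tri l + Posz s * l.
Proof. by have := triple_ge0 s (5 * s) l; rewrite (_ : s + 5 * s = 6 * s)%N //; lia. Qed.

Lemma theta_antisym (I : choiceType) (e : I -> nat) (w : I -> K) (h : I -> I) :
  summable e -> bijective h -> e \o h =1 e -> (forall i, w (h i) = - w i) -> theta e w = 0.
Proof.
move=> se bijh eh wh; apply: double_inj; rewrite addr0.
have {2}-> : theta e w = - theta e w; last by rewrite subrr.
by rewrite -thetaN // [LHS](theta_bij _ se bijh); apply: eq_theta.
Qed.

Lemma int_mod3 (z : int) : exists i, [\/ z = 3 * i, z = 3 * i + 1 | z = 3 * i + 2].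
Proof.
exists (z %/ 3)%Z.
have [e|[e|e]] : z = 3 * (z %/ 3)%Z \/ z = 3 * (z %/ 3)%Z + 1 \/ z = 3 * (z %/ 3)%Z + 2 by lia.
- by constructor 1.
- by constructor 2.
- by constructor 3.
Qed.

Lemma sqE s l : Posz (2 * s)%N * tri l + Posz s * l = Posz s * (l * l).
Proof.
rewrite PoszM (_ : _ + _ = Posz s * (2 * tri l + l)); last by ring.
by rewrite tri2; ring.
Qed.

Lemma eta5_2_exponent0 n b :
  tri (n + 2 * b) + (n - b) * (n - b) = 3 * tri n + n + 6 * tri b + 2 * b.
Proof. by have := tri2 (n + 2 * b); have := tri2 n; have := tri2 b; lia. Qed.

Lemma eta5_2_exponent1 n b :
  tri (1 - n - 2 * b) + (b - n) * (b - n) = 3 * tri n + n + 6 * tri b + 2 * b.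
Proof. by have := tri2 (1 - n - 2 * b); have := tri2 n; have := tri2 b; lia. Qed.

Lemma eta5_2_exponent2 m b :
  tri (m + 2 - 2 * (1 - b)) + (m + (1 - b)) * (m + (1 - b)) =
  tri (m + 2 - 2 * b) + (m + b) * (m + b).
Proof. by have := tri2 (m + 2 - 2 * (1 - b)); have := tri2 (m + 2 - 2 * b); lia. Qed.

Lemma eta224_exponent0 n b :
  4 * tri (n + b) + (n - 2 * b) * (n - 2 * b) = 6 * tri n + n + 12 * tri b + 4 * b.
Proof. by have := tri2 (n + b); have := tri2 n; have := tri2 b; lia. Qed.

Lemma eta224_exponent1 n b :
  4 * tri (1 - n - b) + (2 * b - n) * (2 * b - n) = 6 * tri n + n + 12 * tri b + 4 * b.
Proof. by have := tri2 (1 - n - b); have := tri2 n; have := tri2 b; lia. Qed.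

Lemma eta224_exponent2 m b :
  4 * tri (m + (1 - b)) + (m + 1 - 2 * (1 - b)) * (m + 1 - 2 * (1 - b)) =
  4 * tri (m + b) + (m + 1 - 2 * b) * (m + 1 - 2 * b).
Proof. by have := tri2 (m + (1 - b)); have := tri2 (m + b); lia. Qed.

(* Grouping the terms of [E s ^+ 3 * phim s] by [N = a + 2 b] gives            *)
(* [E (2 * s)], up to sign, for each N not congruent to 2 mod 3, and 0 else.   *)
Lemma eta5_2E s : (0 < s)%N -> eta5_2 s * E (2 * s) = E s ^+ 3 * phim K s.
Proof.
move=> s0; have s20 : (0 < 2 * s)%N by lia.
have st := summable_tri s0; have ss := summable_sq s0.
have sp := summable_pent s0; have sp2 := summable_pent s20.
rewrite -(pentagonal _ s20) (jacobi _ s0).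
pose e (ab : int * int) := (absz (Posz s * tri ab.1)%R +
   absz (Posz (2 * s)%N * tri ab.2 + Posz s * ab.2)%R)%N.
have se : summable e := summableM st ss.
(* Jacobi's weight [a] may be replaced by [a + 2 b], constant on the groups: the additional sum has
   the vanishing factor of [theta_tri_sign]. *)
pose w (ab : int * int) : K := - (sg ab.1 * sg ab.2 * (ab.1 + 2 * ab.2)%:~R).
transitivity (theta e w); last first.
  rewrite -[RHS]addr0 -(mul0r (theta (fun l : int => absz (Posz (2 * s)%N * tri l + Posz s * l)%R)
      (fun b => - (sg b * (2 * b)%:~R)))) -(theta_tri_sign s0).
  rewrite !thetaM // -thetaD //; apply: eq_theta => // -[a b] /=.
  by rewrite /w /sg /= intrD; ring.
pose h0 (x : int * int) := (x.1 + 2 * x.2, x.1 - x.2).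
pose h1 (x : int * int) := (1 - x.1 - 2 * x.2, x.2 - x.1).
pose h2 (x : int * int) := (x.1 + 2 - 2 * x.2, x.1 + x.2).
have cov i : [\/ exists j, i = h0 j, exists j, i = h1 j | exists j, i = h2 j].
  case: i => a b; have [m [em|em|em]] := int_mod3 (a + 2 * b).
  - by constructor 1; exists (m, m - b); congr (_, _) => /=; lia.
  - by constructor 2; exists (- m, b - m); congr (_, _) => /=; lia.
  - by constructor 3; exists (m, b - m); congr (_, _) => /=; lia.
have i0 : injective h0 by move=> [i j] [i' j'] [] /= e1 e2; congr (_, _); lia.
have i1 : injective h1 by move=> [i j] [i' j'] [] /= e1 e2; congr (_, _); lia.
have i2 : injective h2 by move=> [i j] [i' j'] [] /= e1 e2; congr (_, _); lia.
have d01 x y : h0 x <> h1 y by case: x y => [i j] [i' j'] [] /=; lia.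
have d02 x y : h0 x <> h2 y by case: x y => [i j] [i' j'] [] /=; lia.
have d12 x y : h1 x <> h2 y by case: x y => [i j] [i' j'] [] /=; lia.
rewrite (theta_split3 w se i0 i1 i2 d01 d02 d12 cov).
have eE a b : e (a, b) = absz (Posz s * (tri a + b * b)).
  rewrite /e /= absz_add ?tri_ge0s ?sq_ge0 // sqE; congr absz; ring.
(* On the class of 2 modulo 3 this involution keeps the exponent and reverses the sign, so the class
   cancels. *)
pose k (x : int * int) := (x.1, 1 - x.2).
have bk : bijective k by exists k => -[m b]; congr (_, _) => /=; ring.
have ek : (e \o h2) \o k =1 e \o h2.
  move=> [m b]; rewrite /= !eE /k /=; congr (absz (_ * _)).
  exact: eta5_2_exponent2.
have wk x : (w \o h2) (k x) = - (w \o h2) x.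
  case: x => m b; rewrite /w /k /= !sgD !sgN !sg2 sg1.
  rewrite (_ : m + 2 - 2 * (1 - b) + 2 * (m + (1 - b)) = m + 2 - 2 * b + 2 * (m + b)); last by ring.
  by set t := sg m; set u := sg b; set v := sg 2; ring.
rewrite (theta_antisym (summable_comp i2 se) bk ek wk) addr0 /eta5_2 /pent thetaM //.
have ep (n b : int) : (absz (Posz (3 * s)%N * tri n + Posz s * n)%R +
    absz (Posz (3 * (2 * s))%N * tri b + Posz (2 * s)%N * b)%R)%N =
    absz (Posz s * (3 * tri n + n + 6 * tri b + 2 * b)).
  by rewrite absz_add ?pent_ge0 // !PoszM; congr absz; ring.
rewrite (_ : theta (e \o h0) _ = theta (fun x : int * int =>
   (absz (Posz (3 * s)%N * tri x.1 + Posz s * x.1)%R +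
    absz (Posz (3 * (2 * s))%N * tri x.2 + Posz (2 * s)%N * x.2)%R)%N) (w \o h0)); last first.
  apply: eq_theta => // -[n b]; rewrite ep /= eE; congr (absz (_ * _)).
  exact: eta5_2_exponent0.
rewrite (_ : theta (e \o h1) _ = theta (fun x : int * int =>
   (absz (Posz (3 * s)%N * tri x.1 + Posz s * x.1)%R +
    absz (Posz (3 * (2 * s))%N * tri x.2 + Posz (2 * s)%N * x.2)%R)%N) (w \o h1)); last first.
  apply: eq_theta => // -[n b]; rewrite ep /= eE; congr (absz (_ * _)).
  exact: eta5_2_exponent1.
rewrite -thetaD; last exact: (summableM sp sp2).
apply: eq_theta => // -[n b]; rewrite /w /= -/(sg b) !(sgB, sgD, sg2, sgN, sg1).
set t := sg n; set u := sg b.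
rewrite (_ : n + 2 * b + 2 * (n - b) = 3 * n); last by ring.
rewrite (_ : 1 - n - 2 * b + 2 * (b - n) = 1 - 3 * n); last by ring.
rewrite (_ : t * 1 * (t * u) = (t * t) * u); last by ring.
rewrite (_ : -1 * t * 1 * (u * t) = - ((t * t) * u)); last by ring.
rewrite sg_sq (_ : 1 - 6 * n = (1 - 3 * n) - 3 * n); last by ring.
by rewrite (intrB _ (1 - 3 * n)); ring.
Qed.

(** The grouping is as in [eta5_2E], now by [N = 2 a + b], and the class of 1 modulo 3 cancels.
    Jacobi's weight enters as [2 a], so the identity is proved doubled. *)
Lemma eta224E s : (0 < s)%N -> eta224 s * E (4 * s) = E (4 * s) ^+ 3 * phim K s.
Proof.
move=> s0; have s40 : (0 < 4 * s)%N by lia.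
have st := summable_tri s40; have ss := summable_sq s0.
have sp := summable_eta224 s0; have sp4 := summable_pent s40.
rewrite (jacobi _ s40) -(pentagonal _ s40).
pose e (ab : int * int) := (absz (Posz (4 * s)%N * tri ab.1)%R +
   absz (Posz (2 * s)%N * tri ab.2 + Posz s * ab.2)%R)%N.
have se : summable e := summableM st ss.
pose w (ab : int * int) : K := - (sg ab.1 * sg ab.2 * (2 * ab.1 + ab.2)%:~R).
apply: double_inj.
transitivity (theta e w); last first.
  rewrite -[RHS]addr0 -(mul0r (theta (fun l : int => absz (Posz (2 * s)%N * tri l + Posz s * l)%R)
      (fun b => - (sg b * b%:~R)))) -(theta_tri_sign s40).
  rewrite !thetaM // -!thetaD //; apply: eq_theta => // -[a b] /=.
  by rewrite /w /sg /= intrD intrM; ring.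
pose h0 (x : int * int) := (x.1 + x.2, x.1 - 2 * x.2).
pose h1 (x : int * int) := (1 - x.1 - x.2, 2 * x.2 - x.1).
pose h2 (x : int * int) := (x.1 + x.2, x.1 + 1 - 2 * x.2).
have cov i : [\/ exists j, i = h0 j, exists j, i = h1 j | exists j, i = h2 j].
  case: i => a b; have [m [em|em|em]] := int_mod3 (2 * a + b).
  - by constructor 1; exists (m, a - m); congr (_, _) => /=; lia.
  - by constructor 3; exists (m, a - m); congr (_, _) => /=; lia.
  - by constructor 2; exists (- m, 1 + m - a); congr (_, _) => /=; lia.
have i0 : injective h0 by move=> [i j] [i' j'] [] /= e1 e2; congr (_, _); lia.
have i1 : injective h1 by move=> [i j] [i' j'] [] /= e1 e2; congr (_, _); lia.
have i2 : injective h2 by move=> [i j] [i' j'] [] /= e1 e2; congr (_, _); lia.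
have d01 x y : h0 x <> h1 y by case: x y => [i j] [i' j'] [] /=; lia.
have d02 x y : h0 x <> h2 y by case: x y => [i j] [i' j'] [] /=; lia.
have d12 x y : h1 x <> h2 y by case: x y => [i j] [i' j'] [] /=; lia.
rewrite (theta_split3 w se i0 i1 i2 d01 d02 d12 cov).
have eE a b : e (a, b) = absz (Posz s * (4 * tri a + b * b)).
  rewrite /e /= absz_add ?tri_ge0s ?sq_ge0 // sqE; congr absz; rewrite PoszM; ring.
pose k (x : int * int) := (x.1, 1 - x.2).
have bk : bijective k by exists k => -[m b]; congr (_, _) => /=; ring.
have ek : (e \o h2) \o k =1 e \o h2.
  move=> [m b]; rewrite /= !eE /k /=; congr (absz (_ * _)).
  exact: eta224_exponent2.
have wk x : (w \o h2) (k x) = - (w \o h2) x.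
  case: x => m b; rewrite /w /k /= !(sgB, sgD, sg2, sgN, sg1).
  rewrite (_ : 2 * (m + (1 - b)) + (m + 1 - 2 * (1 - b)) = 2 * (m + b) + (m + 1 - 2 * b)); last by ring.
  by set t := sg m; set u := sg b; ring.
rewrite (theta_antisym (summable_comp i2 se) bk ek wk) addr0 /eta224 /pent thetaM //.
have ep (n b : int) : (absz (Posz (6 * s)%N * tri n + Posz s * n)%R +
    absz (Posz (3 * (4 * s))%N * tri b + Posz (4 * s)%N * b)%R)%N =
    absz (Posz s * (6 * tri n + n + 12 * tri b + 4 * b)).
  by rewrite absz_add ?pent_ge0 ?eta224_ge0 // !PoszM; congr absz; ring.
rewrite (_ : theta (e \o h0) _ = theta (fun x : int * int =>
   (absz (Posz (6 * s)%N * tri x.1 + Posz s * x.1)%R +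
    absz (Posz (3 * (4 * s))%N * tri x.2 + Posz (4 * s)%N * x.2)%R)%N) (w \o h0)); last first.
  apply: eq_theta => // -[n b]; rewrite ep /= eE; congr (absz (_ * _)).
  exact: eta224_exponent0.
rewrite (_ : theta (e \o h1) _ = theta (fun x : int * int =>
   (absz (Posz (6 * s)%N * tri x.1 + Posz s * x.1)%R +
    absz (Posz (3 * (4 * s))%N * tri x.2 + Posz (4 * s)%N * x.2)%R)%N) (w \o h1)); last first.
  apply: eq_theta => // -[n b]; rewrite ep /= eE; congr (absz (_ * _)).
  exact: eta224_exponent1.
rewrite -!thetaD; try exact: (summableM sp sp4).
apply: eq_theta => // -[n b]; rewrite /w /= -/(sg b) !(sgB, sgD, sg2, sgN, sg1).
set t := sg n; set u := sg b.
rewrite (_ : 2 * (n + b) + (n - 2 * b) = 3 * n); last by ring.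
rewrite (_ : 2 * (1 - n - b) + (2 * b - n) = 2 - 3 * n); last by ring.
rewrite (_ : t * u * (t * 1) = (t * t) * u); last by ring.
rewrite (_ : -1 * t * u * (1 * t) = - ((t * t) * u)); last by ring.
rewrite sg_sq (_ : 2 - 3 * n = (1 - 3 * n) + (1 - 3 * n) + 3 * n); last by ring.
by rewrite !intrD; ring.
Qed.

End ThetaRelations.

(** * A ternary theta series and its Hecke operator at 5 *)

Section TenthPower.
Local Open Scope ring_scope.
Local Notation K := 'F_11.
Local Notation q := (qX K).
Local Notation E := (euler K).
Local Notation sg := (sg K).

Lemma cf0_eulerX s n : (0 < s)%N -> cf (E s ^+ n) 0 = 1.
Proof. by move=> s0; rewrite cf0X cf0_euler // expr1n. Qed.

Lemma psi_eta224 s : (0 < s)%N -> psi K (2 * s) * E s ^+ 2 = eta224 s.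
Proof.
move=> s0; have s20 : (0 < 2 * s)%N by lia. have s40 : (0 < 4 * s)%N by lia.
have h1 := eta224E s0; have h2 := psiE K s20; have h3 := phimE K s0.
rewrite mulnA in h2.
apply: (@mulfps_inj _ (E (4 * s) * E (2 * s))).
  by rewrite cf0M !cf0_euler // mulr1.
transitivity (E (4 * s) * (psi K (2 * s) * E (2 * s)) * E s ^+ 2); first by ring.
transitivity (E (2 * s) * (eta224 s * E (4 * s))); last by ring.
by rewrite h1 h2 -h3; ring.
Qed.

Lemma phi_eta5_2 s : (0 < s)%N -> phi K s * E s ^+ 2 = eta5_2 (2 * s).
Proof.
move=> s0; have s20 : (0 < 2 * s)%N by lia. have s40 : (0 < 4 * s)%N by lia.
have h1 := eta5_2E s20; have h2 := phiE K s0; have h3 := phimE K s20.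
rewrite mulnA in h1; rewrite mulnA in h3.
apply: (@mulfps_inj _ (E (4 * s) ^+ 2)); first exact: cf0_eulerX.
transitivity (phi K s * (E s ^+ 2 * E (4 * s) ^+ 2)); first by ring.
transitivity (E (4 * s) * (eta5_2 (2 * s) * E (4 * s))); last by ring.
rewrite h1 h2; transitivity (E (2 * s) ^+ 3 * (phim K (2 * s) * E (4 * s))); last by ring.
by rewrite h3; ring.
Qed.

(** Multiplying both theta functions by [E s ^+ 2] multiplies their Wronskian by [E s ^+ 4], the
    derivatives of the common factor cancelling. The sixth power becomes a tenth, and the products
    are again theta series. *)
Lemma euler10_bracket s : (0 < s)%N ->
  s%:R * E s ^+ 10 =
  qD4 s (eta224 s) * eta5_2 (2 * s) - eta224 s * qD4 0 (eta5_2 (2 * s)).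
Proof.
move=> s0; rewrite -psi_eta224 // -phi_eta5_2 //.
transitivity (E s ^+ 4 * (s%:R * E s ^+ 6)); first by ring.
by rewrite euler_bracket // /qD4 !qDM; ring.
Qed.

Lemma theta_natr (I : choiceType) (e : I -> nat) (w : I -> K) n : summable e ->
  n%:R * theta e w = theta e (fun i => n%:R * w i).
Proof. by move=> se; rewrite -(rmorph_nat (@fps_const K)) -thetaZ. Qed.

Lemma qD4_theta (I : choiceType) (e : I -> nat) (w : I -> K) m : summable e ->
  qD4 m (theta e w) = theta e (fun i => (4%:R * (e i)%:R + m%:R) * w i).
Proof.
move=> se; rewrite /qD4 qD_theta // !theta_natr // -thetaD //.
by apply: eq_theta => // i; ring.
Qed.

Lemma cf_theta_affine (I : choiceType) (e : I -> nat) (w : I -> K) N :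
  cf (theta (fun i => 6 * e i + 5)%N w) (6 * N + 5)%N = cf (theta e w) N.
Proof.
rewrite /=; apply: eq_fsbigl; congr (mkset _); apply/funext => i /=.
by rewrite !inE; congr is_true; apply/eqP/eqP; lia.
Qed.

Definition qform (x : int * int * int) : nat :=
  absz (x.1.1 * x.1.1 + x.1.2 * x.1.2 + 6 * (x.2 * x.2)).

(** Like [beta], an odd function modulo 6; their signs compensate the oddness of [harmonic] in [u]
    and in [v], so the weight is unchanged by [u -> -u] and by [v -> -v]. *)
Definition alpha (u : int) : K :=
  if (u %% 6)%Z == 1 then 1 else if (u %% 6)%Z == 5 then -1 else 0.
Definition beta (v : int) : K :=
  if (v %% 6)%Z == 4 then 1 else if (v %% 6)%Z == 2 then -1 else 0.
(** A quarter of the imaginary part of [(u + i v)^4]. *)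
Definition harmonic (u v : int) : int := u * v * (u * u - v * v).
Definition qweight (x : int * int * int) : K :=
  alpha x.1.1 * beta x.1.2 * sg x.2 * (harmonic x.1.1 x.1.2)%:~R.

Lemma summable_qform : summable qform.
Proof.
move=> n; exists [seq (x, k) | x <- [seq (u, v) | u <- zrange n, v <- zrange n], k <- zrange n].
move=> [[u v] k] le; have {}le : (absz (u * u + v * v + 6 * (k * k))%R <= n)%N := le.
have hu : u \in zrange n by rewrite mem_zrange; nia.
have hv : v \in zrange n by rewrite mem_zrange; nia.
have hk : k \in zrange n by rewrite mem_zrange; nia.
by apply: allpairs_f => //; apply: allpairs_f.
Qed.

Lemma alpha_neq0 u : alpha u != 0 -> exists m, u = 1 - 6 * m \/ u = 6 * m - 1.
Proof.
rewrite /alpha; have [e _|_] := eqVneq (u %% 6)%Z 1.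
  by exists (- (u %/ 6)%Z); left; lia.
have [e _|_] := eqVneq (u %% 6)%Z 5; last by rewrite eqxx.
by exists ((u %/ 6)%Z + 1); right; lia.
Qed.

Lemma beta_neq0 v : beta v != 0 -> exists n, v = 6 * n - 2 \/ v = 2 - 6 * n.
Proof.
rewrite /beta; have [e _|_] := eqVneq (v %% 6)%Z 4.
  by exists ((v %/ 6)%Z + 1); left; lia.
have [e _|_] := eqVneq (v %% 6)%Z 2; last by rewrite eqxx.
by exists (- (v %/ 6)%Z); right; lia.
Qed.

Lemma alpha1 m : alpha (1 - 6 * m) = 1.
Proof. by rewrite /alpha (_ : ((1 - 6 * m) %% 6)%Z = 1) //; lia. Qed.
Lemma alpha5 m : alpha (6 * m - 1) = -1.
Proof. by rewrite /alpha (_ : ((6 * m - 1) %% 6)%Z = 5) //; lia. Qed.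
Lemma beta4 n : beta (6 * n - 2) = 1.
Proof. by rewrite /beta (_ : ((6 * n - 2) %% 6)%Z = 4) //; lia. Qed.
Lemma beta2 n : beta (2 - 6 * n) = -1.
Proof. by rewrite /beta (_ : ((2 - 6 * n) %% 6)%Z = 2) //; lia. Qed.

(** Up to signs of [u] and [v], the support consists of [u = 1 - 6 m], [v = 6 n - 2] and [k], with
    [m] from [eta5_2 4], [n] from [eta224 2] and [k] from [phi(-q)]. In [24 = 4 * 2 * 3], the 4
    counts the signs, the 2 is the factor in [euler10_bracket] at [s = 2], and the 3 clears the
    denominators of the exponents in terms of [u] and [v]. *)
Lemma ternary_theta N :
  24%:R * cf (phim K 1 * E 2 ^+ 10) N = cf (theta qform qweight) (6 * N + 5)%N.
Proof.
pose h1 (x : int * int * int) := ((1 - 6 * x.1.1, x.1.2), x.2).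
pose h1' (x : int * int * int) := ((6 * x.1.1 - 1, x.1.2), x.2).
have i1 : injective h1 by move=> [[m v] k] [[m' v'] k'] [] *; congr ((_, _), _); lia.
have i1' : injective h1' by move=> [[m v] k] [[m' v'] k'] [] *; congr ((_, _), _); lia.
have d1 x y : h1 x <> h1' y by case: x y => [[m v] k] [[m' v'] k'] [] /=; lia.
have c1 x : qweight x != 0 -> (exists y, x = h1 y) \/ (exists y, x = h1' y).
  case: x => [[u v] k]; rewrite /qweight /= !mulf_eq0 !negb_or => /andP[/andP[/andP[/alpha_neq0 + _] _] _].
  by case=> m [->|->]; [left|right]; exists ((m, v), k).
rewrite (theta_split_supp summable_qform i1 i1' d1 c1).
have -> : theta (qform \o h1') (qweight \o h1') = theta (qform \o h1) (qweight \o h1).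
  apply: eq_theta => -[[m v] k]; first by rewrite /qform /=; congr absz; ring.
  by rewrite /qweight /= alpha1 alpha5 /harmonic !intrM !intrB !intrM !intrB; ring.
have s1 := summable_comp i1 summable_qform.
pose h2 (x : int * int * int) := ((x.1.1, 6 * x.1.2 - 2), x.2).
pose h2' (x : int * int * int) := ((x.1.1, 2 - 6 * x.1.2), x.2).
have i2 : injective h2 by move=> [[m v] k] [[m' v'] k'] [] *; congr ((_, _), _); lia.
have i2' : injective h2' by move=> [[m v] k] [[m' v'] k'] [] *; congr ((_, _), _); lia.
have d2 x y : h2 x <> h2' y by case: x y => [[m v] k] [[m' v'] k'] [] /=; lia.
have c2 x : (qweight \o h1) x != 0 -> (exists y, x = h2 y) \/ (exists y, x = h2' y).
  case: x => [[u v] k]; rewrite /qweight /= !mulf_eq0 !negb_or => /andP[/andP[/andP[_ /beta_neq0 +] _] _].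
  by case=> m [->|->]; [left|right]; exists ((u, m), k).
rewrite (theta_split_supp s1 i2 i2' d2 c2).
have -> : theta ((qform \o h1) \o h2') ((qweight \o h1) \o h2') =
          theta ((qform \o h1) \o h2) ((qweight \o h1) \o h2).
  apply: eq_theta => -[[m v] k]; first by rewrite /qform /=; congr absz; ring.
  by rewrite /qweight /= beta4 beta2 /harmonic !intrM !intrB !intrM !intrB; ring.
have s2 := summable_sq (isT : (0 < 1)%N); have s3 := summable_eta224 (isT : (0 < 2)%N).
have s4 := summable_pent (isT : (0 < 2 * 2)%N).
pose e1 (n : int) := absz (Posz (6 * 2)%N * tri n + Posz 2 * n).
pose e2 (m : int) := absz (Posz (3 * (2 * 2))%N * tri m + Posz (2 * 2)%N * m).
pose e0 (k : int) := absz (Posz (2 * 1)%N * tri k + Posz 1 * k).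
have se1 : summable e1 by []. have se2 : summable e2 by []. have se0 : summable e0 by [].
have eb : 2%:R * E 2 ^+ 10 = theta (fun x : int * int => (e1 x.1 + e2 x.2)%N)
    (fun x => (4%:R * (e1 x.1)%:R + 2%:R - 4%:R * (e2 x.2)%:R) *
      ((1 - 3 * x.1)%:~R * (1 - 6 * x.2)%:~R)).
  have s12 := summableM se1 se2.
  rewrite euler10_bracket // !qD4_theta // !thetaM // -thetaN // -thetaD //.
  by apply: eq_theta => // -[n m] /=; rewrite -/(e1 n) -/(e2 m); ring.
have s012 := summableM se0 (summableM se1 se2).
pose e3 (x : int * int * int) := (e0 x.2 + (e1 x.1.2 + e2 x.1.1))%N.
have qf x : ((qform \o h1) \o h2) x = (6 * e3 x + 5)%N.
  case: x => [[m n] k]; apply/eqP; rewrite -(eqr_nat int) !natz /e3 /qform /=.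
  have p1 := sq_ge0 1 k; have p2 := eta224_ge0 2 n; have p3 := pent_ge0 (2 * 2) m.
  have p0 : 0 <= (1 - 6 * m) * (1 - 6 * m) + (6 * n - 2) * (6 * n - 2) + 6 * (k * k).
    by apply: addr_ge0; [apply: addr_ge0; apply: sqr_ge0 | apply: mulr_ge0 => //; apply: sqr_ge0].
  rewrite PoszD PoszM !PoszD !abszE !ger0_norm //.
  apply/eqP; rewrite !PoszM.
  have t1 := tri2 k; have t2 := tri2 n; have t3 := tri2 m.
  transitivity (6 * (2 * tri k + k) + 6 * (6 * (2 * tri n) + 2 * n) + 6 * (6 * (2 * tri m) + 4 * m) + 5); last by ring.
  by rewrite t1 t2 t3; ring.
have e1E n : 3%:R * (e1 n)%:R = ((3 * n - 1) * (3 * n - 1) * 2 - 2)%:~R :> K.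
  have <- : 3 * Posz (e1 n) = (3 * n - 1) * (3 * n - 1) * 2 - 2.
    rewrite abszE ger0_norm ?eta224_ge0 // PoszM.
    transitivity (3 * (6 * (2 * tri n) + 2 * n)); first by ring.
    by rewrite tri2; ring.
  by rewrite intrM.
have e2E m : 6%:R * (e2 m)%:R = ((6 * m - 1) * (6 * m - 1) - 1)%:~R :> K.
  have <- : 6 * Posz (e2 m) = (6 * m - 1) * (6 * m - 1) - 1.
    rewrite abszE ger0_norm ?pent_ge0 // !PoszM.
    transitivity (6 * (6 * (2 * tri m) + 4 * m)); first by ring.
    by rewrite tri2; ring.
  by rewrite intrM.
pose g (x : int * int * int) := (x.2, (x.1.2, x.1.1)).
have bg : bijective g by exists (fun y => ((y.2.2, y.2.1), y.1)) => [[[m n] k]|[k [n m]]].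
have key : theta e3 ((qweight \o h1) \o h2) = 3%:R * (phim K 1 * (2%:R * E 2 ^+ 10)).
  rewrite eb; set w12 := fun x : int * int => _ * _.
  have -> : phim K 1 * theta (fun x : int * int => (e1 x.1 + e2 x.2)%N) w12 =
     theta (fun x : int * (int * int) => (e0 x.1 + (e1 x.2.1 + e2 x.2.2))%N)
       (fun x => sg x.1 * w12 x.2) by exact: (thetaM _ _ se0 (summableM se1 se2)).
  rewrite (theta_bij _ s012 bg) theta_natr; last exact: (summable_comp (bij_inj bg) s012).
  apply: eq_theta => // -[[m n] k]; rewrite /qweight /w12 /= alpha1 beta4 -/(sg k).
  set A := (e1 n)%:R; set B := (e2 m)%:R; set t := sg k.
  transitivity (t * ((4%:R * (3%:R * A) + 6%:R - 2%:R * (6%:R * B)) *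
    ((1 - 3 * n)%:~R * (1 - 6 * m)%:~R))); last by ring.
  by rewrite e1E e2E /harmonic !(intrM, intrB); ring.
have -> : theta ((qform \o h1) \o h2) ((qweight \o h1) \o h2) =
          theta (fun x => 6 * e3 x + 5)%N ((qweight \o h1) \o h2) by exact: eq_theta.
set X := theta _ _; have XE : cf X (6 * N + 5) = 6%:R * cf (phim K 1 * E 2 ^+ 10) N.
  have e6 : 3%:R * (phim K 1 * (2%:R * E 2 ^+ 10)) = fps_const 6%:R * (phim K 1 * E 2 ^+ 10).
    by rewrite (rmorph_nat (@fps_const K)); ring.
  by rewrite /X cf_theta_affine key e6 cf_constM.
rewrite !cfD XE; set c := cf _ _.
by rewrite -!mulrDl -!natrD.
Qed.

End TenthPower.

Section HeckeFive.
Local Open Scope ring_scope.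
Local Notation K := 'F_11.

Definition qval (u v k : int) : int := u * u + v * v + 6 * (k * k).

(* The scaling by 5 and the similitudes of norm 25 of the form [qval] attached *)
(* to its six isotropic lines modulo 5.                                         *)
Definition hecke5 (i : nat) (x : int * int * int) : int * int * int :=
  let: (u, v, k) := x in
  match i with
  | 0%N => (5 * u, 5 * v, 5 * k)
  | 1%N => (u - 12 * k, 5 * v, 2 * u + k)
  | 2%N => (u + 12 * k, 5 * v, - 2 * u + k)
  | 3%N => (5 * u, v - 12 * k, 2 * v + k)
  | 4%N => (5 * u, v + 12 * k, - 2 * v + k)
  | 5%N => (3 * u + 4 * v, - 4 * u + 3 * v, 5 * k)
  | _ => (3 * u - 4 * v, 4 * u + 3 * v, 5 * k)
  end.

Lemma qval_hecke5 i u v k : let: (u', v', k') := hecke5 i (u, v, k) in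
  qval u' v' k' = 25 * qval u v k.
Proof. by case: i => [|[|[|[|[|[|i]]]]]]; rewrite /= /qval; ring. Qed.

(** Modulo 5 the form is [u^2 + v^2 + k^2], with six isotropic lines, numbered 1 to 6; index 0 is
    the zero vector. *)
Definition line5 (i : nat) (x : int * int * int) : bool :=
  let: (u, v, k) := x in
  match i with
  | 0%N => [&& (5 %| u)%Z, (5 %| v)%Z & (5 %| k)%Z]
  | 1%N => (5 %| v)%Z && (5 %| k - 2 * u)%Z
  | 2%N => (5 %| v)%Z && (5 %| k + 2 * u)%Z
  | 3%N => (5 %| u)%Z && (5 %| k - 2 * v)%Z
  | 4%N => (5 %| u)%Z && (5 %| k + 2 * v)%Z
  | 5%N => (5 %| k)%Z && (5 %| v - 2 * u)%Z
  | _ => (5 %| k)%Z && (5 %| v + 2 * u)%Z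
  end.

Lemma mod5_cases (z : int) : exists e m : int,
  [/\ z = 5 * (z %/ 5)%Z + e, z * z = 5 * m + e * e &
      [\/ e = 0, e = 1 | [\/ e = 2, e = 3 | e = 4]]].
Proof.
have := divz_eq z 5; have := ltz_pmod z (isT : (0 : int) < 5).
have := modz_ge0 z (isT : (5 : int) != 0).
set r := (z %% 5)%Z; set d := (z %/ 5)%Z => r0 r5 ez.
exists r, (5 * d * d + 2 * d * r); split; first by rewrite {1}ez; ring.
  by rewrite ez; ring.
have [e|[e|[e|[e|e]]]] : r = 0 \/ r = 1 \/ r = 2 \/ r = 3 \/ r = 4 by lia.
- by constructor 1.
- by constructor 2.
- by constructor 3; constructor 1.
- by constructor 3; constructor 2.
- by constructor 3; constructor 3.
Qed.

Lemma isotropic5 u v k n : qval u v k = 5 * n -> exists i : 'I_7, line5 i (u, v, k).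
Proof.
rewrite /qval.
have [eu [mu [hu -> cu]]] := mod5_cases u.
have [ev [mv [hv -> cv]]] := mod5_cases v.
have [ek [mk [hk -> ck]]] := mod5_cases k.
move: (u %/ 5)%Z (v %/ 5)%Z (k %/ 5)%Z hu hv hk => a b c -> -> ->.
(* Among the 125 residue vectors, those with norm not divisible by 5 contradict [eq]; the others lie
   on a listed line. *)
case: cu => [->|->|[->|->|->]]; case: cv => [->|->|[->|->|->]];
 case: ck => [->|->|[->|->|->]] => eq; try (exfalso; lia).
all: first
  [ by exists (inord 0); rewrite inordK //= ; lia
  | by exists (inord 1); rewrite inordK //= ; lia
  | by exists (inord 2); rewrite inordK //= ; lia
  | by exists (inord 3); rewrite inordK //= ; lia
  | by exists (inord 4); rewrite inordK //= ; lia
  | by exists (inord 5); rewrite inordK //= ; lia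
  | by exists (inord 6); rewrite inordK //= ; lia ].
Qed.

Lemma square_mod5 t m n : t * t = 5 * m + n -> (n %% 5)%Z != 2 /\ (n %% 5)%Z != 3.
Proof.
have [e [mt [_ -> ce]]] := mod5_cases t.
by case: ce => [->|->|[->|->|->]] => eq; split; apply/eqP; lia.
Qed.

Lemma hecke5_line (i : 'I_7) x : line5 i (hecke5 i x).
Proof.
case: x => [[u v] k]; case: i => [[|[|[|[|[|[|[|i]]]]]]] //= _]; lia.
Qed.

Lemma line5_uniq (i j : 'I_7) x : line5 i x -> line5 j x -> ~~ line5 0 x -> i = j.
Proof.
case: x => [[u v] k] hi hj h0; apply: val_inj.
move: hi hj h0; case: i => [[|[|[|[|[|[|[|i]]]]]]] //= _];
 case: j => [[|[|[|[|[|[|[|j]]]]]]] //= _]; lia.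
Qed.

(** Divisibility of the image by 5 makes two of the variables proportional modulo 5 so that their
    part of the norm vanishes there; the norm is then the square of the third variable modulo 5, and
    2 and 3 are not squares. *)
Lemma hecke5_primitive (i : 'I_7) u v k n : qval u v k = n ->
  (n %% 5)%Z = 2 \/ (n %% 5)%Z = 3 -> i != 0 :> nat -> ~~ line5 0 (hecke5 i (u, v, k)).
Proof.
move=> <- hn i0; apply/negP => h.
have [t [m e]] : exists t m, t * t = 5 * m + qval u v k.
  move: i0 h; case: i => [[|[|[|[|[|[|[|i]]]]]]] //= _] _ /and3P[/dvdzP[a ha] /dvdzP[b hb] /dvdzP[c hc]].
  - exists v; have -> : u = a * 5 + 12 * k by lia.
    by exists (- (5 * a * a + 24 * a * k + 30 * k * k)); rewrite /qval; ring.
  - exists v; have -> : u = a * 5 - 12 * k by lia.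
    by exists (- (5 * a * a - 24 * a * k + 30 * k * k)); rewrite /qval; ring.
  - exists u; have -> : v = b * 5 + 12 * k by lia.
    by exists (- (5 * b * b + 24 * b * k + 30 * k * k)); rewrite /qval; ring.
  - exists u; have -> : v = b * 5 - 12 * k by lia.
    by exists (- (5 * b * b - 24 * b * k + 30 * k * k)); rewrite /qval; ring.
  - have [w ->] : exists w, u = 2 * v + 5 * w by exists (2 * a - u - 2 * v); lia.
    by exists k, (- (v * v + 4 * v * w + 5 * w * w + k * k)); rewrite /qval; ring.
  - have [w ->] : exists w, u = - 2 * v + 5 * w by exists (2 * a - u + 2 * v); lia.
    by exists k, (- (v * v - 4 * v * w + 5 * w * w + k * k)); rewrite /qval; ring.
by have [/eqP h2 /eqP h3] := square_mod5 e; case: hn.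
Qed.

Lemma hecke5_inj i : injective (hecke5 i).
Proof.
move=> [[u v] k] [[u' v'] k'].
by case: i => [|[|[|[|[|[|i]]]]]] [] /= *; congr ((_, _), _); lia.
Qed.

Lemma dvd5M (x y : int) : (5 %| x * y)%Z -> (5 %| x)%Z || (5 %| y)%Z.
Proof. by rewrite !dvdzE abszM Euclid_dvdM. Qed.

Lemma hecke5_surj u v k n : qval u v k = 25 * n ->
  exists (i : 'I_7) (y : int * int * int), (u, v, k) = hecke5 i y.
Proof.
move=> eq; have [i hi] : exists i : 'I_7, line5 i (u, v, k).
  by apply: (@isotropic5 _ _ _ (5 * n)); rewrite eq; ring.
have [/and3P[/dvdzP[a ha] /dvdzP[b hb] /dvdzP[c hc]]|h0] := boolP (line5 0 (u, v, k)).
  by exists ord0, ((a, b), c); rewrite /= ha hb hc; congr ((_, _), _); ring.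
exists i; move: hi; case: i => [[|[|[|[|[|[|[|i]]]]]]] //= _].
- by move=> h; case/negP: h0.
- move=> /andP[/dvdzP[b hb] /dvdzP[a ha]].
  (* With [v = 5 b] and [k = 5 a + 2 u] the norm is [120 u a] modulo 25, so 5 divides [u] or [a].
     The former would make the whole vector divisible by 5; the latter, [a = 5 t], inverts the
     similitude. The remaining lines follow this pattern. *)
  have /dvd5M/orP[du|/dvdzP[t ht]] : (5 %| u * a)%Z.
  + by move: eq; rewrite (_ : k = a * 5 + 2 * u) ?hb /qval; lia.
  + by case/negP: h0; rewrite /=; lia.
  by exists ((u + 12 * t, b), t); congr ((_, _), _); lia.
- move=> /andP[/dvdzP[b hb] /dvdzP[a ha]].
  have /dvd5M/orP[du|/dvdzP[t ht]] : (5 %| u * a)%Z.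
  + by move: eq; rewrite (_ : k = a * 5 - 2 * u) ?hb /qval; lia.
  + by case/negP: h0; rewrite /=; lia.
  by exists ((u - 12 * t, b), t); congr ((_, _), _); lia.
- move=> /andP[/dvdzP[b hb] /dvdzP[a ha]].
  have /dvd5M/orP[du|/dvdzP[t ht]] : (5 %| v * a)%Z.
  + by move: eq; rewrite (_ : k = a * 5 + 2 * v) ?hb /qval; lia.
  + by case/negP: h0; rewrite /=; lia.
  by exists ((b, v + 12 * t), t); congr ((_, _), _); lia.
- move=> /andP[/dvdzP[b hb] /dvdzP[a ha]].
  have /dvd5M/orP[du|/dvdzP[t ht]] : (5 %| v * a)%Z.
  + by move: eq; rewrite (_ : k = a * 5 - 2 * v) ?hb /qval; lia.
  + by case/negP: h0; rewrite /=; lia.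
  by exists ((b, v - 12 * t), t); congr ((_, _), _); lia.
- move=> /andP[/dvdzP[b hb] /dvdzP[a ha]].
  have /dvd5M/orP[du|/dvdzP[t ht]] : (5 %| u * (u + 4 * a))%Z.
  + by move: eq; rewrite (_ : v = a * 5 + 2 * u) ?hb /qval; lia.
  + by case/negP: h0; rewrite /=; lia.
  exists ((- a - (t - a), a + 2 * (t - a)), b); congr ((_, _), _); lia.
- move=> /andP[/dvdzP[b hb] /dvdzP[a ha]].
  have /dvd5M/orP[du|/dvdzP[t ht]] : (5 %| u * (u - 4 * a))%Z.
  + by move: eq; rewrite (_ : v = a * 5 - 2 * u) ?hb /qval; lia.
  + by case/negP: h0; rewrite /=; lia.
  exists ((a - (t + a), a - 2 * (t + a)), b); congr ((_, _), _); lia.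
Qed.

Lemma alphaD a r : alpha (6 * a + r) = alpha r.
Proof. by rewrite /alpha (_ : ((6 * a + r) %% 6)%Z = (r %% 6)%Z) // mulrC modzMDl. Qed.
Lemma betaD a r : beta (6 * a + r) = beta r.
Proof. by rewrite /beta (_ : ((6 * a + r) %% 6)%Z = (r %% 6)%Z) // mulrC modzMDl. Qed.

Lemma mod6_cases (z : int) : exists a (r : 'I_6), z = 6 * a + Posz r.
Proof.
have := divz_eq z 6; have := ltz_pmod z (isT : (0 : int) < 6).
have := modz_ge0 z (isT : (6 : int) != 0) => r0 r6 ez.
have lt : (absz (z %% 6)%Z < 6)%N by lia.
by exists (z %/ 6)%Z, (Ordinal lt); rewrite {1}ez /= abszE ger0_norm //; ring.
Qed.

Lemma alpha_5 u : alpha (5 * u) = - alpha u.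
Proof.
have [a [r ->]] := mod6_cases u; rewrite (_ : 5 * (6 * a + Posz r) = 6 * (5 * a) + 5 * Posz r); last by ring.
rewrite !alphaD; case: r => [[|[|[|[|[|[|r]]]]]] //= _]; exact: val_inj.
Qed.
Lemma beta_5 v : beta (5 * v) = - beta v.
Proof.
have [a [r ->]] := mod6_cases v; rewrite (_ : 5 * (6 * a + Posz r) = 6 * (5 * a) + 5 * Posz r); last by ring.
rewrite !betaD; case: r => [[|[|[|[|[|[|r]]]]]] //= _]; exact: val_inj.
Qed.

Lemma alpha_beta_rot u v :
  alpha (3 * u + 4 * v) * beta (- 4 * u + 3 * v) = - (alpha u * beta v) /\
  alpha (3 * u - 4 * v) * beta (4 * u + 3 * v) = - (alpha u * beta v).
Proof.
have [a [r ->]] := mod6_cases u; have [b [s ->]] := mod6_cases v.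
rewrite (_ : 3 * _ + 4 * _ = 6 * (3 * a + 4 * b) + (3 * Posz r + 4 * Posz s)); last by ring.
rewrite (_ : - 4 * _ + 3 * _ = 6 * (- 4 * a + 3 * b) + (- 4 * Posz r + 3 * Posz s)); last by ring.
rewrite (_ : 3 * _ - 4 * _ = 6 * (3 * a - 4 * b) + (3 * Posz r - 4 * Posz s)); last by ring.
rewrite (_ : 4 * _ + 3 * _ = 6 * (4 * a + 3 * b) + (4 * Posz r + 3 * Posz s)); last by ring.
rewrite !alphaD !betaD.
case: r => [[|[|[|[|[|[|r]]]]]] //= _]; case: s => [[|[|[|[|[|[|s]]]]]] //= _];
 by split; apply: val_inj.
Qed.

Lemma alpha_12 u k : alpha (u + 12 * k) = alpha u /\ alpha (u - 12 * k) = alpha u.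
Proof.
rewrite (_ : u + _ = 6 * (2 * k) + u); last by ring.
by rewrite (_ : u - _ = 6 * (- 2 * k) + u) ?alphaD //; ring.
Qed.
Lemma beta_12 u k : beta (u + 12 * k) = beta u /\ beta (u - 12 * k) = beta u.
Proof.
rewrite (_ : u + _ = 6 * (2 * k) + u); last by ring.
by rewrite (_ : u - _ = 6 * (- 2 * k) + u) ?betaD //; ring.
Qed.

(* Since [harmonic] has eigenvalue -794 under the six similitudes, the sum is *)
(* [625 + 794 = 11 * 129] times the weight.                                     *)
Lemma sum_hecke5 x : \sum_(i < 7) qweight (hecke5 i x) = 0.
Proof.
case: x => [[u v] k]; rewrite !big_ord_recl big_ord0 /qweight /=.
have [r1 r2] := alpha_beta_rot u v; have [a1 a2] := alpha_12 u k; have [b1 b2] := beta_12 v k.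
rewrite r1 r2 a1 a2 b1 b2 alpha_5 beta_5 !mulNr !mulrN !mulNr !opprK.
have s5 : sg K (5 * k) = sg K k.
  by rewrite (_ : 5 * k = 2 * (2 * k) + k) ?sgD ?sg2 ?mul1r //; ring.
rewrite s5 !sgD !sgN !sg2 !mul1r; set c := alpha u * beta v * sg K k.
(* The product of the three characters is fixed by the scaling and changes sign under each of the
   six similitudes. *)
transitivity (c * (harmonic (5 * u) (5 * v) - harmonic (u - 12 * k) (5 * v)
  - harmonic (u + 12 * k) (5 * v) - harmonic (5 * u) (v - 12 * k)
  - harmonic (5 * u) (v + 12 * k) - harmonic (3 * u + 4 * v) (- (4 * u) + 3 * v)
  - harmonic (3 * u - 4 * v) (4 * u + 3 * v))%:~R); first by rewrite !rmorphB /=; ring.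
rewrite (_ : _ - _ = 11 * (129 * harmonic u v)); last by rewrite /harmonic; ring.
by rewrite intrM (_ : 11%:~R = 0) ?mul0r ?mulr0 //; apply: val_inj.
Qed.

Lemma cf_theta_25 (n : nat) : (n %% 5 == 2)%N || (n %% 5 == 3)%N ->
  cf (theta qform qweight) (25 * n) = 0.
Proof.
move=> hn.
have qvalE x : Posz (qform x) = qval x.1.1 x.1.2 x.2.
  rewrite abszE ger0_norm //.
  by apply: addr_ge0; [apply: addr_ge0; apply: sqr_ge0 | apply: mulr_ge0 => //; apply: sqr_ge0].
have qh i x : qform (hecke5 i x) = (25 * qform x)%N.
  apply/eqP; rewrite -(eqr_nat int) !natz PoszM !qvalE; apply/eqP.
  by case: x => [[u v] k]; have := qval_hecke5 i u v k; case: (hecke5 _ _) => [[u' v'] k'].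
have [s us sP] := summable_seq summable_qform n.+1.
pose Y := [seq y <- s | qform y == n].
have memY y : (y \in Y) = (qform y == n).
  by rewrite mem_filter; case: eqP => //= e; rewrite sP // e.
(* Each vector of norm [25 n] occurs in [L] exactly once: a repetition would put it on two lines,
   hence make an image under a similitude divisible by 5, which [prim] excludes. *)
pose L := [seq hecke5 (i : 'I_7) y | i <- enum 'I_7, y <- Y].
have prim (i : 'I_7) y : qform y = n -> i != 0 :> nat -> ~~ line5 0 (hecke5 i y).
  case: y => [[u v] k] ey; apply: (@hecke5_primitive i u v k (Posz n)); last by lia.
  by rewrite -ey qvalE.
have uL : uniq L.
  apply: allpairs_uniq => [||[i x] [j y]]; [exact: enum_uniq | exact: filter_uniq |].
  move=> /allpairsP[[i' x'] /= [_ xY [-> ->]]] /allpairsP[[j' y'] /= [_ yY [-> ->]]] e.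
  move: xY yY; rewrite !memY => /eqP ex /eqP ey.
  suff ij : i' = j' by move: e; rewrite ij => /hecke5_inj ->.
  have li := hecke5_line i' x'; have lj := hecke5_line j' y'; rewrite -e in lj.
  have [i0|i0] := eqVneq (nat_of_ord i') 0%N.
    have [j0|j0] := eqVneq (nat_of_ord j') 0%N; first by apply: val_inj; rewrite /= i0 j0.
    by have := prim j' y' ey j0; rewrite -e; move: li; rewrite {1}i0 => ->.
  exact: line5_uniq li lj (prim i' x' ex i0).
have LP x : qform x = (25 * n)%N -> x \in L.
  case: x => [[u v] k] ex; have qv : qval u v k = 25 * Posz n.
    by have := qvalE (u, v, k); rewrite ex PoszM => <-.
  have [i [y e]] := hecke5_surj qv; rewrite e; apply: allpairs_f; first by rewrite mem_enum.
  by rewrite memY; move: ex; rewrite e qh => /eqP; rewrite eqn_pmul2l.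
rewrite (cf_theta _ uL LP) big_mkcond big_allpairs_dep exchange_big /=.
rewrite big_seq big1 // => y; rewrite memY => /eqP ey.
rewrite -[RHS](sum_hecke5 y) big_enum; apply: eq_bigr => i _.
by rewrite qh ey eqxx.
Qed.

End HeckeFive.

(** * The Cartier operator modulo 11 *)

Section ThetaODE.
Local Open Scope ring_scope.
Local Notation K := 'F_11.
Local Notation q := (qX K).

Lemma cf0M1 (f g : fps K) : cf f 0 = 1 -> cf g 0 = 1 -> cf (f * g) 0 = 1.
Proof. by move=> f0 g0; rewrite cf0M f0 g0 mulr1. Qed.
Lemma cf0X1 (f : fps K) n : cf f 0 = 1 -> cf (f ^+ n) 0 = 1.
Proof. by move=> f0; rewrite cf0X f0 expr1n. Qed.
Lemma cf0_quot (f g h : fps K) : f * g = h -> cf g 0 = 1 -> cf h 0 = 1 -> cf f 0 = 1.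
Proof. by move=> <- g0; rewrite cf0M g0 mulr1. Qed.

Lemma nat11 : 11%:R = 0 :> fps K.
Proof.
rewrite -(rmorph_nat (@fps_const K)) (_ : 11%:R = 0 :> K) ?rmorph0 //; exact: val_inj.
Qed.

Lemma mod11 (f g h : fps K) : f = g + 11%:R * h -> f = g.
Proof. by move=> ->; rewrite nat11 mul0r addr0. Qed.

Lemma qDD (f g : fps K) : qD (f + g) = qD f + qD g. Proof. exact: raddfD. Qed.
Lemma qDB (f g : fps K) : qD (f - g) = qD f - qD g. Proof. exact: raddfB. Qed.

(** Divided by [a b], the third order bracket contains second derivatives only in
    [D^2 W2 - D^2 W3 = D^2 x], which is first order in [W]; so it can be solved for [D W]. Over the
    rationals the result is [2 D W = W^2 - x y - y^2], and 6 and 5 are [1/2] and [-1/2] modulo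
    11. *)
Lemma halphen (a b h x y W W2 W3 : fps K) :
  cf a 0 = 1 -> cf b 0 = 1 -> cf h 0 = 1 -> cf x 0 = 1 ->
  qD4 1 a = W2 * a -> qD4 0 b = W3 * b -> W2 = W + x + y -> W3 = W + y ->
  qD x = x * W -> qD y = y * (W + x + y) -> h ^+ 2 = a * b * x ->
  (8%:R * qD h + h) ^+ 2 =
    qD4 1 (qD4 1 (qD4 1 a)) * b - 3%:R * (qD4 1 (qD4 1 a) * qD4 0 b)
    + 3%:R * (qD4 1 a * qD4 0 (qD4 0 b)) - a * qD4 0 (qD4 0 (qD4 0 b)) ->
  qD W = 6%:R * W ^+ 2 + 5%:R * x * y + 5%:R * y ^+ 2.
Proof.
move=> a0 b0 h0 x0 Wa Wb W2E W3E qDx qDy hh br3.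
have DhE : 8%:R * qD h + h = (W2 + W3 + 4%:R * W) * h.
  apply: (@mulfps_inj _ h) => //.
  transitivity (4%:R * qD (h ^+ 2) + h ^+ 2); first by rewrite qDX /=; ring.
  transitivity ((W2 + W3 + 4%:R * W) * h ^+ 2); last by ring.
  rewrite hh !qDM qDx; transitivity (qD4 1 a * (b * x) + a * qD4 0 b * x + 4%:R * W * (a * b * x)).
    by rewrite /qD4; ring.
  by rewrite Wa Wb; ring.
have L1 f : qD4 1 (f * a) = (4%:R * qD f + W2 * f) * a.
  transitivity (4%:R * qD f * a + f * qD4 1 a); first by rewrite /qD4 qDM; ring.
  by rewrite Wa; ring.
have M1 f : qD4 0 (f * b) = (4%:R * qD f + W3 * f) * b.
  transitivity (4%:R * qD f * b + f * qD4 0 b); first by rewrite /qD4 qDM; ring.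
  by rewrite Wb; ring.
have DW2 : qD W2 = qD W + x * W + y * (W + x + y) by rewrite W2E !qDD qDx qDy.
have DW3 : qD W3 = qD W + y * (W + x + y) by rewrite W3E qDD qDy.
have n4 : qD (4%:R : fps K) = 0 by exact: qD_nat.
have DDx : qD (qD x) = x * W * W + x * qD W by rewrite qDx qDM qDx.
move: br3; rewrite DhE Wa Wb !L1 !M1 exprMn hh.
rewrite !qDD !qDM !n4 => eq.
have key : a * b * x * (40%:R * qD W) = a * b * x * (20%:R * W ^+ 2 - 20%:R * x * y - 20%:R * y ^+ 2).
  have {}eq : (W2 + W3 + 4%:R * W) ^+ 2 * (a * b * x) = a * b *
    (16%:R * (qD (qD W2) - qD (qD W3)) + 12%:R * (W2 - W3) * (qD W2 + qD W3) + (W2 - W3) ^+ 3).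
    by rewrite eq; ring.
  have dd : qD (qD W2) - qD (qD W3) = x * W * W + x * qD W.
    by rewrite -DDx qDx DW2 DW3 -!qDB; congr qD; ring.
  have e1 : 16%:R * (a * b * x * qD W) = a * b * ((W2 + W3 + 4%:R * W) ^+ 2 * x
     - 16%:R * x * W * W - 12%:R * (W2 - W3) * (qD W2 + qD W3) - (W2 - W3) ^+ 3).
    transitivity ((W2 + W3 + 4%:R * W) ^+ 2 * (a * b * x) - a * b *
     (16%:R * x * W * W + 12%:R * (W2 - W3) * (qD W2 + qD W3) + (W2 - W3) ^+ 3)); last by ring.
    by rewrite eq dd; ring.
  transitivity (16%:R * (a * b * x * qD W) + a * b * x * (24%:R * qD W)); first by ring.
  by rewrite e1 DW2 DW3 W2E W3E; ring.
have {}key : 40%:R * qD W = 20%:R * W ^+ 2 - 20%:R * x * y - 20%:R * y ^+ 2.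
  by apply: mulfps_inj key; apply: cf0M1 => //; exact: cf0M1.
transitivity (8%:R * (40%:R * qD W)); first by apply: (@mod11 _ _ (- (29%:R * qD W))); ring.
rewrite key; apply: (@mod11 _ _ (14%:R * W ^+ 2 - 15%:R * x * y - 15%:R * y ^+ 2)); ring.
Qed.

Variables a b c e : fps K.
Hypotheses (a0 : cf a 0 = 1) (b0 : cf b 0 = 1) (c0 : cf c 0 = 1) (e0 : cf e 0 = 1).

(** For [a = psi(q^2)], [b = phi(q)] and [c = phi(-q)], the hypothesis [b4] is Jacobi's quartic
    identity, and [y / (x + y)] is the parameter of the Legendre family whose Hasse invariant is
    [pH]. *)
Let x := c ^+ 4.
Let y := 16%:R * q * a ^+ 4.

Hypothesis e6 : e ^+ 6 = a * b * x.
Hypothesis b4 : b ^+ 4 = x + y.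
Hypothesis bracket : a * b * x = qD4 1 a * b - a * qD4 0 b.
Hypothesis bracketN : a * c * (x + y) = qD4 1 a * c - a * qD4 0 c.
Hypothesis bracket3 : (8%:R * qD (e ^+ 3) + e ^+ 3) ^+ 2 =
  qD4 1 (qD4 1 (qD4 1 a)) * b - 3%:R * (qD4 1 (qD4 1 a) * qD4 0 b)
  + 3%:R * (qD4 1 a * qD4 0 (qD4 0 b)) - a * qD4 0 (qD4 0 (qD4 0 b)).

(** Four times the logarithmic derivatives of [q^(1/4) a] and of [b]. With [W], that of [c], the
    brackets say [W2 - W3 = x] and [W2 - W = x + y]. *)
Let W2 := qD4 1 a * fps_inv a.
Let W3 := qD4 0 b * fps_inv b.
Definition logder (f : fps K) := qD4 0 f * fps_inv f.
Let W := logder c.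

Lemma logderE (f g : fps K) : cf f 0 = 1 -> g * fps_inv f * f = g.
Proof. by move=> f0; rewrite -mulrA [_ * f]mulrC mulfps_inv // mulr1. Qed.

Let Wa : qD4 1 a = W2 * a. Proof. by rewrite logderE. Qed.
Let Wb : qD4 0 b = W3 * b. Proof. by rewrite logderE. Qed.
Let Wc : qD4 0 c = W * c. Proof. by rewrite logderE. Qed.

Let W23 : W2 = W3 + x.
Proof.
apply: (@mulfps_inj _ (a * b)); first exact: cf0M1.
transitivity (W2 * a * b - a * (W3 * b) + a * b * W3); first by ring.
by rewrite -Wa -Wb -bracket; ring.
Qed.

Let W24 : W2 = W + x + y.
Proof.
apply: (@mulfps_inj _ (a * c)); first exact: cf0M1.
transitivity (W2 * a * c - a * (W * c) + a * c * W); first by ring.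
by rewrite -Wa -Wc -bracketN; ring.
Qed.

Lemma qD_x : qD x = x * W.
Proof.
rewrite /x qDX /=; transitivity (c ^+ 3 * (qD4 0 c)); first by rewrite /qD4; ring.
by rewrite Wc; ring.
Qed.

Lemma qD_q : qD q = q.
Proof. by apply: fpsP => n; rewrite cf_qD /=; case: n => [|[|n]]; rewrite ?mulr1 ?mulr0. Qed.

Lemma qD_y : qD y = y * (W + x + y).
Proof.
rewrite -W24 /y (qDM _ (a ^+ 4)) (qDM _ q) qD_nat qDX qD_q /=.
transitivity (16%:R * q * a ^+ 3 * (qD4 1 a)); first by rewrite /qD4; ring.
by rewrite Wa; ring.
Qed.

Lemma qD_W : qD W = 6%:R * W ^+ 2 + 5%:R * x * y + 5%:R * y ^+ 2.
Proof.
have W3E : W3 = W + y by apply: (addIr x); rewrite -W23 W24; ring.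
have hh : (e ^+ 3) ^+ 2 = a * b * x by rewrite -exprM e6.
have x0 : cf x 0 = 1 by exact: cf0X1.
exact: (halphen a0 b0 (cf0X1 3 e0) x0 Wa Wb W24 W3E qD_x qD_y hh bracket3).
Qed.

End ThetaODE.

(** * Verified polynomial computation modulo 11 *)

Section Reflection.
Local Open Scope ring_scope.
Local Notation K := 'F_11.

(* A polynomial in W, x, y modulo 11, as a list of monomials, sorted by        *)
(* exponents so that equal polynomials are represented by equal lists.         *)
Definition mono := (nat * nat * nat)%type.
Definition mpol := seq (mono * nat).

Definition mono_lt (m n : mono) : bool :=
  let: (i, j, k) := m in let: (i', j', k') := n in
  [|| (i < i')%N, (i == i') && (j < j')%N | [&& i == i', j == j' & (k < k')%N]].

Definition mono_mul (m n : mono) : mono :=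
  let: (i, j, k) := m in let: (i', j', k') := n in ((i + i', j + j'), k + k')%N.

Fixpoint pins (m : mono) (c : nat) (p : mpol) : mpol :=
  if p is (m', c') :: p' then
    if m == m' then
      if ((c + c') %% 11 == 0)%N then p' else (m, (c + c') %% 11)%N :: p'
    else if mono_lt m m' then (m, c) :: p else (m', c') :: pins m c p'
  else [:: (m, c)].

Definition pins0 (m : mono) (c : nat) (p : mpol) : mpol :=
  if (c %% 11 == 0)%N then p else pins m (c %% 11)%N p.

Definition padd (p q : mpol) : mpol := foldr (fun t => pins0 t.1 t.2) q p.
Definition pscale (m : mono) (c : nat) (p : mpol) : mpol :=
  [seq (mono_mul m t.1, (c * t.2) %% 11)%N | t <- p].
Definition pmul (p q : mpol) : mpol :=
  foldr (fun t acc => padd (pscale t.1 t.2 q) acc) [::] p.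
Definition pexp (p : mpol) (n : nat) : mpol := iter n (pmul p) [:: ((0, 0, 0), 1)]%N.

(* The derivation with [W' = 6 W^2 + 5 x y + 5 y^2], [x' = x W] and            *)
(* [y' = y (W + x + y)].                                                        *)
Definition pder_mono (m : mono) (c : nat) : mpol :=
  let: (i, j, k) := m in
  [:: ((i.+1, j, k), c * (6 * i + j + k)); ((i.-1, j.+1, k.+1), c * (5 * i));
      ((i.-1, j, k.+2), c * (5 * i)); ((i, j.+1, k), c * k); ((i, j, k.+1), c * k)]%N.
Definition pder (p : mpol) : mpol := foldr (fun t => padd (pder_mono t.1 t.2)) [::] p.

Variables W x y : fps K.
Hypothesis qDW : qD W = 6%:R * W ^+ 2 + 5%:R * x * y + 5%:R * y ^+ 2.
Hypothesis qDx : qD x = x * W.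
Hypothesis qDy : qD y = y * (W + x + y).

Definition evm (m : mono) : fps K := W ^+ m.1.1 * x ^+ m.1.2 * y ^+ m.2.
Definition ev (p : mpol) : fps K := \sum_(t <- p) t.2%:R * evm t.1.

Lemma natr_mod11 n : (n %% 11)%:R = n%:R :> fps K.
Proof.
rewrite [in RHS](divn_eq n 11) natrD natrM; set z := (_ %/ _)%:R; move: z => z.
by apply: esym; apply: (@mod11 _ _ z); ring.
Qed.

Lemma ev_nil : ev [::] = 0. Proof. by rewrite /ev big_nil. Qed.
Lemma ev_cons m c p : ev ((m, c) :: p) = c%:R * evm m + ev p.
Proof. by rewrite /ev big_cons. Qed.

Lemma ev_pins m c p : ev (pins m c p) = c%:R * evm m + ev p.
Proof.
elim: p => [|[m' c'] p IH]; first by rewrite /= ev_cons.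
rewrite [pins _ _ _]/=; have [<-|_] := eqVneq m m'.
  have e : c%:R * evm m + (c'%:R * evm m + ev p) = ((c + c') %% 11)%:R * evm m + ev p.
    by rewrite natr_mod11 natrD; ring.
  case: eqP => [z|_]; rewrite !ev_cons e //.
  by rewrite z mul0r add0r.
by case: ifP => _; rewrite !ev_cons ?IH; ring.
Qed.

Lemma ev_pins0 m c p : ev (pins0 m c p) = c%:R * evm m + ev p.
Proof.
rewrite /pins0; case: eqP => [z|_]; last by rewrite ev_pins natr_mod11.
by rewrite -natr_mod11 z mul0r add0r.
Qed.

Lemma ev_padd p q : ev (padd p q) = ev p + ev q.
Proof.
elim: p => [|[m c] p IH] /=; first by rewrite ev_nil add0r.
by rewrite ev_pins0 IH ev_cons addrA.
Qed.

Lemma evm_mul m n : evm (mono_mul m n) = evm m * evm n.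
Proof. by case: m n => [[i j] k] [[i' j'] k']; rewrite /evm /= !exprD; ring. Qed.

Lemma ev_pscale m c p : ev (pscale m c p) = c%:R * evm m * ev p.
Proof.
elim: p => [|[m' c'] p IH] /=; first by rewrite ev_nil mulr0.
by rewrite !ev_cons IH natr_mod11 natrM evm_mul; ring.
Qed.

Lemma ev_pmul p q : ev (pmul p q) = ev p * ev q.
Proof.
elim: p => [|[m c] p IH] /=; first by rewrite ev_nil mul0r.
by rewrite ev_padd ev_pscale IH ev_cons; ring.
Qed.

Lemma ev1 : ev [:: ((0, 0, 0), 1)]%N = 1.
Proof. by rewrite ev_cons ev_nil /evm /= !expr0 !mulr1 addr0. Qed.

Lemma ev_pexp p n : ev (pexp p n) = ev p ^+ n.
Proof. by elim: n => [|n IH]; rewrite ?ev1 //= ev_pmul IH exprS. Qed.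

Lemma ev_pder_mono m c : ev (pder_mono m c) = c%:R * qD (evm m).
Proof.
case: m => [[i j] k]; rewrite /pder_mono !ev_cons ev_nil /evm /= !qDM !qDX qDW qDx qDy.
have px (f : fps K) n : n%:R * f ^+ n.-1 * f = n%:R * f ^+ n.
  by case: n => [|n]; rewrite ?mul0r //= exprSr mulrA.
transitivity (c%:R * ((i%:R * W ^+ i.-1 * W) * (6%:R * W) * x ^+ j * y ^+ k
  + i%:R * W ^+ i.-1 * (5%:R * x * y + 5%:R * y ^+ 2) * x ^+ j * y ^+ k
  + W ^+ i * (j%:R * x ^+ j.-1 * x) * W * y ^+ k
  + W ^+ i * x ^+ j * (k%:R * y ^+ k.-1 * y) * (W + x + y))); last by ring.
rewrite !px !(natrM, natrD) !exprS; ring.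
Qed.

Lemma ev_pder p : ev (pder p) = qD (ev p).
Proof.
elim: p => [|[m c] p IH] /=; first by rewrite ev_nil (raddf0 (@qD K)).
by rewrite ev_padd ev_pder_mono IH ev_cons qDD qDM qD_nat mul0r add0r.
Qed.

Lemma ev_iter_pder n p : ev (iter n pder p) = iter n (@qD K) (ev p).
Proof. by elim: n => //= n IH; rewrite ev_pder IH. Qed.

Lemma qD_fermat (f : fps K) : iter 11 (@qD K) f = qD f.
Proof.
apply: fpsP => n.
have it k : cf (iter k (@qD K) f) n = n%:R ^+ k * cf f n.
  by elim: k => [|k IH]; rewrite ?mul1r //= IH exprS mulrA.
rewrite it cf_qD; congr (_ * _).
have p11 : prime 11 by [].
by rewrite -natrX -(Fp_nat_mod p11) fermat_little // Fp_nat_mod.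
Qed.

Definition pX : mpol := [:: ((0, 1, 0), 1)]%N.
Definition pY : mpol := [:: ((0, 0, 1), 1)]%N.
Definition pXY : mpol := [:: ((0, 0, 1), 1); ((0, 1, 0), 1)]%N.
(** The quotient of [iter 11 pder pX] by [x], computed by lowering exponents; its value is [W],
    because [D^11 x = D x = x W]. *)
Definition pR : mpol := [seq ((t.1.1.1, t.1.1.2.-1, t.1.2), t.2) | t <- iter 11 pder pX].
(* The Hasse invariant of the Legendre family: [sum_i C(5,i)^2 (x+y)^(5-i) y^i]. *)
Definition pH : mpol := foldr padd [::]
  [seq pscale (0, 0, i)%N ('C(5, i) ^ 2)%N (pexp pXY (5 - i)) | i <- iota 0 6].
Definition pH2 : mpol := pmul pH pH.
(** On the eta quotient [g] the operator [D + 2] is multiplication by [3 W + 2 x + 4 y]; thus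
    [pstep p] is the cofactor of [g] in [(D + 2) (p g)]. *)
Definition pell : mpol := [:: ((0, 0, 1), 4); ((0, 1, 0), 2); ((1, 0, 0), 3)]%N.
Definition pstep (p : mpol) : mpol := padd (pder p) (pmul p pell).
Definition pten : mpol := iter 10 pstep [:: ((0, 0, 0), 1)]%N.

(* The homogenization of p of degree n in W, with W replaced by r and h as      *)
(* homogenizing variable.                                                        *)
Definition psubst (n : nat) (r h p : mpol) : mpol :=
  let T := [seq pmul (pexp r i) (pexp h (n - i)) | i <- iota 0 n.+1] in
  foldr (fun t => padd (pscale (0%N, t.1.1.2, t.1.2) t.2 (nth [::] T t.1.1.1))) [::] p.

Lemma ev_psubst n r h p : all (fun t : mono * nat => t.1.1.1 <= n)%N p ->
  ev r = W -> ev h = 1 -> ev (psubst n r h p) = ev p.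
Proof.
move=> /allP bp er eh; rewrite /psubst; set T := map _ _.
have ET i : (i <= n)%N -> ev (nth [::] T i) = W ^+ i.
  move=> lt; rewrite (nth_map 0%N) ?size_iota // nth_iota // ev_pmul !ev_pexp er eh.
  by rewrite expr1n mulr1.
elim: p bp => [|[[[i j] k] c] p IH] bp; first by [].
rewrite [foldr _ _ _]/= ev_padd IH; last by move=> t tp; apply: bp; rewrite inE tp orbT.
rewrite ev_cons ev_pscale ET; last by apply: (bp ((i, j, k), c)); rewrite mem_head.
by rewrite /evm /=; ring.
Qed.

(* Since [D^11 = D], the first two equations give [W = r] and [y * h = y] when  *)
(* W, x, y solve the system; the last one then becomes [p + x^12 y^9 (x+y)^9 = 1]. *)
Lemma certificate : exists r h p : mpol,
  [/\ iter 11 pder pX = pmul pX r,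
      iter 11 pder pXY = pmul pXY (padd r (pmul pY h)),
      p = iter 10 pstep [:: ((0, 0, 0), 1)]%N,
      all (fun t : mono * nat => t.1.1.1 <= 10)%N p &
      padd (psubst 10 r h p) (pmul (pscale (0, 12, 9)%N 1%N (pexp pXY 9)) (pexp h 8)) =
      pexp h 11].
(* The witnesses have degrees 11, 10 and 10 in [W], [x] and [y], and the powers of [h] make the last
   equation homogeneous of degree 110. Quantifying over them keeps these large polynomials opaque
   afterwards. *)
Proof. by exists pR, pH2, pten; split; vm_compute. Qed.

Hypothesis x0 : cf x 0 = 1.
Hypothesis xy0 : cf (x + y) 0 = 1.
Hypothesis y_reg : forall f g, y * f = y * g -> f = g.

Lemma ev_pX : ev pX = x.
Proof. by rewrite ev_cons ev_nil /evm /= !expr0 expr1 mul1r mulr1 addr0 mul1r. Qed.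
Lemma ev_pY : ev pY = y.
Proof. by rewrite ev_cons ev_nil /evm /= !expr0 expr1 !mul1r addr0. Qed.
Lemma ev_pXY : ev pXY = x + y.
Proof. by rewrite !ev_cons ev_nil /evm /= !expr0 !expr1; ring. Qed.

Lemma ten_identity : exists2 p : mpol, p = iter 10 pstep [:: ((0, 0, 0), 1)]%N &
  1 = ev p + x ^+ 12 * y ^+ 9 * (x + y) ^+ 9.
Proof.
have [r [h [p [er eh ep bp ec]]]] := certificate; exists p; first exact: ep.
have evr : ev r = W.
  apply: (mulfps_inj x0); rewrite -{1}ev_pX -ev_pmul -er ev_iter_pder qD_fermat.
  by rewrite ev_pX.
have evh : ev h = 1.
  apply: y_reg; apply: (@addrI _ W); rewrite -{1}evr -{1}ev_pY -ev_pmul -ev_padd mulr1.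
  apply: (mulfps_inj xy0); rewrite -{1}ev_pXY -ev_pmul -eh ev_iter_pder qD_fermat.
  by rewrite ev_pXY qDD qDx qDy; ring.
have := congr1 ev ec; rewrite ev_padd (ev_psubst bp evr evh).
rewrite (ev_pmul (pscale _ _ _)) ev_pscale !ev_pexp evh ev_pXY !expr1n => <-.
by rewrite /evm /= expr0; ring.
Qed.

Lemma iter_pstep g n : qD g + 2%:R * g = (3%:R * W + 2%:R * x + 4%:R * y) * g ->
  iter n (fun f => qD f + 2%:R * f) g = ev (iter n pstep [:: ((0, 0, 0), 1)]%N) * g.
Proof.
move=> gE; elim: n => [|n IH]; first by rewrite ev1 mul1r.
rewrite !iterS IH; move: (iter n pstep _) => p.
rewrite /pstep ev_padd ev_pder ev_pmul.
have -> : ev pell = 3%:R * W + 2%:R * x + 4%:R * y.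
  by rewrite !ev_cons ev_nil /evm /=; ring.
transitivity (qD (ev p) * g + ev p * (qD g + 2%:R * g)); first by rewrite qDM; ring.
by rewrite gE; ring.
Qed.

Lemma cf_natM m (f : fps K) n : cf (m%:R * f) n = m%:R * cf f n.
Proof. by rewrite -(rmorph_nat (@fps_const K)) cf_constM. Qed.

(* Cartier's operator: [1 - (D + 2)^10] keeps the coefficients of index 9 mod 11. *)
Lemma cartier g n : qD g + 2%:R * g = (3%:R * W + 2%:R * x + 4%:R * y) * g ->
  cf g (11 * n + 9)%N = cf (x ^+ 12 * y ^+ 9 * (x + y) ^+ 9 * g) (11 * n + 9)%N.
Proof.
move=> gE; have it k : cf (iter k (fun f => qD f + 2%:R * f) g) (11 * n + 9)%N =
    (11 * n + 9 + 2)%:R ^+ k * cf g (11 * n + 9)%N.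
  elim: k => [|k IH]; first by rewrite mul1r.
  rewrite iterS cfD cf_natM cf_qD IH exprS (natrD _ (11 * n + 9)%N); ring.
have [p ep one_eq] := ten_identity.
have := it 10%N; rewrite (iter_pstep 10 gE) -ep (_ : 11 * n + 9 + 2 = 11 * n.+1)%N; last by lia.
rewrite natrM (_ : 11%:R = 0 :> K) ?mul0r ?expr0n ?mul0r; last exact: val_inj.
have -> : ev p = 1 - x ^+ 12 * y ^+ 9 * (x + y) ^+ 9 by rewrite {1}one_eq; ring.
by rewrite mulrBl mul1r cfB => /eqP; rewrite subr_eq0 => /eqP.
Qed.

End Reflection.

Section Frobenius.
Local Open Scope ring_scope.
Local Notation K := 'F_11.
Local Notation q := (qX K).

Lemma eqm_sum_coef (R : comNzRingType) N (f : fps R) :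
  eqm N f (\sum_(i < N) fps_const (cf f i) * qX R ^+ i).
Proof.
move=> n lt; rewrite cf_sum (bigD1 (Ordinal lt)) // cf_constM cf_qXn eqxx mulr1.
rewrite big1 => [|i ne]; first by rewrite /= addr0.
rewrite cf_constM cf_qXn eq_sym.
by rewrite -val_eqE in ne; rewrite (negbTE ne) mulr0.
Qed.

(** In characteristic 11 the eleventh power is additive, and by Fermat it fixes coefficients, so it
    sends [f(q)] to [f(q^11)]. *)
Lemma cf_frobenius (f : fps K) n : cf (f ^+ 11) (11 * n)%N = cf f n.
Proof.
have ch : 11%N \in [pchar (fps K)] by apply/andP; split=> //; apply/eqP; exact: nat11.
pose N := (11 * n).+1.
have -> := @eqmX _ N _ _ 11 (@eqm_sum_coef _ N f) (11 * n)%N (ltnSn _).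
rewrite -[X in cf X _]/(pFrobenius_aut ch _) rmorph_sum cf_sum.
have lt : (n < N)%N by rewrite /N; lia.
have term (i : 'I_N) : cf (pFrobenius_aut ch (fps_const (cf f i) * q ^+ i)) (11 * n)%N =
    cf f i * (n == i)%:R.
  rewrite pFrobenius_autE exprMn -exprM -rmorphXn cf_constM cf_qXn [(i * 11)%N]mulnC eqn_pmul2l //.
  congr (_ * _); rewrite -[in LHS](natr_Zp (cf f i)).
  have p11 : prime 11 by [].
  by rewrite -natrX -(Fp_nat_mod p11) fermat_little // Fp_nat_mod // natr_Zp.
under eq_bigr => i _ do rewrite term.
rewrite (bigD1 (Ordinal lt)) //= eqxx mulr1 big1 ?addr0 // => i.
by rewrite -val_eqE /= eq_sym => /negbTE ->; rewrite mulr0.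
Qed.

End Frobenius.

Section Mod11.
Local Open Scope ring_scope.
Local Notation K := 'F_11.
Local Notation q := (qX K).
Local Notation E := (euler K).

(* To be applied to [a = psi(q^2)], [b = phi(q)], [c = phi(-q)], [e = euler 1]  *)
(* and [d = euler 2]; the last three hypotheses on a, b, c and e are Halphen's   *)
(* system in bilinear form.                                                     *)
Lemma cartier_eta (a b c e d g : fps K) n :
  cf a 0 = 1 -> cf b 0 = 1 -> cf c 0 = 1 -> cf e 0 = 1 -> cf g 0 = 1 ->
  e ^+ 6 = a * b * c ^+ 4 -> d ^+ 3 = a * b * c -> c * d = e ^+ 2 ->
  b ^+ 4 = c ^+ 4 + 16%:R * q * a ^+ 4 ->
  a * b * c ^+ 4 = qD4 1 a * b - a * qD4 0 b ->
  a * c * (c ^+ 4 + 16%:R * q * a ^+ 4) = qD4 1 a * c - a * qD4 0 c ->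
  (8%:R * qD (e ^+ 3) + e ^+ 3) ^+ 2 =
    qD4 1 (qD4 1 (qD4 1 a)) * b - 3%:R * (qD4 1 (qD4 1 a) * qD4 0 b)
    + 3%:R * (qD4 1 a * qD4 0 (qD4 0 b)) - a * qD4 0 (qD4 0 (qD4 0 b)) ->
  g * e ^+ 2 = d ^+ 3 ->
  cf g (11 * n + 9)%N = 16%:R ^+ 9 * cf (c * d ^+ 10) n.
Proof.
move=> a0 b0 c0 e0 g0 e6 d3 cd b4 br brN br3 ge.
set x := c ^+ 4 in e6 b4 br brN *; set y := 16%:R * q * a ^+ 4 in b4 brN *.
set W := logder c.
have Dx : qD x = x * W := qD_x c0.
have Dy : qD y = y * (W + x + y) := qD_y a0 c0 brN.
have DW : qD W = 6%:R * W ^+ 2 + 5%:R * x * y + 5%:R * y ^+ 2 :=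
  qD_W a0 b0 c0 e0 e6 br brN br3.
have x0 : cf x 0 = 1 by exact: cf0X1.
have xy0 : cf (x + y) 0 = 1 by rewrite -b4; exact: cf0X1.
have yreg f1 f2 : y * f1 = y * f2 -> f1 = f2.
  have -> : y = fps_const 16%:R * (q ^+ 1 * a ^+ 4) by rewrite (rmorph_nat (@fps_const K)) /y; ring.
  move=> /(congr1 (fun z => fps_const (9%:R : K) * z)).
  rewrite !(mulrA (fps_const 9%:R)) -rmorphM (_ : 9%:R * 16%:R = 1 :> K); last exact: val_inj.
  by rewrite rmorph1 !mul1r -!mulrA => /qXn_reg; do 4!move/(mulfps_inj a0).
have gE : qD g + 2%:R * g = (3%:R * W + 2%:R * x + 4%:R * y) * g.
  have Wc : qD4 0 c = W * c by rewrite logderE.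
  have Wa : qD4 1 a = (W + x + y) * a.
    apply: (mulfps_inj c0); transitivity (a * c * (x + y) + a * qD4 0 c); first by rewrite brN; ring.
    by rewrite Wc; ring.
  have Wb : qD4 0 b = (W + y) * b.
    apply: (mulfps_inj a0); transitivity (qD4 1 a * b - a * b * x); first by rewrite br; ring.
    by rewrite Wa; ring.
  (* Only the cube of [g], times [x], is a monomial in the theta functions. Its logarithmic
     derivative gives [12 D g], and 12 is 1 modulo 11. *)
  have g3 : g ^+ 3 * x = a ^+ 2 * b ^+ 2 * c ^+ 3.
    apply: (mulfps_inj (cf0M1 a0 b0)); transitivity (g ^+ 3 * e ^+ 6); first by rewrite e6; ring.
    transitivity ((g * e ^+ 2) ^+ 3); first by ring.
    by rewrite ge d3; ring.
  have D3 : 4%:R * qD (g ^+ 3 * x) = (7%:R * W + 2%:R * x + 4%:R * y - 2%:R) * (g ^+ 3 * x).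
    rewrite g3 !qDM; transitivity (2%:R * a * (qD4 1 a - a) * b ^+ 2 * c ^+ 3 +
      2%:R * a ^+ 2 * b * qD4 0 b * c ^+ 3 + 3%:R * a ^+ 2 * b ^+ 2 * c ^+ 2 * qD4 0 c).
      by rewrite /qD4; ring.
    by rewrite Wa Wb Wc; ring.
  have D12 : 12%:R * qD g = (3%:R * W + 2%:R * x + 4%:R * y - 2%:R) * g.
    apply: (mulfps_inj (cf0M1 (cf0X1 2 g0) x0)).
    transitivity (4%:R * qD (g ^+ 3 * x) - 4%:R * g ^+ 3 * qD x).
      by rewrite (qDM _ x) qDX /=; ring.
    by rewrite D3 Dx; ring.
  transitivity (12%:R * qD g + 2%:R * g); first by apply: (@mod11 _ _ (- qD g)); ring.
  by rewrite D12; ring.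
rewrite (cartier DW Dx Dy x0 xy0 yreg n gE).
(* Expressed by [e] and [d], the left side is [16^9 q^9 e^22 d^99]. Apart from [16^9 q^9] this is an
   eleventh power, so its projection is read off by Frobenius. *)
have -> : x ^+ 12 * y ^+ 9 * (x + y) ^+ 9 * g =
   fps_const (16%:R ^+ 9) * (q ^+ 9 * (c * d ^+ 10) ^+ 11).
  rewrite rmorphXn (rmorph_nat (@fps_const K)) -b4.
  transitivity (16%:R ^+ 9 * (q ^+ 9 * ((a * b * x) ^+ 4 * (a * b * c) ^+ 32 * g))).
    by rewrite /y /x; ring.
  congr (_ * (_ * _)); rewrite -e6 -d3.
  transitivity (e ^+ 22 * (g * e ^+ 2) * (d ^+ 3) ^+ 32); first by ring.
  by rewrite ge; transitivity ((e ^+ 2 * d ^+ 9) ^+ 11); [ring | rewrite -cd; ring].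
rewrite cf_constM cf_qXnM ifF; last by lia.
by rewrite addnK cf_frobenius.
Qed.

End Mod11.

(** * The theta functions satisfy the hypotheses of the projection *)

Section EtaQuotients.
Local Open Scope ring_scope.
Local Notation K := 'F_11.
Local Notation q := (qX K).
Local Notation E := (euler K).
Implicit Types a b c e f g : fps K.

Lemma quot_sixth a b c e1 e2 e4 : [/\ cf e1 0 = 1, cf e2 0 = 1 & cf e4 0 = 1] ->
  a * e2 = e4 ^+ 2 -> b * (e1 ^+ 2 * e4 ^+ 2) = e2 ^+ 5 -> c * e2 = e1 ^+ 2 ->
  e1 ^+ 6 = a * b * c ^+ 4.
Proof.
move=> [u1 u2 u4] ea eb ec.
have u : cf (e2 ^+ 5 * (e1 ^+ 2 * e4 ^+ 2)) 0 = 1 by do ?[apply: cf0M1 | apply: cf0X1].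
apply: (mulfps_inj u).
transitivity ((a * e2) * (b * (e1 ^+ 2 * e4 ^+ 2)) * (c * e2) ^+ 4); last by ring.
by rewrite ea eb ec; ring.
Qed.

Lemma quot_cube a b c e1 e2 e4 : [/\ cf e1 0 = 1, cf e2 0 = 1 & cf e4 0 = 1] ->
  a * e2 = e4 ^+ 2 -> b * (e1 ^+ 2 * e4 ^+ 2) = e2 ^+ 5 -> c * e2 = e1 ^+ 2 ->
  e2 ^+ 3 = a * b * c.
Proof.
move=> [u1 u2 u4] ea eb ec.
have u : cf (e2 ^+ 2 * (e1 ^+ 2 * e4 ^+ 2)) 0 = 1 by do ?[apply: cf0M1 | apply: cf0X1].
apply: (mulfps_inj u).
transitivity ((a * e2) * (b * (e1 ^+ 2 * e4 ^+ 2)) * (c * e2)); last by ring.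
by rewrite ea eb ec; ring.
Qed.

Lemma quot_square a b c e2 e4 e8 : [/\ cf e2 0 = 1, cf e4 0 = 1 & cf e8 0 = 1] ->
  a * e2 = e4 ^+ 2 -> b * (e2 ^+ 2 * e8 ^+ 2) = e4 ^+ 5 -> c * e4 = e8 ^+ 2 ->
  a ^+ 2 = b * c.
Proof.
move=> [u2 u4 u8] ea eb ec.
have u : cf (e4 * (e2 ^+ 2 * e8 ^+ 2)) 0 = 1 by do ?[apply: cf0M1 | apply: cf0X1].
apply: (mulfps_inj u).
transitivity ((a * e2) ^+ 2 * e8 ^+ 2 * e4); first by ring.
transitivity ((b * (e2 ^+ 2 * e8 ^+ 2)) * (c * e4)); last by ring.
by rewrite ea eb ec; ring.
Qed.

(** Jacobi's quartic identity, as a difference of two squares; [p2] and [p4] stand for [phi(q^2)]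
    and [psi(q^4)]. *)
Lemma quartic_of_squares x a b c p2 p4 :
  b ^+ 2 = p2 ^+ 2 + 4%:R * x * p4 ^+ 2 -> c ^+ 2 = p2 ^+ 2 - 4%:R * x * p4 ^+ 2 ->
  a ^+ 2 = p2 * p4 -> b ^+ 4 = c ^+ 4 + 16%:R * x * a ^+ 4.
Proof.
move=> eb ec ea; transitivity ((b ^+ 2) ^+ 2); first by ring.
transitivity ((c ^+ 2) ^+ 2 + 16%:R * x * (a ^+ 2) ^+ 2); last by ring.
by rewrite eb ec ea; ring.
Qed.

Let qnegB f g : qneg (f - g) = qneg f - qneg g. Proof. exact: rmorphB. Qed.
Let qnegD f g : qneg (f + g) = qneg f + qneg g. Proof. exact: rmorphD. Qed.
Let qnegM f g : qneg (f * g) = qneg f * qneg g. Proof. exact: rmorphM. Qed.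
Let qnegX f n : qneg (f ^+ n) = qneg f ^+ n. Proof. exact: rmorphXn. Qed.
Let qneg_nat n : qneg n%:R = n%:R :> fps K. Proof. exact: rmorph_nat. Qed.

Lemma qneg_qD4 m (f : fps K) : qneg (qD4 m f) = qD4 m (qneg f).
Proof. by rewrite /qD4 qnegD !qnegM !qneg_nat qD_qneg. Qed.

(** Changing [q] to [-q] fixes [psi(q^2)] and exchanges [phi(q)] with [phi(-q)], so the second
    bracket comes from the first. *)
Lemma qneg_bracket a b c : qneg a = a -> qneg b = c -> qneg c = b ->
  a * b * c ^+ 4 = qD4 1 a * b - a * qD4 0 b -> a * c * b ^+ 4 = qD4 1 a * c - a * qD4 0 c.
Proof.
move=> na nb nc /(congr1 (@qneg K)); rewrite qnegB (qnegM (a * b)) qnegX !qnegM !qneg_qD4.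
by rewrite na nb nc.
Qed.

Lemma qneg_square x b c p2 p4 : qneg x = - x -> qneg b = c -> qneg p2 = p2 -> qneg p4 = p4 ->
  b ^+ 2 = p2 ^+ 2 + 4%:R * x * p4 ^+ 2 -> c ^+ 2 = p2 ^+ 2 - 4%:R * x * p4 ^+ 2.
Proof.
move=> nx nb n2 n4 /(congr1 (@qneg K)); rewrite qnegD (qnegM (4%:R * x)) !qnegX qnegM qneg_nat.
by rewrite nx nb n2 n4 mulrN mulNr.
Qed.

Lemma cf_eta_quotient g n : g * E 1 ^+ 2 = E 2 ^+ 3 ->
  cf g (11 * n + 9)%N = 16%:R ^+ 9 * cf (phim K 1 * E 2 ^+ 10) n.
Proof.
move=> gE.
have u1 : cf (E 1) 0 = 1 by apply: cf0_euler.
have u2 : cf (E 2) 0 = 1 by apply: cf0_euler.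
have u4 : cf (E 4) 0 = 1 by apply: cf0_euler.
have u8 : cf (E 8) 0 = 1 by apply: cf0_euler.
have aE : psi K 2 * E 2 = E 4 ^+ 2 := @psiE K 2 isT.
have bE : phi K 1 * (E 1 ^+ 2 * E 4 ^+ 2) = E 2 ^+ 5 := @phiE K 1 isT.
have cE : phim K 1 * E 2 = E 1 ^+ 2 := @phimE K 1 isT.
have p4E : psi K 4 * E 4 = E 8 ^+ 2 := @psiE K 4 isT.
have p2E : phi K 2 * (E 2 ^+ 2 * E 8 ^+ 2) = E 4 ^+ 5 := @phiE K 2 isT.
have nb : qneg (phi K 1) = phim K 1 by apply: qneg_phi.
have nc : qneg (phim K 1) = phi K 1 by rewrite -nb; apply: qnegK.
have na : qneg (psi K 2) = psi K 2 by apply: qneg_psi_even.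
have b2 : phi K 1 ^+ 2 = phi K 2 ^+ 2 + 4%:R * q ^+ 1 * psi K 4 ^+ 2 := @phi_sqr 1 isT.
have nq : qneg (q ^+ 1) = - q ^+ 1 by rewrite expr1; apply: qneg_qX.
have np2 : qneg (phi K 2) = phi K 2 by apply: qneg_phi_even.
have np4 : qneg (psi K 4) = psi K 4 by apply: qneg_psi_even.
have c2 := qneg_square nq nb np2 np4 b2.
have a2 := quot_square (And3 u2 u4 u8) aE p2E p4E.
have b4 := quartic_of_squares b2 c2 a2.
have br : 1%:R * E 1 ^+ 6 = qD4 1 (psi K 2) * phi K 1 - psi K 2 * qD4 0 (phi K 1) :=
  @euler_bracket 1 isT.
have br3 : 1%:R * (8%:R * qD (E 1 ^+ 3) + 1%:R * E 1 ^+ 3) ^+ 2 =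
  qD4 1 (qD4 1 (qD4 1 (psi K 2))) * phi K 1 - 3%:R * (qD4 1 (qD4 1 (psi K 2)) * qD4 0 (phi K 1))
  + 3%:R * (qD4 1 (psi K 2) * qD4 0 (qD4 0 (phi K 1)))
  - psi K 2 * qD4 0 (qD4 0 (qD4 0 (phi K 1))) := @euler_bracket3 1 isT.
have e6 := quot_sixth (And3 u1 u2 u4) aE bE cE.
have d3 := quot_cube (And3 u1 u2 u4) aE bE cE.
move: aE bE cE u1 u2 u4 na nb nc {p4E p2E nq np2 np4 c2 a2 b2 u8} b4 br br3 e6 d3 gE.
move: (psi K 2) (phi K 1) (phim K 1) (E 1) (E 2) (E 4) => a b c e d f.
move=> aE bE cE u1 u2 u4 na nb nc b4; rewrite !mul1r expr1 in b4 * => br br3 e6 d3 gE.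
have a0 : cf a 0 = 1 by apply: (cf0_quot aE u2); apply: cf0X1.
have b0 : cf b 0 = 1.
  by apply: (cf0_quot bE); [apply: cf0M1|]; apply: cf0X1.
have c0 : cf c 0 = 1 by apply: (cf0_quot cE u2); apply: cf0X1.
have g0 : cf g 0 = 1 by apply: (cf0_quot gE); apply: cf0X1.
rewrite e6 in br; have brN := qneg_bracket na nb nc br; rewrite b4 in brN.
exact: (cartier_eta n a0 b0 c0 u1 g0 e6 d3 cE b4 br brN br3 gE).
Qed.

End EtaQuotients.

(** * The even part of the shell series *)

Section InfiniteSums.
Local Open Scope ring_scope.
Variable R : comNzRingType.
Implicit Types (u v : nat -> fps R) (f : fps R).
Local Notation q := (qX R).

Definition tends0 u := forall i, eqm i (u i) 0.

Definition sumf u : fps R := Fps (fun n => cf (\sum_(i < n.+1) u i) n).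

Lemma eqm_sumf u N M : tends0 u -> (N <= M)%N -> eqm N (sumf u) (\sum_(i < M) u i).
Proof.
move=> u0 leNM n ltnN; rewrite [LHS]/=.
have [k ->] : exists k, M = (n.+1 + k)%N by exists (M - n.+1)%N; lia.
elim: k => [|k IH]; first by rewrite addn0.
by rewrite addnS [in RHS]big_ord_recr IH cfD (u0 (n.+1 + k)%N) ?addr0 //; lia.
Qed.

Lemma tends0D u v : tends0 u -> tends0 v -> tends0 (fun i => u i + v i).
Proof. by move=> u0 v0 i; rewrite -[0]addr0; apply: eqmD. Qed.

Lemma tends0M f u : tends0 u -> tends0 (fun i => f * u i).
Proof. by move=> u0 i; rewrite -(mulr0 f); apply: eqmM. Qed.

Lemma tends0_qXn (e : nat -> nat) (g : nat -> fps R) :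
  (forall i, (i <= e i)%N) -> tends0 (fun i => q ^+ e i * g i).
Proof. by move=> ei i n ltni; rewrite cf_qXnM ifT //; apply: leq_trans ltni _. Qed.

Lemma eq_sumf u v : u =1 v -> sumf u = sumf v.
Proof. by move=> /funext ->. Qed.

Lemma sumfD u v : sumf (fun i => u i + v i) = sumf u + sumf v.
Proof. by apply: fpsP => n; rewrite cfD [LHS]/= big_split. Qed.

Lemma sumfM f u : tends0 u -> f * sumf u = sumf (fun i => f * u i).
Proof.
move=> u0; apply: eqm_all => N; apply: eqm_trans (eqmM (@eqm_refl _ N f) (eqm_sumf u0 (leqnn N))) _.
by rewrite mulr_sumr; apply: eqm_sym; apply: eqm_sumf => //; apply: tends0M.
Qed.

Lemma sumfS u : tends0 u -> sumf u = u 0%N + sumf (fun i => u i.+1).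
Proof.
move=> u0; have uS : tends0 (fun i => u i.+1) by move=> i; apply: eqm_le (u0 i.+1).
apply: eqm_all => N; apply: eqm_trans (eqm_sumf u0 (leqnSn N)) _.
by rewrite big_ord_recl; apply: eqmD => //; apply: eqm_sym; apply: eqm_sumf.
Qed.

Lemma eqm_sumf0 u N : (forall i, eqm N (u i) 0) -> eqm N (sumf u) 0.
Proof.
by move=> u0 n ltn; rewrite /= cf_sum big1 // => i _; rewrite u0.
Qed.

Lemma qneg_sumf u : qneg (sumf u) = sumf (fun i => qneg (u i)).
Proof.
apply: fpsP => n; rewrite cf_qneg /= !cf_sum mulr_sumr.
by apply: eq_bigr => i _; rewrite cf_qneg.
Qed.

End InfiniteSums.

Section ShellSeries.
Local Open Scope ring_scope.
Variable R : comNzRingType.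
Local Notation q := (qX R).
Local Notation sumf := (@sumf R).

(** [shell 0] is the series [H(q)]. The index [i] stands for a variable [z = q^(2i+1)] raised to the
    power [k], which the functional equation [shellE] multiplies by [q^2]. *)
Definition shell i := sumf (fun k => q ^+ (i.*2.+1 * k) * \prod_(t < k) (1 + q ^+ t.*2.+1)).

(* Iterated from [i = 0], it expands [shell 0] as the sum over [j >= 0] of     *)
(* [q^(j^2+j) / (q; q^2)_(j+1)], whose terms with [j < 0] sum to [qneg (shell 0)]. *)
Lemma shellE i : (1 - q ^+ i.*2.+1) * shell i = 1 + q ^+ i.*2.+2 * shell i.+1.
Proof.
pose pr k : fps R := \prod_(t < k) (1 + q ^+ t.*2.+1).
have t0 j : tends0 (fun k => q ^+ (j.*2.+1 * k) * pr k) by apply: tends0_qXn => k; nia.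
have h : shell i = 1 + (q ^+ i.*2.+1 * shell i + q ^+ i.*2.+2 * shell i.+1).
  rewrite [LHS]/shell (sumfS (t0 i)) muln0 [pr 0%N]big_ord0 mulr1 expr0; congr (1 + _).
  rewrite /shell !sumfM // -sumfD; apply: eq_sumf => k; rewrite -/(pr k) /pr big_ord_recr /= -/(pr k).
  have -> : q ^+ (i.*2.+1 * k.+1) = q ^+ i.*2.+1 * q ^+ (i.*2.+1 * k) by rewrite -exprD -mulnS.
  have -> : q ^+ (i.+1.*2.+1 * k) = q ^+ (i.*2.+1 * k) * q ^+ k.*2.
    by rewrite -exprD; congr (_ ^+ _); lia.
  by rewrite !exprS; ring.
by rewrite mulrBl mul1r {1}h; ring.
Qed.

(* [1 / (q^2; q^2)_k] *)
Definition iqf k : fps R := fps_inv (qfact (q ^+ 2) k).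

Lemma cf0_qfact k : cf (qfact (q ^+ 2) k) 0 = 1.
Proof. by have := @eqm_qfact R 2 k isT 0%N isT; rewrite cf0_euler. Qed.

Lemma iqfS k : (1 - q ^+ k.*2.+2) * iqf k.+1 = iqf k.
Proof.
apply: (mulfps_inj (cf0_qfact k)); rewrite /iqf (mulfps_inv (cf0_qfact k)) mulrA.
rewrite -[RHS](mulfps_inv (cf0_qfact k.+1)); congr (_ * _).
by rewrite /qfact big_ord_recr -exprM mul2n.
Qed.

Lemma iqf0 : iqf 0 = 1.
Proof. by have := mulfps_inv (cf0_qfact 0); rewrite /iqf {1}/qfact big_ord0 mul1r. Qed.

Lemma pronic_ge0 (m : int) : 0 <= m * (m + 1).
Proof.
have h : 0 <= m \/ m <= -1 by lia.
by case: h => h; nia.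
Qed.

Definition sexp (j : int) (k : nat) := absz ((j + Posz k) * (j + Posz k + 1) + Posz k).

Lemma sexpE (j : int) (k : nat) :
  Posz (sexp j k) = (j + Posz k) * (j + Posz k + 1) + Posz k.
Proof. by rewrite /sexp gez0_abs // addr_ge0 // pronic_ge0. Qed.

Lemma sexp_ge j k : (k <= sexp j k)%N.
Proof. by have := sexpE j k; have := pronic_ge0 (j + Posz k); lia. Qed.

Definition sterm j k : fps R := q ^+ sexp j k * ((-1) ^+ k * iqf k).
(* For [j >= 0] this is [q^(j^2+j) (q^(2j+3); q^2)_oo] by Euler's expansion; the  *)
(* series also makes sense for [j < 0], where the infinite product does not.    *)
Definition bilat j := sumf (sterm j).

Lemma tends0_sterm j : tends0 (sterm j).
Proof. exact: tends0_qXn (sexp_ge j). Qed.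

Lemma sexp_rec (a b k : nat) (j : int) : j = Posz a - Posz b ->
  (b.*2 + sexp j k = a.*2 + sexp (j - 1) k + k.*2)%N.
Proof.
move=> je; have := sexpE j k; have := sexpE (j - 1) k.
have -> : (j - 1 + Posz k) * (j - 1 + Posz k + 1) =
    (j + Posz k) * (j + Posz k + 1) - 2 * (j + Posz k) by ring.
by move: (_ * (_ + 1)); rewrite je => m; lia.
Qed.

Lemma sexpS (j : int) k : sexp (j - 1) k.+1 = (sexp j k).+1.
Proof.
have := sexpE j k; have := sexpE (j - 1) k.+1.
by rewrite (_ : j - 1 + Posz k.+1 = j + Posz k); lia.
Qed.

(** This is [(1 - q^(2j+1)) B_j = q^(2j) B_(j-1)]; writing [j = a - b] with natural numbers clears
    the negative powers and covers both signs of [j]. *)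
Lemma bilat_rec (a b : nat) (j : int) : j = Posz a - Posz b ->
  (q ^+ b.*2 - q ^+ a.*2.+1) * bilat j = q ^+ a.*2 * bilat (j - 1).
Proof.
move=> je; have t0 := tends0_sterm.
suff h : q ^+ b.*2 * bilat j - q ^+ a.*2 * bilat (j - 1) = q ^+ a.*2.+1 * bilat j.
  by rewrite mulrBl -h; ring.
rewrite -mulNr !sumfM // -sumfD sumfS; last first.
  by apply: tends0D; apply: tends0M; apply: t0.
have e0 := sexp_rec 0 je.
have -> : q ^+ b.*2 * sterm j 0 + - q ^+ a.*2 * sterm (j - 1) 0 = 0.
  by rewrite mulNr /sterm !mulrA -!exprD e0 addn0 subrr.
rewrite add0r; apply: eq_sumf => k; rewrite mulNr /sterm !mulrA -!exprD.
rewrite (sexp_rec k.+1 je) sexpS -(iqfS k).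
by rewrite !exprD doubleS !exprS; ring.
Qed.

(** By [bilat_rec] and then [shellE], the remainder [q^(2m) shell m B_(m-1)] equals [B_m] plus the
    next remainder. *)
Lemma shell_bilat m : shell 0 * bilat (-1) =
  \sum_(j < m) bilat (Posz j) + q ^+ m.*2 * shell m * bilat (Posz m - 1).
Proof.
elim: m => [|m ->]; first by rewrite big_ord0 add0r mul1r sub0r.
rewrite big_ord_recr -addrA; congr (_ + _).
have h : (1 - q ^+ m.*2.+1) * bilat (Posz m) = q ^+ m.*2 * bilat (Posz m - 1).
  by rewrite -(@bilat_rec m 0) ?subr0.
rewrite mulrAC -h mulrAC shellE (_ : Posz m.+1 - 1 = Posz m); last by lia.
by rewrite doubleS [LHS]mulrDl mul1r.
Qed.

(** Up to the factor [bilat (-1)] these are the terms of [qneg (shell 0)], which thereby becomes the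
    negative half of the bilateral sum. *)
Lemma bilat_neg n : bilat (Negz n) =
  (-1) ^+ n * q ^+ n * \prod_(t < n) (1 - q ^+ t.*2.+1) * bilat (-1).
Proof.
elim: n => [|n IH]; first by rewrite big_ord0 !mul1r.
have := @bilat_rec 0 n.+1 (- Posz n.+1); rewrite sub0r => /(_ erefl).
rewrite (_ : - Posz n.+1 - 1 = Negz n.+1) ?NegzE; last by lia.
rewrite (_ : - Posz n.+2 = Negz n.+1) // (_ : - Posz n.+1 = Negz n) //.
rewrite mul1r IH => <-; rewrite big_ord_recr /= doubleS.
move: (bilat _) (\prod_(_ < _) _) => x y; rewrite expr1 -mulrA !exprS -mulrA.
by ring.
Qed.

(** [U m] is [bilat m] without its leading power of [q]. The product in [UP] does not depend on [m],
    while [U m] tends to 1. *)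
Lemma bilat_euler : bilat (-1) = odd_euler R 1.
Proof.
pose U m := sumf (fun k => q ^+ (k * k + k.*2 + (m * k).*2) * ((-1) ^+ k * iqf k)).
have t0 m : tends0 (fun k => q ^+ (k * k + k.*2 + (m * k).*2) * ((-1) ^+ k * iqf k)).
  by apply: tends0_qXn => k; lia.
have bU m : bilat (Posz m) = q ^+ (m * m + m) * U m.
  rewrite sumfM //; apply: eq_sumf => k; rewrite /sterm mulrA -exprD.
  by congr (q ^+ _ * _); apply/eqP; rewrite -eqz_nat sexpE; apply/eqP; lia.
have UP m : U m * \prod_(i < m.+1) (1 - q ^+ i.*2.+1) = bilat (-1).
  apply: (@qXn_reg _ (m * m + m)); rewrite mulrA -bU.
  elim: m => [|m IH].
    rewrite big_ord_recr big_ord0 mulrC /= mul1r.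
    by have := @bilat_rec 0 0 0 erefl; rewrite sub0r.
  rewrite big_ord_recr /=.
  have h : (1 - q ^+ m.+1.*2.+1) * bilat (Posz m.+1) = q ^+ m.+1.*2 * bilat (Posz m).
    by rewrite -(_ : Posz m.+1 - 1 = Posz m) -?(@bilat_rec m.+1 0) ?subr0 //; lia.
  transitivity (q ^+ m.+1.*2 * (bilat (Posz m) * \prod_(i < m.+1) (1 - q ^+ i.*2.+1))).
    by rewrite [RHS]mulrA -h; ring.
  by rewrite IH mulrA -exprD; congr (q ^+ _ * _); lia.
apply: eqm_all => N; rewrite -(UP N).
have e1 : eqm N (U N) 1.
  rewrite /U (sumfS (t0 N)) -[X in eqm _ _ X]addr0; apply: eqmD.
    by rewrite !muln0 !expr0 iqf0 !mul1r.
  by apply: eqm_sumf0 => k; apply: eqm_qXn; lia.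
rewrite odd_eulerE -[X in eqm _ _ X]mul1r; apply: eqmM => //.
apply: eqm_sym; apply: eqm_trans (eqm_pinf (tends1_odd _ _) (leqnSn N)) _ => //.
by apply: eqm_prod => i _; rewrite mul1n mulN1r.
Qed.

(* [1 / (-q^(2i+1); q^2)_oo], by Euler's expansion *)
Definition diag i := sumf (fun k => q ^+ (i.*2.+1 * k) * ((-1) ^+ k * iqf k)).

Lemma diag_euler : diag 0 * odd_euler_plus R 1 = 1.
Proof.
have t0 i : tends0 (fun k => q ^+ (i.*2.+1 * k) * ((-1) ^+ k * iqf k)).
  by apply: tends0_qXn => k; nia.
have rec i : diag i.+1 = (1 + q ^+ i.*2.+1) * diag i.
  suff h : diag i - diag i.+1 = - q ^+ i.*2.+1 * diag i.
    by rewrite mulrDl mul1r -[RHS]subr0 -(subrr (diag i - diag i.+1)) {2}h; ring.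
  rewrite -[X in _ + X]mulN1r /diag !sumfM // -sumfD sumfS; last first.
    by apply: tends0D (t0 i) _; apply: tends0M; apply: t0.
  rewrite !muln0 mulN1r subrr add0r; apply: eq_sumf => k; rewrite -(iqfS k).
  have -> : q ^+ (i.*2.+1 * k.+1) = q ^+ i.*2.+1 * q ^+ (i.*2.+1 * k) by rewrite -exprD -mulnS.
  have -> : q ^+ (i.+1.*2.+1 * k.+1) = q ^+ i.*2.+1 * q ^+ (i.*2.+1 * k) * q ^+ k.*2.+2.
    by rewrite -!exprD; congr (_ ^+ _); lia.
  by rewrite ![(-1) ^+ k.+1]exprS; ring.
have prodE M : diag 0 * \prod_(i < M) (1 + q ^+ i.*2.+1) = diag M.
  by elim: M => [|M IH]; rewrite ?big_ord0 ?mulr1 // big_ord_recr /= mulrA IH rec mulrC.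
apply: eqm_all => N; rewrite odd_euler_plusE.
apply: eqm_trans (eqmM (@eqm_refl _ N (diag 0)) (eqm_pinf (tends1_odd _ _) (leqnn N))) _ => //.
rewrite (eq_bigr (fun i : 'I_N => 1 + q ^+ (val i).*2.+1)); last by move=> i _; rewrite mul1n mul1r.
rewrite prodE /diag sumfS //.
rewrite -[X in eqm _ _ X]addr0; apply: eqmD.
  by rewrite muln0 !expr0 iqf0 !mul1r.
by apply: eqm_sumf0 => k; apply: eqm_qXn; nia.
Qed.

End ShellSeries.

Section EvenPart.
Local Open Scope ring_scope.
Local Notation K := 'F_11.
Local Notation q := (qX K).
Local Notation E := (euler K).
Local Notation bilat := (bilat K).

Lemma mem_intseq C (j : int) :
  (j \in [seq Posz n | n <- iota 0 C] ++ [seq Negz n | n <- iota 0 C]) = (- Posz C <= j < Posz C).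
Proof.
rewrite mem_cat; apply/orP/idP => [[] /mapP[k]|]; rewrite ?mem_iota; try lia.
case: j => j hj; [left | right]; apply/mapP; exists j; rewrite ?mem_iota //; lia.
Qed.

Lemma intseq_uniq C : uniq ([seq Posz n | n <- iota 0 C] ++ [seq Negz n | n <- iota 0 C]).
Proof.
rewrite cat_uniq !map_inj_uniq ?iota_uniq /=; try by move=> x y [].
by rewrite andbT; apply/hasPn => _ /mapP[k _ ->]; apply/mapP => -[].
Qed.

(** Apart from the summand [k], the exponent [sexp j k] depends only on [j + k]. So after exchanging
    the sums, the sum over [j] is the same theta series for every [k], and [diag 0] factors out. *)
Lemma bilateral_sum N C : (N.*2.+2 <= C)%N ->
  eqm N (\sum_(j < C) bilat (Posz j) + \sum_(n < C) bilat (Negz n)) (psi2 2 * diag K 0).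
Proof.
move=> leNC; set s := [seq Posz n | n <- iota 0 C] ++ [seq Negz n | n <- iota 0 C].
have -> : \sum_(j < C) bilat (Posz j) + \sum_(n < C) bilat (Negz n) = \sum_(j <- s) bilat j.
  have bm (F : nat -> fps K) : \sum_(j <- iota 0 C) F j = \sum_(j < C) F j.
    by rewrite -(big_mkord xpredT) /index_iota subn0.
  by rewrite big_cat !big_map !bm.
apply: (@eqm_trans _ _ (\sum_(j <- s) \sum_(k < N) sterm K j k)).
  by apply: eqm_sum => j _; apply: eqm_sumf (tends0_sterm K j) (leqnn N).
rewrite exchange_big /=; apply: eqm_sym.
have t0 : tends0 (fun k => q ^+ (1 * k) * ((-1) ^+ k * iqf K k)).
  by apply: tends0_qXn => k; rewrite mul1n.
apply: eqm_trans (eqmM (@eqm_refl _ N _) (eqm_sumf t0 (leqnn N))) _.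
rewrite mulr_sumr; apply: eqm_sum => k _.
have -> : \sum_(j <- s) sterm K j k =
   (\sum_(j <- s) fps_const (1 : K) * q ^+ absz ((2 : int) * tri (j + Posz k + 1))%R) *
   (q ^+ (1 * k) * ((-1) ^+ k * iqf K k)).
  rewrite mulr_suml; apply: eq_bigr => j _; rewrite rmorph1 mul1r mulrA -exprD mul1n.
  rewrite /sterm; congr (q ^+ _ * _); apply/eqP; rewrite -eqz_nat sexpE tri2.
  rewrite addrK PoszD gez0_abs; first by apply/eqP; ring.
  by rewrite mulrC pronic_ge0.
apply: eqmM => //.
rewrite -(big_map (fun j => j + Posz k + 1) predT
   (fun l => fps_const (1 : K) * q ^+ absz ((2 : int) * tri l)%R)).
apply: eqm_theta => [|l]; first by rewrite map_inj_uniq ?intseq_uniq // => x y; lia.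
move=> ltl; apply/mapP; exists (l - Posz k - 1); last by ring.
(* From [|l| <= N + 1] and [k < N] one gets [|j| <= 2 N + 1], whence the size required of [C]. *)
rewrite mem_intseq; have ltk := ltn_ord k.
have : (`|l| <= N.+1)%N; last by lia.
by move: ltl; rewrite tri2; nia.
Qed.

Lemma qneg_shell : qneg (shell K 0) =
  sumf (fun k => q ^+ k * ((-1) ^+ k * \prod_(t < k) (1 - q ^+ t.*2.+1))).
Proof.
rewrite qneg_sumf; apply: eq_sumf => k; rewrite mul1n.
have qM (f g : fps K) : qneg (f * g) = qneg f * qneg g by exact: rmorphM.
have qqX n : qneg (q ^+ n) = (-1) ^+ n * q ^+ n.
  transitivity (qneg q ^+ n); first exact: rmorphXn.
  by rewrite qneg_qX [LHS]exprNn.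
rewrite qM qqX -mulrA mulrCA; congr (_ * (_ * _)).
transitivity (\prod_(t < k) qneg (1 + q ^+ t.*2.+1)); first exact: rmorph_prod.
apply: eq_bigr => t _; transitivity (1 + qneg (q ^+ t.*2.+1)).
  have q1 : qneg 1 = 1 :> fps K by exact: rmorph1.
  by rewrite -{2}q1; exact: rmorphD.
by rewrite qqX -signr_odd /= odd_double expr1 mulN1r.
Qed.

Lemma shell_sym : (shell K 0 + qneg (shell K 0)) * bilat (-1) = psi2 2 * diag K 0.
Proof.
apply: eqm_all => N; pose C := N.*2.+2; rewrite mulrDl (shell_bilat K C) addrAC.
rewrite -[X in eqm _ _ X]addr0; apply: eqmD; last first.
  by rewrite -mulrA; apply: eqm_qXn; rewrite /C; lia.
apply: eqm_trans (bilateral_sum (leqnn C)); apply: eqmD => //.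
rewrite qneg_shell; set u := fun k => _; have u0 : tends0 u by apply: tends0_qXn.
apply: (@eqm_trans _ _ ((\sum_(k < C) u k) * bilat (-1))).
  by apply: eqmM => //; apply: eqm_sumf u0 _; rewrite /C; lia.
rewrite mulr_suml => n _; congr (cf _ n); apply: eq_bigr => k _.
by rewrite bilat_neg /u; congr (_ * _); rewrite -mulrA mulrCA.
Qed.

Lemma shell_evenE : (shell K 0 + qneg (shell K 0)) * E 2 = fps_const 2%:R * (psi K 2 * E 4).
Proof.
have e2 : E 2 = odd_euler K 2 * E 4 := @euler_odd K 2 isT.
have oe : odd_euler_plus K 1 * odd_euler K 1 = odd_euler K 2 := @odd_euler_mul K 1 isT.
have de := diag_euler K; have ss := shell_sym; have p2 := @psi2E 2 isT.
move: e2 oe de ss; rewrite bilat_euler p2.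
move: (E 2) (E 4) (odd_euler K 2) (odd_euler K 1) (odd_euler_plus K 1) (psi K 2) (diag K 0).
move: (_ + _) (fps_const _) => h c x y z t u p d -> <- du hd.
transitivity (h * t * u * y); first by ring.
rewrite hd; transitivity ((d * u) * (c * (p * y))); first by ring.
by rewrite du mul1r.
Qed.

End EvenPart.

(** * Substitution of [q^2] for [q] and even coefficients *)

Section Dilation.
Local Open Scope ring_scope.
Variable R : comNzRingType.
Local Notation q := (qX R).
Implicit Types f g : fps R.

Definition qdil f : fps R := Fps (fun n => if odd n then 0 else cf f n./2).

Lemma sum_parity n (F : nat -> R) :
  \sum_(i < n.*2.+1) F i = \sum_(i < n.+1) F i.*2 + \sum_(i < n) F i.*2.+1.
Proof.
elim: n => [|n IH]; first by rewrite !big_ord_recr !big_ord0 addr0.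
rewrite doubleS big_ord_recr big_ord_recr IH /= [in RHS]big_ord_recr /=.
by rewrite [\sum_(i < n.+1) F i.*2.+1]big_ord_recr /=; ring.
Qed.

(** Taking the even part is linear over series in [q^2]; an identity for [H(q) + H(-q)] thus
    descends to the series of even coefficients. *)
Lemma cf_qdil_mul f g n : cf (f * qdil g) n.*2 = \sum_(i < n.+1) cf f i.*2 * cf g (n - i).
Proof.
rewrite cfM (sum_parity n (fun i => cf f i * cf (qdil g) (n.*2 - i))).
rewrite [X in _ + X]big1 ?addr0; last first.
  by move=> i _; rewrite /= ifT ?mulr0 //; have := ltn_ord i; lia.
by apply: eq_bigr => i _; rewrite /= -doubleB odd_double doubleK.
Qed.

Lemma cf_qdil f n : cf (qdil f) n = if odd n then 0 else cf f n./2.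
Proof. by []. Qed.

Lemma qdilM f g : qdil (f * g) = qdil f * qdil g.
Proof.
apply: fpsP => n; rewrite cf_qdil; case: ifP => on; last first.
  rewrite -[n in RHS](odd_double_half n) on add0n cf_qdil_mul cfM.
  by apply: eq_bigr => i _; rewrite cf_qdil odd_double doubleK.
rewrite cfM big1 // => i _; rewrite !cf_qdil; case: ifP => oi; first by rewrite mul0r.
by rewrite ifT ?mulr0 // oddB ?on ?oi // -ltnS.
Qed.

Lemma qdilB f g : qdil (f - g) = qdil f - qdil g.
Proof. by apply: fpsP => n; rewrite cfB !cf_qdil cfB; case: ifP; rewrite ?subr0. Qed.

Lemma qdil_qXn k : qdil (q ^+ k) = q ^+ k.*2.
Proof.
apply: fpsP => n; rewrite cf_qdil !cf_qXn; case: ifP => on.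
  by rewrite (_ : n == k.*2 = false) //; apply/eqP => e; rewrite e odd_double in on.
by rewrite -[n in RHS]odd_double_half on add0n -!muln2 eqn_pmul2r.
Qed.

Lemma qdil_euler s : (0 < s)%N -> qdil (euler R s) = euler R (2 * s).
Proof.
move=> s0; have q1 : qdil 1 = 1 by rewrite -(expr0 q) qdil_qXn.
apply: eqm_all => N n ltn; rewrite cf_qdil.
have e2 : eqm N (euler R (2 * s)) (qdil (\prod_(i < N) (1 - q ^+ (s * i.+1)))).
  rewrite (big_morph qdil qdilM q1).
  apply: eqm_trans (eqm_pinf (tends1_euler R _) (leqnn N)) _; first by rewrite muln_gt0.
  apply: eqm_prod => i _; rewrite qdilB q1 qdil_qXn (_ : (s * i.+1).*2 = 2 * s * i.+1)%N //.
  by rewrite -mul2n mulnA.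
rewrite (e2 n ltn) cf_qdil; case: ifP => // _.
apply: (eqm_pinf (tends1_euler R s0) (leqnn N)).
by apply: leq_ltn_trans ltn; lia.
Qed.

Lemma qdil_theta (I : choiceType) (e : I -> nat) (w : I -> R) : summable e ->
  qdil (theta e w) = theta (fun i => (e i).*2) w.
Proof.
move=> se; apply: fpsP => n; have [s us sP] := summable_seq se n.+1.
rewrite cf_qdil (@cf_theta _ _ _ w n s) //; last by move=> i ei; apply: sP; lia.
case: ifP => on.
  by rewrite big1 // => i /eqP ei; rewrite -ei odd_double in on.
rewrite (@cf_theta _ _ e w n./2 s) //; last by move=> i ei; apply: sP; lia.
by apply: eq_bigl => i; rewrite -[n in RHS]odd_double_half on add0n -!muln2 eqn_pmul2r.
Qed.

Lemma qdil_psi s : (0 < s)%N -> qdil (psi R s) = psi R (2 * s).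
Proof.
move=> s0; rewrite qdil_theta.
  apply: eq_theta => // l; rewrite mulnCA -mul2n; apply/eqP; rewrite -eqz_nat PoszM.
  have := @triple_ge0 s (3 * s) l; rewrite (_ : s + 3 * s = 4 * s)%N; last by lia.
  move=> h; rewrite !gez0_abs //; last first.
    rewrite (_ : _ + _ = 2 * (Posz (4 * s)%N * tri l + Posz s * l)); first exact: mulr_ge0.
    by rewrite !PoszM; ring.
  by rewrite !PoszM; apply/eqP; ring.
have := @summable_triple s (3 * s) s0; rewrite (_ : s + 3 * s = 4 * s)%N; last by lia.
by apply; lia.
Qed.

End Dilation.

Section EvenCoefficients.
Local Open Scope ring_scope.
Local Notation K := 'F_11.
Local Notation E := (euler K).

Definition shell_even : fps K := Fps (fun n => cf (shell K 0) n.*2).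

Lemma shell_even_quotient : shell_even * E 1 ^+ 2 = E 2 ^+ 3.
Proof.
have h := shell_evenE.
have e2 : E 2 = qdil (E 1) by rewrite qdil_euler.
have e4 : E 4 = qdil (E 2) by rewrite qdil_euler.
have p2 : psi K 2 = qdil (psi K 1) by rewrite qdil_psi.
have pE : psi K 1 * E 1 = E 2 ^+ 2 := @psiE K 1 isT.
have key : shell_even * E 1 = psi K 1 * E 2.
  move: h; rewrite e4 p2 {1}e2 -qdilM; move: (psi K 1 * E 2) (E 1) => x y h.
  apply: double_inj; apply: fpsP => n.
  have /(congr1 (fun f => cf f n.*2)) := h.
  rewrite cf_qdil_mul cf_constM cf_qdil odd_double doubleK => e.
  rewrite cfD [RHS]cfD -[X in _ = X]mulr2n -[RHS]mulr_natl -e cfM -big_split.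
  apply: eq_bigr => i _; rewrite cfD cf_qneg -signr_odd odd_double mul1r.
  by rewrite mulrDl.
move: key pE; move: shell_even (psi K 1) (E 1) (E 2) => f p x y key pE.
transitivity (f * x * x); first by ring.
rewrite key; transitivity (p * x * y); first by ring.
by rewrite pE; ring.
Qed.

End EvenCoefficients.

(** * Totally symmetric plane partitions with one shell *)

Section SymmetricDiagrams.

(** The transposed [y] in the conclusion makes one condition express both symmetry ([y = x]) and
    closure downwards. *)
Definition symdown k (D : {set 'I_k * 'I_k}) :=
  [forall x, forall y, (x \in D) ==> ((y.2, y.1) \in D) || ~~ ((y.1 <= x.1) && (y.2 <= x.2))].

Lemma symdownP k (D : {set 'I_k * 'I_k}) :
  reflect ((forall i j, (i, j) \in D -> (j, i) \in D) /\
           (forall i j i' j' : 'I_k, (i, j) \in D -> i' <= i -> j' <= j -> (i', j') \in D))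
    (symdown D).
Proof.
apply: (iffP idP) => [/forallP h|[sy dn]].
  have d (i j i' j' : 'I_k) : (i, j) \in D -> i' <= i -> j' <= j -> (j', i') \in D.
    move=> ijD lei lej; have /forallP/(_ (i', j'))/implyP/(_ ijD) /= := h (i, j).
    by rewrite lei lej orbF.
  have s i j : (i, j) \in D -> (j, i) \in D by move=> ijD; apply: d ijD _ _.
  by split=> // i j i' j' ijD lei lej; apply/s/(d _ _ _ _ ijD).
apply/forallP => -[i j]; apply/forallP => -[i' j']; apply/implyP => ijD /=.
by case: andP => [[lei lej]|_]; rewrite ?orbT // (sy _ _ (dn _ _ _ _ ijD lei lej)).
Qed.

Variable k : nat.
Implicit Types (D : {set 'I_k * 'I_k}) (h : 'I_k.+1).

Definition lift2 h (x : 'I_k * 'I_k) : 'I_k.+1 * 'I_k.+1 := (lift h x.1, lift h x.2).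

Lemma lift2_inj h : injective (lift2 h).
Proof.
move=> [i j] [i' j'] e; congr pair.
  by move/(congr1 fst): e; apply: lift_inj.
by move/(congr1 snd): e; apply: lift_inj.
Qed.

Lemma lift2K h D : lift2 h @^-1: (lift2 h @: D) = D.
Proof. by apply/setP => x; rewrite inE mem_imset //; exact: lift2_inj. Qed.

Lemma lift2_out h (A : {set 'I_k.+1 * 'I_k.+1}) :
  A = lift2 h @: (lift2 h @^-1: A) :|: [set x in A | (x.1 == h) || (x.2 == h)].
Proof.
apply/setP => -[i j]; rewrite !inE /=; have [ijA|ijA] := boolP ((i, j) \in A); last first.
  by rewrite orbF; apply/esym/negP => /imsetP[x]; rewrite inE => xA e; rewrite e xA in ijA.
case: (unliftP h i) ijA => [i'|] ->; last by rewrite eqxx orbT.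
case: (unliftP h j) => [j'|] -> ijA; last by rewrite eqxx !orbT.
by apply/esym/orP; left; apply/imsetP; exists (i', j'); rewrite ?inE.
Qed.

Lemma symdown_preim h A : symdown A -> symdown (lift2 h @^-1: A).
Proof.
move=> /symdownP[sy dn]; apply/symdownP; split=> [i j|i j i' j']; rewrite !inE; first exact: sy.
by move=> ijA lei lej; apply: dn ijA _ _; rewrite /= leq_bump2.
Qed.

Lemma symdown_widen D : symdown (lift2 ord_max @: D) = symdown D.
Proof.
apply/idP/idP => [/(@symdown_preim ord_max)|/symdownP[sy dn]]; first by rewrite lift2K.
apply/symdownP; split=> [i j /imsetP[[a b] abD [-> ->]]|i j i' j' /imsetP[[a b] abD [-> ->]]].
  by apply/imsetP; exists (b, a) => //; apply: sy.
rewrite !lift_max => lei lej.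
case: (unliftP ord_max i') lei => [i1 ->|->]; last by rewrite leqNgt ltn_ord.
case: (unliftP ord_max j') lej => [j1 ->|->]; last by rewrite [_ <= b]leqNgt ltn_ord.
rewrite !lift_max => lej lei; apply/imsetP; exists (i1, j1) => //.
exact: dn abD lei lej.
Qed.

Definition hook : {set 'I_k.+1 * 'I_k.+1} := [set x | (x.1 == ord0) || (x.2 == ord0)].

Lemma lift2_range h x : (x \in lift2 h @: [set: 'I_k * 'I_k]) = (x.1 != h) && (x.2 != h).
Proof.
apply/imsetP/andP => [[[a b] _ ->]|[]]; first by rewrite ![lift _ _ == _]eq_sym !neq_lift.
case: x => i j /=; case: (unliftP h i) => [i' ->|->]; last by rewrite eqxx.
by case: (unliftP h j) => [j' ->|->] _; rewrite ?eqxx // => _; exists (i', j'); rewrite ?finset.in_setT.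
Qed.

Lemma hookE : hook = ~: (lift2 ord0 @: [set: 'I_k * 'I_k]).
Proof. by apply/setP => x; rewrite finset.in_setC lift2_range inE negb_and !negbK. Qed.

Lemma card_hook : #|hook| = k.*2.+1.
Proof.
have := cardsC (lift2 ord0 @: [set: 'I_k * 'I_k]); rewrite -hookE card_imset; last exact: lift2_inj.
by rewrite cardsT !card_prod !card_ord => h; apply/eqP; rewrite -(eqn_add2l (k * k)) h; lia.
Qed.

Lemma hook_disjoint D : [disjoint hook & lift2 ord0 @: D].
Proof.
rewrite hookE disjoint_sym finset.disjoints_subset finset.setCK; exact/imsetS/finset.subsetT.
Qed.

Lemma symdown_hook D : symdown (hook :|: lift2 ord0 @: D) = symdown D.
Proof.
apply/idP/idP => [/(@symdown_preim ord0)|/symdownP[sy dn]].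
  by congr symdown; apply/setP => x; rewrite !inE /= mem_imset; [|exact: lift2_inj].
apply/symdownP; split=> [i j|i j i' j']; rewrite !inE /=.
  case/orP => [/orP[]->|/imsetP[[a b] abD [-> ->]]]; rewrite ?orbT //.
  by apply/orP; right; apply/imsetP; exists (b, a) => //; apply: sy.
case: (unliftP ord0 i') => [i1 ->|->]; last by rewrite eqxx.
case: (unliftP ord0 j') => [j1 ->|->]; last by rewrite eqxx orbT.
case/orP => [/orP[]/eqP ->|]; rewrite ?lift0 ?ltn0 //.
case/imsetP => [[a b] abD [-> ->]]; rewrite !lift0 !ltnS => lei lej.
by apply/orP; right; apply/imsetP; exists (i1, j1) => //; apply: dn abD lei lej.
Qed.

End SymmetricDiagrams.

Section DiagramGeneratingFunction.
Local Open Scope ring_scope.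

(** The corner [(0, k)] decides. Without it, [D] avoids the last row and column and comes from a
    smaller square; with it, [D] contains the whole first row and column, and removing this hook
    leaves an arbitrary smaller diagram. *)
Lemma big_symdown_split (A : comNzRingType) k (F : {set 'I_k.+1 * 'I_k.+1} -> A) :
  \sum_(D | symdown D) F D = \sum_(D : {set 'I_k * 'I_k} | symdown D) F (lift2 ord_max @: D) +
    \sum_(D : {set 'I_k * 'I_k} | symdown D) F (hook k :|: lift2 ord0 @: D).
Proof.
rewrite (bigID (fun D : {set 'I_k.+1 * 'I_k.+1} => (ord0, ord_max) \notin D)) /=.
congr (_ + _).
  rewrite (reindex_onto (fun D : {set 'I_k * 'I_k} => lift2 ord_max @: D)
    (fun D : {set 'I_k.+1 * 'I_k.+1} => lift2 ord_max @^-1: D)) /=.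
    apply: eq_bigl => D.
    rewrite lift2K eqxx andbT symdown_widen andb_idr // => _.
    by apply/imsetP => -[[a b] _ /(congr1 snd) /= /eqP]; rewrite (negPf (neq_lift _ _)).
  move=> D /andP[/symdownP[sy dn] out]; rewrite [RHS](lift2_out ord_max).
  rewrite [X in _ = _ :|: X](_ : _ = finset.set0) ?finset.setU0 //.
  apply/setP => -[i j]; rewrite !inE /=; apply/negP => /andP[ijD /orP[]/eqP e].
    by move/negP: out; apply; apply: dn (sy _ _ ijD) _ _; rewrite ?e.
  by move/negP: out; apply; apply: dn ijD _ _; rewrite ?e.
rewrite (reindex_onto (fun D : {set 'I_k * 'I_k} => hook k :|: lift2 ord0 @: D)
    (fun D : {set 'I_k.+1 * 'I_k.+1} => lift2 ord0 @^-1: D)) /=.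
  have hK (D : {set 'I_k * 'I_k}) : lift2 ord0 @^-1: (hook k :|: lift2 ord0 @: D) = D.
    by apply/setP => x; rewrite !inE /= mem_imset; [|exact: lift2_inj].
  by apply: eq_bigl => D; rewrite hK eqxx andbT symdown_hook !inE eqxx /= andbT.
move=> D /andP[/symdownP[sy dn]]; rewrite negbK => inD; rewrite [RHS](lift2_out ord0) finset.setUC.
congr (_ :|: _); apply/setP => -[i j]; rewrite !inE /= andb_idl // => /orP[]/eqP ->.
  by apply: dn inD _ _; rewrite //= -ltnS.
by apply/sy; apply: dn inD _ _; rewrite //= -ltnS.
Qed.

Lemma symdown_gf (A : comNzRingType) (q : A) k :
  \sum_(D : {set 'I_k * 'I_k} | symdown D) q ^+ #|D| = \prod_(t < k) (1 + q ^+ t.*2.+1).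
Proof.
elim: k => [|k IH].
  rewrite big_ord0 (bigD1 finset.set0) /=; last by apply/symdownP; split=> [] [].
  by rewrite cards0 expr0 big1 ?addr0 // => D /andP[_ /set0Pn[[[]]]].
rewrite big_symdown_split big_ord_recr /= -IH mulrDr mulr1 mulr_suml.
congr (_ + _); apply: eq_bigr => D _; first by rewrite card_imset //; exact: lift2_inj.
rewrite cardsU disjoint_setI0 ?hook_disjoint // cards0 subn0 card_hook addnC exprD.
by rewrite card_imset //; exact: lift2_inj.
Qed.

(** The boxes outside the first row: it is their number that determines the weight, by
    [weight_floor]. *)
Definition lower_card k (D : {set 'I_k * 'I_k}) := #|[set x in D | x.1 != 0%N :> nat]|.

Lemma lower_card_widen k (D : {set 'I_k * 'I_k}) : lower_card (lift2 ord_max @: D) = lower_card D.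
Proof.
have lm (y : 'I_k * 'I_k) : nat_of_ord (lift2 ord_max y).1 = y.1 := lift_max y.1.
rewrite -[RHS](card_imset _ (@lift2_inj _ ord_max)); apply: eq_card => x; rewrite !inE.
apply/andP/imsetP => [[/imsetP[y yD ->]]|[y]]; first by rewrite lm => y1; exists y; rewrite ?inE ?yD.
by rewrite inE => /andP[yD y1] ->; rewrite mem_imset ?yD ?lm //; exact: lift2_inj.
Qed.

Lemma lower_card_hook k (D : {set 'I_k * 'I_k}) :
  lower_card (hook k :|: lift2 ord0 @: D) = (k + #|D|)%N.
Proof.
pose col : {set 'I_k.+1 * 'I_k.+1} := [set (lift ord0 i, ord0) | i in 'I_k].
have <- : (#|col| + #|lift2 ord0 @: D| = k + #|D|)%N.
  rewrite [#|lift2 _ @: _|]card_imset; last exact: lift2_inj.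
  by rewrite card_imset ?card_ord // => i j /(congr1 fst); apply: lift_inj.
rewrite -cardsUI [X in (_ + X)%N](_ : _ = 0%N); last first.
  apply/eqP; rewrite cards_eq0; apply/eqP/setP => x; rewrite !inE; apply/negP => /andP[/imsetP[i _ ->]].
  by case/imsetP => -[a b] _ /(congr1 snd) /= /eqP; rewrite (negPf (neq_lift _ _)).
rewrite addn0; apply: eq_card => -[i j]; rewrite !inE /=.
case: (unliftP ord0 i) => [i' ->|->]; last first.
  rewrite andbF; apply/esym/negP => /orP[/imsetP[a _]|/imsetP[[a b] _]] /(congr1 fst) /= /eqP.
    by rewrite (negPf (neq_lift _ _)).
  by rewrite (negPf (neq_lift _ _)).
rewrite lift0 andbT [_ == ord0]eq_sym (negPf (neq_lift _ _)) orFb; congr orb.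
apply/eqP/imsetP => [->|[a _ /(congr1 snd)] //]; by exists i'.
Qed.

(** The term of index [i] counts the diagrams with first row of length [i + 1]: the outer hook has
    [i] boxes below that row, and what it encloses is counted by [symdown_gf]. The 1 is the empty
    diagram. *)
Lemma lower_card_gf (A : comNzRingType) (q : A) k :
  \sum_(D : {set 'I_k * 'I_k} | symdown D) q ^+ lower_card D =
  1 + \sum_(i < k) q ^+ i * \prod_(t < i) (1 + q ^+ t.*2.+1).
Proof.
elim: k => [|k IH].
  rewrite big_ord0 (bigD1 finset.set0) /=; last by apply/symdownP; split=> [] [].
  rewrite /lower_card (_ : [set x in _ | _] = finset.set0); last by apply/setP => -[[]].
  by rewrite cards0 expr0 big1 ?addr0 // => D /andP[_ /set0Pn[[[]]]].
rewrite big_symdown_split big_ord_recr /= addrA -IH.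
congr (_ + _); first by apply: eq_bigr => D _; rewrite lower_card_widen.
by rewrite -symdown_gf mulr_sumr; apply: eq_bigr => D _; rewrite lower_card_hook exprD.
Qed.

End DiagramGeneratingFunction.

(** * Partitions and their floors *)

Section ShellPartitions.
Variable n : nat.
Local Notation I := 'I_n.+1.
Implicit Types (p : array n.+1) (A : {set I * I}).

Lemma card_ord_ltn m : m <= n.+1 -> #|[set c : I | c < m]| = m.
Proof.
move=> lem; have winj : injective (widen_ord lem) by move=> i j /(congr1 val) /= /val_inj.
rewrite -[RHS](card_ord m) -(card_imset _ winj).
apply: eq_card => c; rewrite !inE; apply/idP/imsetP => [ltcm|[i _ ->]].
  by exists (Ordinal ltcm) => //; apply: val_inj.
exact: (ltn_ord i).
Qed.

Lemma ltn_card_down (P : pred I) (c : I) : (forall a b : I, a <= b -> P b -> P a) ->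
  (c < #|[set a | P a]|) = P c.
Proof.
move=> dn; apply/idP/idP => [|Pc].
  apply: contraTT => nPc; rewrite -leqNgt -[in X in _ <= X](card_ord_ltn (ltnW (ltn_ord c))).
  apply/subset_leq_card/fintype.subsetP => a; rewrite !inE => Pa; rewrite ltnNge.
  by apply: contra nPc => leca; apply: dn Pa.
rewrite -[c.+1 in X in X <= _](card_ord_ltn (ltn_ord c)); apply/subset_leq_card/fintype.subsetP => a.
by rewrite !inE ltnS => leac; apply: dn Pc.
Qed.

Lemma leq_ltP m m' : m <= n.+1 -> (forall c : I, c < m -> c < m') -> m <= m'.
Proof.
move=> lem h; rewrite leqNgt; apply/negP => lt.
by have := h (Ordinal (leq_trans lt lem)) lt; rewrite ltnn.
Qed.

Lemma array_le p x : p x <= n.+1. Proof. by rewrite -ltnS. Qed.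

Lemma ord3P (i : 'I_3) : [\/ i = @Ordinal 3 0 isT, i = @Ordinal 3 1 isT | i = @Ordinal 3 2 isT].
Proof.
case: i => -[|[|[|//]]] h; [constructor 1 | constructor 2 | constructor 3]; exact: val_inj.
Qed.

(** The two conditions are invariance under two adjacent transpositions, which generate the
    symmetric group. *)
Lemma totally_symmetricP p :
  reflect ((forall a b : I, p (a, b) = p (b, a)) /\
           (forall a b c : I, (c < p (a, b)) = (b < p (a, c))))
    (totally_symmetric p).
Proof.
pose o0 := @Ordinal 3 0 isT; pose o1 := @Ordinal 3 1 isT; pose o2 := @Ordinal 3 2 isT.
apply: (iffP idP) => [ts|[s01 s12]].
  pose mk (a b c : I) : {ffun 'I_3 -> I} := [ffun i => if i == o0 then a else if i == o1 then b else c].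
  have h (s : 'S_3) a b c : in_diagram p [ffun i => mk a b c (s i)] = in_diagram p (mk a b c).
    by have /forallP/(_ (mk a b c))/eqP := forallP ts s.
  split=> [a b|a b c].
    apply/val_inj/eqP; rewrite eqn_leq; apply/andP; split; apply: leq_ltP; rewrite ?array_le // => c.
      by have := h (tperm o0 o1) a b c; rewrite /in_diagram !ffunE tpermL tpermR tpermD // !eqxx /= => <-.
    by have := h (tperm o0 o1) b a c; rewrite /in_diagram !ffunE tpermL tpermR tpermD // !eqxx /= => <-.
  by have := h (tperm o1 o2) a b c; rewrite /in_diagram !ffunE tpermL tpermR tpermD // !eqxx /= => <-.
apply/forallP => s; apply/forallP => x; apply/eqP; rewrite /in_diagram !ffunE.
have ne (i j : 'I_3) : i != j -> s i <> s j by move=> ij /perm_inj e; rewrite e eqxx in ij.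
have := ne o0 o1 isT; have := ne o0 o2 isT; have := ne o1 o2 isT.
case: (ord3P (s o0)) => ->; case: (ord3P (s o1)) => ->; case: (ord3P (s o2)) => -> // _ _ _.
all: by [rewrite s01 | rewrite s12 s01 | rewrite s01 s12 | rewrite s12 s01 s12].
Qed.

Definition shell_tspp p := [&& plane_partition p, totally_symmetric p & one_shell p].

Lemma self_conjugate_row p (b : I) :
  (forall a b c : I, (c < p (a, b)) = (b < p (a, c))) -> self_conjugate (fun j => p (b, j)).
Proof.
move=> s12; apply/forallP => k; rewrite -[X in _ == X](card_ord_ltn (array_le p (b, k))).
by apply/eqP/eq_card => j; rewrite !inE s12.
Qed.

Lemma shell_tsppP p :
  reflect [/\ forall a b : I, p (a, b) = p (b, a),
              forall a b c : I, (c < p (a, b)) = (b < p (a, c)),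
              forall a b b' : I, b <= b' -> p (a, b') <= p (a, b)
            & forall a b : I, 0 < a -> 0 < b -> p (a, b) <= 1]
    (shell_tspp p).
Proof.
apply: (iffP and3P) => [[pp /totally_symmetricP[s01 s12] /andP[_ os]]|[s01 s12 mn os]].
  split=> // [a b b' leb|a b a0 b0].
    by have /forallP/(_ b)/forallP/(_ b')/implyP/(_ leb)/andP[] := forallP pp a.
  case: (posnP (p (a, b))) => [->//|p0]; have /forallP/(_ b)/implyP := forallP os a.
  by rewrite -!lt0n a0 b0 p0 => /(_ isT)/eqP ->.
split.
- apply/forallP => a; apply/forallP => b; apply/forallP => b'; apply/implyP => leb.
  by rewrite ![p (_, a)]s01 !mn.
- by apply/totally_symmetricP.
apply/andP; split; apply/forallP => a; last first.
  apply/forallP => b; apply/implyP => /and3P[a0 b0 p0].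
  by rewrite eqn_leq lt0n p0 os // lt0n.
apply/implyP => _; rewrite self_conjugate_row //=.
apply/forallP => k; have /forallP/(_ k)/eqP h := self_conjugate_row a s12.
by rewrite s01 -h; apply/eqP/eq_card => j; rewrite !inE s01.
Qed.

(* The boxes of height 0; by total symmetry and the shell condition they        *)
(* determine all the others, see [solid].                                       *)
Definition floor p : {set I * I} := [set x | 0 < p x].

(** Off the first row and column the height is at most 1, so every box lies in a coordinate plane,
    where a copy of the floor decides. *)
Definition solid A (a b c : I) : bool :=
  [|| (a == ord0) && ((b, c) \in A), (b == ord0) && ((a, c) \in A) | (c == ord0) && ((a, b) \in A)].

Definition of_floor A : array n.+1 := [ffun x => inord #|[set c | solid A x.1 x.2 c]|].

Lemma of_floorE A (a b : I) : of_floor A (a, b) = #|[set c | solid A a b c]| :> nat.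
Proof. by rewrite ffunE inordK // ltnS -[X in _ <= X]card_ord max_card. Qed.

Lemma ltn_of_floor A (a b c : I) : symdown A -> (c < of_floor A (a, b)) = solid A a b c.
Proof.
move=> /symdownP[_ dn]; rewrite of_floorE ltn_card_down // => c1 c2 lec /or3P[] /andP[e0 h].
- by apply/or3P/Or31; rewrite e0 (dn _ _ _ _ h).
- by apply/or3P/Or32; rewrite e0 (dn _ _ _ _ h).
apply/or3P/Or33; rewrite h andbT -val_eqE -leqn0.
by move: e0 lec => /eqP ->.
Qed.

Lemma of_floorK A : symdown A -> floor (of_floor A) = A.
Proof.
move=> sA; apply/setP => -[a b]; rewrite inE (@ltn_of_floor A a b ord0 sA) /solid eqxx /=.
case/symdownP: sA => sy _; apply/or3P/idP => [[/andP[/eqP-> h]|/andP[/eqP-> h]|]|h] //.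
- exact: sy.
- by apply/Or33.
Qed.

Lemma shell_of_floor A : symdown A -> shell_tspp (of_floor A).
Proof.
move=> sA; have lt a b c := @ltn_of_floor A a b c sA; case/symdownP: (sA) => sy dn.
have syE a b : ((a, b) \in A) = ((b, a) \in A) by apply/idP/idP; apply: sy.
apply/shell_tsppP; split=> [a b|a b c|a b b' leb|a b a0 b0].
- apply/val_inj; rewrite /= !of_floorE; apply: eq_card => c; rewrite !inE /solid syE orbCA.
  by rewrite [(a, b) \in A]syE.
- by rewrite !lt /solid [(c, b) \in A]syE [X in _ || X]orbC.
- apply: leq_ltP => [|c]; first exact: array_le.
  rewrite !lt => /or3P[] /andP[e0 h].
  + by apply/or3P/Or31; rewrite e0 (dn _ _ _ _ h).
  + apply/or3P/Or32; rewrite h andbT -val_eqE -leqn0.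
    by move: e0 leb => /eqP ->.
  + by apply/or3P/Or33; rewrite e0 (dn _ _ _ _ h).
apply: leq_ltP => [|c]; first exact: array_le.
by rewrite lt => /or3P[] /andP[/eqP e _]; [rewrite e in a0 | rewrite e in b0 | rewrite e].
Qed.

Lemma symdown_floor p : shell_tspp p -> symdown (floor p).
Proof.
case/shell_tsppP => s01 _ mn _; apply/symdownP; split=> [i j|i j i' j']; rewrite !inE ?[p (j, i)]s01 //.
move=> p0 lei lej; apply: leq_trans p0 _; apply: (leq_trans (mn _ _ _ lej)).
by rewrite s01 [p (i', _)]s01 mn.
Qed.

Lemma floorK p : shell_tspp p -> of_floor (floor p) = p.
Proof.
move=> sp; have sA := symdown_floor sp; case/shell_tsppP: (sp) => s01 s12 mn os.
have fl a b : ((a, b) \in floor p) = (0 < p (a, b)) by rewrite inE.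
have low (b c : I) : (c < p (ord0, b)) = ((b, c) \in floor p).
  by rewrite fl s01 s12.
apply/ffunP => -[a b]; apply: val_inj; rewrite /= of_floorE -[RHS](card_ord_ltn (array_le p (a, b))).
apply: eq_card => c; rewrite !inE /solid !fl.
have z (i : I) : i != ord0 -> 0 < i by rewrite -val_eqE lt0n.
case: (eqVneq a ord0) => [->|a0] /=.
  rewrite low fl orb_idr // => /orP[] /andP[/eqP-> //].
  by rewrite s01.
case: (eqVneq b ord0) => [->|b0] /=.
  by rewrite [p (a, ord0)]s01 low fl orb_idr // => /andP[/eqP->]; rewrite s01.
case: (eqVneq c ord0) => [->|c0] //=.
apply/esym/negbTE; rewrite -leqNgt; apply: leq_trans (z _ c0).
by apply: os; apply: z.
Qed.

Lemma card_pair_sum A : #|A| = \sum_(a < n.+1) \sum_(b < n.+1) ((a, b) \in A).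
Proof.
rewrite -sum1_card big_mkcond pair_bigA /=; apply: eq_bigr => -[a b] _ /=.
by case: (_ \in _).
Qed.

(** Let the floor have [r] boxes in the first column below the corner and [s] outside the first row
    and column. The corner entry is [1 + r], the rest of the first row adds up to [r + s], as does
    the rest of the first column, and the interior gives [s]; and [lower_card] is [r + s]. *)
Lemma weight_floor p : shell_tspp p -> (ord0, ord0) \in floor p ->
  weight p = 3 * lower_card (floor p) + 1.
Proof.
move=> sp; case/shell_tsppP: (sp) => s01 s12 mn os.
have fl a b : ((a, b) \in floor p) = (0 < p (a, b)) by rewrite inE.
rewrite fl => p00.
have low (b : I) : p (ord0, b) = \sum_(c < n.+1) (0 < p (b, c)) :> nat.
  rewrite -[LHS](card_ord_ltn (array_le p _)) -sum1_card big_mkcond /=.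
  by apply: eq_bigr => c _; rewrite inE s01 s12; case: ifP.
have pos (i : 'I_n) : 0 < lift ord0 i by rewrite lift0.
have up (i j : 'I_n) : p (lift ord0 i, lift ord0 j) = (0 < p (lift ord0 i, lift ord0 j)) :> nat.
  by have := os _ _ (pos i) (pos j); case: (nat_of_ord (p _)) => [|[]].
have -> : weight p = \sum_(a < n.+1) \sum_(b < n.+1) p (a, b).
  by rewrite /weight pair_bigA; apply: eq_bigr => -[].
have -> : lower_card (floor p) = \sum_(i < n) \sum_(b < n.+1) (0 < p (lift ord0 i, b)).
  rewrite /lower_card card_pair_sum big_ord_recl big1 ?add0n => [|b _]; last by rewrite inE andbF.
  by apply: eq_bigr => i _; apply: eq_bigr => b _; rewrite inE fl /= andbT.
pose r := \sum_(i < n) (0 < p (lift ord0 i, ord0)).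
pose s := \sum_(i < n) \sum_(j < n) (0 < p (lift ord0 i, lift ord0 j)).
have rowE : \sum_(j < n) p (ord0, lift ord0 j) = r + s.
  by rewrite -big_split; apply: eq_bigr => j _; rewrite low big_ord_recl.
rewrite big_ord_recl big_ord_recl low big_ord_recl p00 rowE.
have -> : \sum_(i < n) \sum_(b < n.+1) p (lift ord0 i, b) = (r + s) + s.
  rewrite -rowE -big_split; apply: eq_bigr => i _ /=.
  by rewrite big_ord_recl s01; congr (_ + _); apply: eq_bigr => j _; rewrite -up.
have -> : \sum_(i < n) \sum_(b < n.+1) (0 < p (lift ord0 i, b)) = r + s.
  by rewrite -big_split; apply: eq_bigr => i _; rewrite big_ord_recl.
have -> : \sum_(i < n) (0 < p (ord0, lift ord0 i)) = r.
  by apply: eq_bigr => i _; rewrite s01.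
lia.
Qed.

Lemma weight_empty p : shell_tspp p -> (ord0, ord0) \notin floor p -> weight p = 0.
Proof.
case/shell_tsppP=> s01 _ mn _; rewrite inE -leqNgt leqn0 => /eqP p00.
apply: big1 => -[a b] _; apply/eqP; rewrite -leqn0 -p00.
by apply: leq_trans (mn a ord0 b _) _; rewrite // s01 mn.
Qed.

Lemma card_shell_tspp N : 0 < N ->
  #|[set p : array n.+1 | shell_tspp p && (weight p == N)]| =
  #|[set A : {set I * I} | symdown A && (A != finset.set0) && (3 * lower_card A + 1 == N)]|.
Proof.
move=> N0; rewrite -[RHS](card_in_imset (f := of_floor)); last first.
  move=> A B; rewrite !inE => /andP[/andP[sA _] _] /andP[/andP[sB _] _] /(congr1 floor).
  by rewrite !of_floorK.
apply: eq_card => p; rewrite inE; apply/andP/imsetP => [[sp /eqP w]|[A]].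
  exists (floor p); last by rewrite floorK.
  have p00 : (ord0, ord0) \in floor p.
    by apply: contraLR N0 => /(weight_empty sp) w0; rewrite -w w0.
  rewrite inE symdown_floor // -weight_floor // w eqxx andbT.
  by apply/set0Pn; exists (ord0, ord0).
rewrite inE => /andP[/andP[sA /set0Pn[[a b] abA]] w] ->.
split; first exact: shell_of_floor.
rewrite weight_floor ?of_floorK //; first exact: shell_of_floor.
by case/symdownP: sA => _ dn; apply: dn abA _ _.
Qed.

End ShellPartitions.

Section ShellCoefficients.
Local Open Scope ring_scope.
Local Notation K := 'F_11.

Lemma lower_card0 k : lower_card (finset.set0 : {set 'I_k * 'I_k}) = 0%N.
Proof. by apply/eqP; rewrite cards_eq0; apply/eqP/setP => x; rewrite !inE. Qed.

Lemma num_1shell_tsppE N : (0 < N)%N -> num_1shell_tspp N =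
  #|[set A : {set 'I_N * 'I_N} | symdown A && (A != finset.set0) && (3 * lower_card A + 1 == N)%N]|.
Proof.
case: N => // n _; rewrite -card_shell_tspp //; apply: eq_card => p.
by rewrite !inE /shell_tspp -!andbA.
Qed.

Lemma num_1shell_tspp_coeff m : (0 < m)%N ->
  (num_1shell_tspp (3 * m + 1))%:R = cf (shell K 0) m.
Proof.
move=> m0; set N := (3 * m + 1)%N; rewrite num_1shell_tsppE; last by rewrite /N addn1.
have t0 : tends0 (fun k => qX K ^+ (1 * k) * \prod_(t < k) (1 + qX K ^+ t.*2.+1)).
  by apply: tends0_qXn => k; rewrite mul1n.
rewrite /shell (eqm_sumf t0 (leqnn N)); last by rewrite /N; lia.
have -> : \sum_(i < N) qX K ^+ (1 * i) * \prod_(t < i) (1 + qX K ^+ t.*2.+1) =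
    \sum_(A : {set 'I_N * 'I_N} | symdown A) qX K ^+ lower_card A - 1.
  rewrite lower_card_gf addrC addKr; apply: eq_bigr => i _; by rewrite mul1n.
rewrite cfB cf1 gtn_eqF // subr0 cf_sum -sum1_card natr_sum big_mkcond [RHS]big_mkcond /=.
apply: eq_bigr => A _; rewrite inE cf_qXn (_ : (3 * lower_card A + 1 == N)%N = (m == lower_card A)).
  case: (symdown A) => //=; case: (eqVneq A finset.set0) => [->|_] /=; last by case: eqP.
  by rewrite lower_card0 gtn_eqF.
by rewrite /N eqn_add2r eqn_pmul2l // eq_sym.
Qed.

Lemma num_1shell_tspp_eq0 N : (0 < N)%N -> (N %% 3 != 1)%N -> num_1shell_tspp N = 0%N.
Proof.
move=> N0 N3; rewrite num_1shell_tsppE //; apply/eqP; rewrite cards_eq0; apply/eqP/setP => A.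
by rewrite !inE; apply/negP => /andP[_ /eqP e]; move: N3; rewrite -e mulnC modnMDl.
Qed.

Lemma eta_coeff_eq0 m n : (6 * m + 5 = 25 * n)%N -> (n %% 5 == 2)%N || (n %% 5 == 3)%N ->
  cf shell_even (11 * m + 9)%N = 0.
Proof.
move=> e n5; rewrite (cf_eta_quotient m shell_even_quotient).
have h := ternary_theta m; rewrite e (cf_theta_25 n5) in h.
suff -> : cf (phim K 1 * euler K 2 ^+ 10) m = 0 by rewrite mulr0.
move: h; move: (cf (phim K 1 * _) m) => x h.
have e24 : 6%:R * 24%:R = 1 :> K by exact: val_inj.
by rewrite -[x]mul1r -e24 -mulrA h mulr0.
Qed.

Lemma num_1shell_tspp_275 n : odd n -> (n %% 5 == 2)%N || (n %% 5 == 3)%N ->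
  num_1shell_tspp (275 * n) = 0 %[mod 11].
Proof.
move=> on n5; have n0 : (0 < n)%N by case: n on n5.
(* As 275 is 2 modulo 3, [275 n] is 1 modulo 3 only for [n] congruent to 2; otherwise the count is
   0. *)
have [n3|n3] := eqVneq (n %% 3)%N 2; last first.
  by rewrite num_1shell_tspp_eq0 //; lia.
(* Being odd and 2 modulo 3, [n] is 5 modulo 6. Then [275 n = 6 (11 m + 9) + 1] for [m = 25 t + 20],
   the solution of [6 m + 5 = 25 n]. *)
have [t nE] : exists t, n = (6 * t + 5)%N by exists (n %/ 6)%N; lia.
have -> : (275 * n = 3 * (11 * (25 * t + 20) + 9).*2 + 1)%N by rewrite nE; lia.
rewrite -val_Fp_nat // -[RHS]val_Fp_nat // num_1shell_tspp_coeff; last by lia.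
rewrite (_ : cf (shell K 0) _ = cf shell_even (11 * (25 * t + 20) + 9)%N) //.
by rewrite (eta_coeff_eq0 _ n5) //; rewrite nE; lia.
Qed.

End ShellCoefficients.

Theorem theorem1p2 (n : nat) :
  num_1shell_tspp (2750 * n + 825) = 0 %[mod 11] /\
  num_1shell_tspp (2750 * n + 1925) = 0 %[mod 11].
Proof.
have -> : 2750 * n + 825 = 275 * (10 * n + 3) by lia.
have -> : 2750 * n + 1925 = 275 * (10 * n + 7) by lia.
by split; apply: num_1shell_tspp_275; lia.
Qed.
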